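(* The sequence of estimators $\{T^X_N\}_N$ is asymptotically efficient for estimating $S^X$ for $P\in\mathcal{P}$, where $P$ is the cumulative distribution function of $(Y,Y^X)$. That is, $\{T_N^X\}_N$ is asymptotically efficient at $P$, relative to the model $\mathcal{P}$, for estimating $\psi(P)=S^X$, where $\psi(Q)=\mathrm{Cov}_Q(A,B)/\mathrm{Var}_Q(A)$ for $(A,B)\sim Q\in\mathcal{P}$ with $\mathrm{Var}_Q(A)\ne 0$.
   Context: Let $X\in\mathbb{R}^{p_1}$ and $Z\in\mathbb{R}^{p_2}$ be independent random vectors, $f$ a deterministic (measurable) real-valued function, $Z'$ an independent copy of $Z$, independent of $(X,Z)$, and $Y=f(X,Z)$, $Y^X=f(X,Z')$. Assume that $Y$ is square integrable and $\mathrm{Var}(Y)\neq 0$. The Sobol index is $S^X=\mathrm{Var}(\mathbb{E}(Y|X))/\mathrm{Var}(Y)=\mathrm{Cov}(Y,Y^X)/\mathrm{Var}(Y)$. Let $(X_i,Z_i,Z_i')_{i\ge 1}$ be i.i.d. copies of $(X,Z,Z')$, and $Y_i=f(X_i,Z_i)$, $Y_i^X=f(X_i,Z_i')$. With all sums over $i=1,\dots,N$, $$T^X_N = \frac{ \frac{1}{N} \sum Y_i Y_i^X - \left(\frac{1}{N} \sum \frac{Y_i+Y_i^X}{2}\right)^2 }{ \frac{1}{N}\sum \frac{Y_i^2+(Y_i^X)^2}{2} - \left( \frac{1}{N} \sum \frac{Y_i+Y_i^X}{2} \right)^2 }$$ (with an arbitrary fixed value when the denominator vanishes). Model: $\mathcal{P}$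 is the set of all cumulative distribution functions (identified with distributions) $Q$ of exchangeable square-integrable random vectors of $\mathbb{R}^2$, i.e. those with $Q(a,b)=Q(b,a)$ for all $(a,b)\in\mathbb{R}^2$. The distribution $P$ of $(Y,Y^X)$ belongs to $\mathcal{P}$. The observations are the i.i.d. pairs $(Y_i,Y_i^X)$. Asymptotic efficiency (semiparametric sense, van der Vaart, Asymptotic Statistics, Ch. 25): let $\dot{\mathcal{P}}$ be the set of bounded measurable $g:\mathbb{R}^2\to\mathbb{R}$ with $g(a,b)=g(b,a)$ for all $a,b$ and $\mathbb{E}_P(g)=0$; the tangent set of $\mathcal{P}$ at $P$ is the closure of $\dot{\mathcal{P}}$ in $L^2(P)$. For $g\in\dot{\mathcal{P}}$ and $|t|$ small let $dP_t^g=(1+tg)\,dP$. A real functional $\psi$ has efficient influence function $\widetilde\psi_P$ at $P$ if $\widetilde\psi_P$ belongs to the closure of $\dot{\mathcal{P}}$ in $L^2(P)$ and $\lim_{t\to0}(\psi(P_t^g)-\psi(P))/t=\mathbb{E}_P(\widetilde\psi_P\, g)$ for all $g\in\dot{\mathcal{P}}$. An estimator sequence $T_N$, a function of the first $N$ observations, is regular at $P$ if there is a fixed law $L$ such that for every $g\in\dot{\mathcal{P}}$, $\sqrt N\,(T_N-\psi(P^g_{1/\sqrt N}))$ converges in distribution to $L$ when the observations are i.i.d. from $P^g_{1/\sqrt N}$. It is asymptotically efficient at $P$ for estimating $\psi(P)$ if it is regular at $P$ with $L=\mathcal{N}(0,\mathbb{E}_P(\widetilde\psi_P^2))$.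
   Formalization: Efficiency is stated under the condition that an efficient influence function of ψ exists at P (in particular whenever E(Y^4) is finite); for merely square-integrable Y it may fail to exist, e.g. Y=X+Z with X, Z i.i.d. of finite variance and infinite fourth moment. *)

(* Defs.v *)
(* MathComp-Analysis *)
From HB Require Import structures.
From mathcomp Require Import all_boot all_order all_algebra.
From mathcomp Require Import all_classical all_reals all_analysis.

Set Implicit Arguments.
Unset Strict Implicit.
Unset Printing Implicit Defensive.

Import Order.TTheory GRing.Theory Num.Theory.
Import numFieldNormedType.Exports.

Local Open Scope classical_set_scope.
Local Open Scope ring_scope.

Section independence.
Context d (Om : measurableType d) (R : realType) (Pr : probability Om R).

Definition independent d1 d2 (T1 : measurableType d1) (T2 : measurableType d2)
    (U : Om -> T1) (V : Om -> T2) : Prop :=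
  forall (A : set T1) (B : set T2), measurable A -> measurable B ->
    Pr (U @^-1` A `&` V @^-1` B) = (Pr (U @^-1` A) * Pr (V @^-1` B))%E.

(* Mutual independence: taking B i = setT for the indices i outside a given set
   yields the product rule for every subfamily. *)
Definition iid d1 (T1 : measurableType d1) n
    (W : 'I_n -> {RV Pr >-> T1}) (Q : probability T1 R) : Prop :=
  (forall i (B : set T1), measurable B -> distribution Pr (W i) B = Q B) /\
  (forall B : 'I_n -> set T1, (forall i, measurable (B i)) ->
    Pr [set w | forall i, B i (W i w)] =
    (\prod_(i < n) fine (Pr (W i @^-1` B i)))%:E).

(* [m] is a version of E(Y | X). *)
Definition is_cond_expectation d1 (T1 : measurableType d1)
    (X : Om -> T1) (Y : Om -> R) (m : Om -> R) : Prop :=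
  [/\ exists2 phi : T1 -> R, measurable_fun setT phi & m = phi \o X,
      Pr.-integrable setT (EFin \o m) &
      forall A : set T1, measurable A ->
        (\int[Pr]_(w in X @^-1` A) (m w)%:E =
         \int[Pr]_(w in X @^-1` A) (Y w)%:E)%E].

Definition cond_expectation d1 (T1 : measurableType d1)
    (X : Om -> T1) (Y : Om -> R) : Om -> R :=
  xget (cst 0) [set m | is_cond_expectation X Y m].

Definition sobol_index d1 (T1 : measurableType d1)
    (X : Om -> T1) (Y : Om -> R) : R :=
  fine 'V_Pr[cond_expectation X Y] / fine 'V_Pr[Y].

End independence.

(* The pair (Y, Y^X) as a random vector of R^2. *)
Section pick_freeze.
Context d (Om : measurableType d) d1 (T1 : measurableType d1)
  d2 (T2 : measurableType d2) (R : realType).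
Variables (f : {mfun (T1 * T2)%type >-> R}) (X : {mfun Om >-> T1})
  (Z Z' : {mfun Om >-> T2}).

Definition output : Om -> R := fun w => f (X w, Z w).

Definition pick_freeze_pair : Om -> R * R :=
  fun w => (f (X w, Z w), f (X w, Z' w)).

Lemma measurable_pick_freeze_pair : measurable_fun setT pick_freeze_pair.
Proof.
apply: measurable_fun_pair; apply: measurableT_comp => //;
  exact: measurable_fun_pair.
Qed.

HB.instance Definition _ :=
  isMeasurableFun.Build _ _ _ _ pick_freeze_pair
    measurable_pick_freeze_pair.

End pick_freeze.

Section model.
Context (R : realType).
Implicit Types (P Q : probability (R * R)%type R).

Definition exchangeable_model : set (probability (R * R)%type R) :=
  [set Q | [/\ (fst : R * R -> R) \in Lfun Q 2%:E,
               (snd : R * R -> R) \in Lfun Q 2%:E &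
               forall a b : R,
                 Q (`]-oo, a] `*` `]-oo, b]) = Q (`]-oo, b] `*` `]-oo, a])]].

Definition psi Q : R :=
  fine (covariance Q (fst : R * R -> R) (snd : R * R -> R)) /
  fine 'V_Q[(fst : R * R -> R)].

Definition score_set P : set (R * R -> R) :=
  [set g : R * R -> R |
    [/\ measurable_fun setT g,
        exists M : R, forall x, `|g x| <= M,
        forall a b : R, g (a, b) = g (b, a) &
        ('E_P[g] = 0)%E]].

(* Closure of [score_set P] in L^2(P). *)
Definition tangent_set P : set (R * R -> R) :=
  [set h : R * R -> R |
    h \in Lfun P 2%:E /\
    forall e : R, 0 < e -> exists2 g, score_set P g &
      ('N[P]_(2%:E)[EFin \o (h \- g)%R] < e%:E)%E].

(* dP_t^g = (1 + t g) dP. For g in [score_set P] such a probability exists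
   when |t| is small, which is all that the limits below involve; it is
   determined on measurable sets. The value P is junk. *)
Definition tilt P (g : R * R -> R) (t : R) : probability (R * R)%type R :=
  xget P [set Q : probability (R * R)%type R |
    forall A, measurable A -> Q A = (\int[P]_(x in A) (1 + t * g x)%:E)%E].

Definition efficient_influence_function
    (phi : probability (R * R)%type R -> R) P (h : R * R -> R) : Prop :=
  tangent_set P h /\
  forall g, score_set P g ->
    (phi (tilt P g t) - phi P) / t @[t --> 0^'] --> \int[P]_x (h x * g x).

(* N(0, v). The library's [normal_prob 0 0] is a uniform law, hence the case
   distinction. *)
Definition centered_normal (v : R) : probability (measurableTypeR R) R :=
  if v == 0 then (dirac (0 : measurableTypeR R) : probability _ R)
  else (normal_prob 0 (Num.sqrt v) : probability (measurableTypeR R) R).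

(* Convergence of the cdfs at the continuity points of the limit cdf. *)
Definition cvg_in_distribution (d : nat -> measure_display)
    (Om : forall N, measurableType (d N))
    (Pr : forall N, probability (Om N) R)
    (S : forall N, Om N -> R) (L : probability (measurableTypeR R) R) : Prop :=
  forall x : R, {for x, continuous (fun y : R => L `]-oo, y]%classic)} ->
    Pr N [set w | S N w <= x] @[N --> \oo] --> L `]-oo, x]%classic.

(* The N observations under P^g_{1/sqrt N} may live on a probability space that
   depends on N. *)
Definition regular_with_limit (T : forall N, N.-tuple (R * R) -> R)
    (phi : probability (R * R)%type R -> R) P
    (L : probability (measurableTypeR R) R) : Prop :=
  (forall N, measurable_fun setT (T N)) /\
  forall g, score_set P g ->
  forall (d : nat -> measure_display) (Om : forall N, measurableType (d N))
    (Pr : forall N, probability (Om N) R)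
    (W : forall N, 'I_N -> {RV (Pr N) >-> (R * R)%type}),
    (forall N, iid (W N) (tilt P g (Num.sqrt N%:R)^-1)) ->
    cvg_in_distribution Pr
      (fun N w => Num.sqrt N%:R *
         (T N [tuple W N i w | i < N] - phi (tilt P g (Num.sqrt N%:R)^-1))) L.

(* Includes the existence of the efficient influence function, which can fail
   for [psi] when P has infinite fourth moments: the derivative of [psi] is then
   given by a function that need not be in L^2(P). *)
Definition asymptotically_efficient (T : forall N, N.-tuple (R * R) -> R)
    (phi : probability (R * R)%type R -> R) P : Prop :=
  exists2 h, efficient_influence_function phi P h &
    regular_with_limit T phi P (centered_normal (\int[P]_x (h x ^+ 2))).

(* The estimator T^X_N as a function of the pairs (Y_i, Y_i^X); [c] is its
   value when the denominator vanishes. *)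
Definition sobol_estimator (c : R) (N : nat) (w : N.-tuple (R * R)) : R :=
  let mean (F : R * R -> R) := N%:R^-1 * \sum_(i < N) F (tnth w i) in
  let center := mean (fun y => (y.1 + y.2) / 2) in
  let num := mean (fun y => y.1 * y.2) - center ^+ 2 in
  let den := mean (fun y => (y.1 ^+ 2 + y.2 ^+ 2) / 2) - center ^+ 2 in
  if den == 0 then c else num / den.

End model.

(* Main.v *)
Require Import Defs.
From HB Require Import structures.
From mathcomp Require Import all_boot all_order all_algebra.
From mathcomp Require Import all_classical all_reals all_analysis measurable_realfun.
From mathcomp Require Import ring lra.

(** Write m and v for the mean and the variance of a coordinate under P. Both
    efficiency claims rest on one explicit function, [influence]:
      phi(a, b) = ((a - m)(b - m) - psi(P) ((a - m)^2 + (b - m)^2) / 2) / v.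
    Moments are affine in t along the tilts (1 + t g) dP, so psi is a rational
    function of t there, and for exchangeable P its derivative at 0 is E (phi g)
    ([psi_derivative]). If phi is square integrable, its recentred truncations are
    scores that converge to it, and phi is the efficient influence function
    ([tangent_of_L2]). Conversely, if h is an efficient influence function, then h
    and phi have the same pairing with every score; testing on the truncations of
    phi bounds the norm of phi by that of h ([L2_of_pairing]). Finite fourth moments
    also make phi square integrable. What remains is regularity with the limit
    N(0, E (phi^2)).

    For regularity put t = 1 / sqrt N. The estimator is a quotient num / den, and with
    normalized sums G, C, D of phi, of the centre and of the squares,
      den = v + D - t C^2,   num - psi(P) den = v t (G + e) - (1 - psi(P)) t C^2,
    where e = E (phi g). Under the tilts C and D vanish in probability, while
    (psi(P_t) - psi(P)) / t tends to e; hence sqrt N (T_N - psi(P_t)) behaves like G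
    ([event_comparison]). The summands of G are centred under the tilt, with
    variances close to E (phi^2) / N, and their sum is treated by Lindeberg's
    replacement argument: the law of one summand acts on functions by [average], N
    iterations give the law of the sum ([E_partial_sum]), and on smooth functions
    one step differs from a step N(0, E (phi^2) / N) by o(1 / N) uniformly
    ([levy_clt]). The degenerate case of the same theorem gives the convergence to 0
    of C and D ([vanishing_row_sum]).

    As for the pick-freeze pair, ((X, Z), Z') and ((X, Z'), Z) have the same law, the
    product of those of X, Z and Z, so that P is exchangeable. By Fubini the
    integral of f(x, z) over the law of Z is a version of E (Y | X), and the mean of
    Y Y^X, which is the integral of f(x, z) f(x, z'), is the second moment of this
    version ([variance_cond_expectation]): psi(P) is the Sobol index. *)

Set Implicit Arguments.
Unset Strict Implicit.
Unset Printing Implicit Defensive.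

Import Order.TTheory GRing.Theory Num.Theory.
Import numFieldNormedType.Exports.

Local Open Scope classical_set_scope.
Local Open Scope ring_scope.

(** * Real-valued expectations *)

Notation L1 P f := (P.-integrable [set: _] (EFin \o f)).

Lemma sqr_norm (R : realDomainType) (x : R) : `|x| ^+ 2 = x ^+ 2.
Proof. exact/real_normK/num_real. Qed.

Section real_expectation.
Context d (T : measurableType d) (R : realType) (P : probability T R).
Implicit Types f g : T -> R.

Lemma L1_measurable f : L1 P f -> measurable_fun setT f.
Proof. by move=> /measurable_int /measurable_EFinP. Qed.

Lemma L1D f g : L1 P f -> L1 P g -> L1 P (fun x => f x + g x).
Proof. by move=> Lf Lg; apply: (integrableD _ Lf Lg). Qed.

Lemma L1B f g : L1 P f -> L1 P g -> L1 P (fun x => f x - g x).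
Proof. by move=> Lf Lg; apply: (integrableB _ Lf Lg). Qed.

Lemma L1Zl k f : L1 P f -> L1 P (fun x => k * f x).
Proof. by move=> Lf; apply: (integrableZl _ _ Lf). Qed.

Lemma L1_cst k : L1 P (fun=> k).
Proof. exact: finite_measure_integrable_cst. Qed.

Lemma L1_le f g : measurable_fun setT f -> L1 P g ->
  (forall x, `|f x| <= g x) -> L1 P f.
Proof.
move=> mf Lg fg; apply: le_integrable Lg => //; first exact/measurable_EFinP.
by move=> x _ /=; rewrite lee_fin (le_trans (fg x)) ?ler_norm.
Qed.

Lemma L1_bounded f K : measurable_fun setT f -> (forall x, `|f x| <= K) ->
  L1 P f.
Proof. by move=> mf fK; apply: L1_le (L1_cst K) _. Qed.

Lemma L1_norm f : L1 P f -> L1 P (fun x => `|f x|).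
Proof. exact: integrable_norm. Qed.

Lemma L1Mb f g K : L1 P f -> measurable_fun setT g ->
  (forall x, `|g x| <= K) -> L1 P (fun x => f x * g x).
Proof.
move=> Lf mg gK; apply: L1_le (L1Zl K (L1_norm Lf)) _.
  by apply: measurable_funM => //; exact: L1_measurable.
by move=> x; rewrite normrM mulrC ler_wpM2r.
Qed.

Lemma ED f g : L1 P f -> L1 P g ->
  \int[P]_x (f x + g x) = \int[P]_x f x + \int[P]_x g x.
Proof. by move=> Lf Lg; rewrite RintegralD. Qed.

Lemma EB f g : L1 P f -> L1 P g ->
  \int[P]_x (f x - g x) = \int[P]_x f x - \int[P]_x g x.
Proof. by move=> Lf Lg; rewrite RintegralB. Qed.

Lemma EZl k f : L1 P f -> \int[P]_x (k * f x) = k * \int[P]_x f x.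
Proof. by move=> Lf; rewrite RintegralZl. Qed.

Lemma Ecst k : \int[P]_x k = k :> R.
Proof.
transitivity (k * fine (P setT)); first exact: Rintegral_cst.
by rewrite probability_setT mulr1.
Qed.

Lemma Ele f g : L1 P f -> L1 P g -> (forall x, f x <= g x) ->
  \int[P]_x f x <= \int[P]_x g x.
Proof. by move=> Lf Lg fg; apply: le_Rintegral. Qed.

Lemma Ele_norm f g : L1 P f -> L1 P g -> (forall x, `|f x| <= g x) ->
  `|\int[P]_x f x| <= \int[P]_x g x.
Proof.
move=> Lf Lg fg; apply: le_trans (le_normr_Rintegral _ Lf) _ => //.
by apply: Ele => //; exact: L1_norm.
Qed.

Lemma EFinE f : L1 P f -> (\int[P]_x (f x)%:E)%E = (\int[P]_x f x)%:E.
Proof. by move=> Lf; rewrite fineK//; exact: integrable_fin_num. Qed.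

Definition L2 f := measurable_fun setT f /\ L1 P (fun x => f x ^+ 2).

Lemma L2_Lfun f : L2 f <-> f \in Lfun P 2%:E.
Proof.
split=> [[mf /integrableP[_ Lf]]|Lf]; last first.
  split; last exact: Lfun2_integrable_sqr.
  by move: Lf; rewrite inE => /andP[] /[!inE].
rewrite inE; apply/andP; split; rewrite inE//= /finite_norm unlock/=.
rewrite poweR_lty//; apply: le_lt_trans Lf.
apply: ge0_le_integral => //=.
- apply/measurable_EFinP.
  apply/(@measurableT_comp _ _ _ _ _ _ (fun x : R => x `^ 2)%R) => //.
  exact/measurableT_comp.
- apply/measurable_EFinP; apply: measurableT_comp => //.
  exact: measurable_funX.
- by move=> x _; rewrite lee_fin powR_mulrn// -normrX.
Qed.

Lemma L2_cst k : L2 (fun=> k).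
Proof. by split=> //; exact: L1_cst. Qed.

Lemma L2M f g : L2 f -> L2 g -> L1 P (fun x => f x * g x).
Proof.
move=> [mf Lf] [mg Lg]; apply: L1_le (L1D Lf Lg) _.
  exact: measurable_funM.
move=> x; rewrite normrM -[f x ^+ 2]sqr_norm -[g x ^+ 2]sqr_norm.
have := sqr_ge0 (`|f x| - `|g x|); have := normr_ge0 (f x).
by have := normr_ge0 (g x); nra.
Qed.

Lemma L2_L1 f : L2 f -> L1 P f.
Proof.
move=> Lf; have := L2M Lf (L2_cst 1).
by congr (L1 P _); apply/funext => x; rewrite mulr1.
Qed.

Lemma L2Zl k f : L2 f -> L2 (fun x => k * f x).
Proof.
move=> [mf Lf]; split; first exact: measurable_funM.
have := L1Zl (k ^+ 2) Lf; congr (L1 P _).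
by apply/funext => x; rewrite exprMn.
Qed.

Lemma L2D f g : L2 f -> L2 g -> L2 (fun x => f x + g x).
Proof.
move=> Lf Lg; split; first by apply: measurable_funD; [case: Lf|case: Lg].
have := L1D (L1D Lf.2 (L1Zl 2 (L2M Lf Lg))) Lg.2; congr (L1 P _).
by apply/funext => x; ring.
Qed.

Lemma L2B f g : L2 f -> L2 g -> L2 (fun x => f x - g x).
Proof.
move=> Lf Lg; have := L2D Lf (L2Zl (-1) Lg); congr L2.
by apply/funext => x; rewrite mulN1r.
Qed.

Lemma L2_le f g : measurable_fun setT f -> L2 g -> (forall x, `|f x| <= `|g x|) ->
  L2 f.
Proof.
move=> mf [mg Lg] fg; split => //; apply: L1_le Lg _.
  exact: measurable_funX.
by move=> x; rewrite ger0_norm ?sqr_ge0// -sqr_norm -[leRHS]sqr_norm lerXn2r ?nnegrE.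
Qed.

Lemma L2_bounded f K : measurable_fun setT f -> (forall x, `|f x| <= K) -> L2 f.
Proof.
move=> mf fK; apply: L2_le (L2_cst K) _ => // x.
by rewrite (le_trans (fK x))// ler_norm.
Qed.

Lemma dominated_E (f_ : nat -> T -> R) f g :
  (forall n, measurable_fun setT (f_ n)) -> measurable_fun setT f -> L1 P g ->
  (forall n x, `|f_ n x| <= g x) ->
  (forall x, f_ n x @[n --> \oo] --> f x) ->
  \int[P]_x f_ n x @[n --> \oo] --> \int[P]_x f x.
Proof.
move=> mf_ mf Lg fg f_f.
have Lf_ n : L1 P (f_ n) by apply: L1_le Lg _.
have Lf : L1 P f.
  apply: L1_le Lg _ => // x.
  have := f_f x => /cvg_norm fx.
  by apply: ler_cvg_to fx (@cvg_cst _ (g x) _ _ _) _; apply: nearW => n; exact: fg.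
suff : (\int[P]_x (f_ n x)%:E @[n --> \oo] --> \int[P]_x (f x)%:E)%E.
  by rewrite (EFinE Lf) => /fine_cvg.
have [] := @dominated_convergence _ T R P setT measurableT
  (fun n => EFin \o f_ n) (EFin \o f) (EFin \o g) => //.
- by move=> n; exact/measurable_EFinP.
- exact/measurable_EFinP.
- by apply: aeW => x _; apply: cvg_EFin; [exact: nearW|exact: f_f].
- by apply: aeW => x n _ /=; rewrite lee_fin.
Qed.

End real_expectation.

Section probability_bounds.
Context d (T : measurableType d) (R : realType) (Pr : probability T R).
Implicit Types A B : set T.

Lemma fine_prob_le A B : measurable A -> measurable B -> A `<=` B ->
  fine (Pr A) <= fine (Pr B).
Proof.
move=> mA mB AB; apply: fine_le; rewrite ?fin_num_measure//.
by apply: le_measure; rewrite ?inE.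
Qed.

Lemma fine_probU A B : measurable A -> measurable B ->
  fine (Pr (A `|` B)) <= fine (Pr A) + fine (Pr B).
Proof.
move=> mA mB; rewrite -fineD ?fin_num_measure//.
apply: fine_le; rewrite ?fin_numD ?fin_num_measure//; first exact: measurableU.
exact: measureU2.
Qed.

Lemma fine_probC A : measurable A -> fine (Pr (~` A)) = 1 - fine (Pr A).
Proof.
by move=> mA; rewrite probability_setC// fineB// fin_num_measure.
Qed.

Lemma measurable_le (S : T -> R) y : measurable_fun setT S -> measurable [set w | S w <= y].
Proof.
move=> mS; have -> : [set w | S w <= y] = S @^-1` `]-oo, y]%classic.
  by apply/seteqP; split=> w /=; rewrite in_itv.
by rewrite -[X in measurable X]setTI; exact: mS.
Qed.

Lemma measurable_norm_gt (S : T -> R) y : measurable_fun setT S ->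
  measurable [set w | y < `|S w|].
Proof.
move=> mS; rewrite (_ : [set w | _] = ~` [set w | `|S w| <= y]).
  by apply/measurableC/measurable_le; exact: measurableT_comp.
by apply/seteqP; split=> w /=; rewrite ltNge => /negP.
Qed.

End probability_bounds.

(** * Densities *)

Section density.
Context d (T : measurableType d) (R : realType).
Variables (mu Q : {measure set T -> \bar R}) (w : T -> R).
Hypothesis mw : measurable_fun setT w.
Hypothesis w0 : forall x, 0 <= w x.
Hypothesis QE : forall A, measurable A -> Q A = (\int[mu]_(x in A) (w x)%:E)%E.
Local Open Scope ereal_scope.

Let mEw : measurable_fun setT (EFin \o w).
Proof. exact/measurable_EFinP. Qed.

Import HBNNSimple.

Let density_indic (r : R) E : (0 <= r)%R -> measurable E ->
  \int[Q]_x (r * \1_E x)%:E = \int[mu]_x ((r * \1_E x)%:E * (w x)%:E).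
Proof.
move=> r0 mE; under [RHS]eq_integral do rewrite EFinM -muleA.
under [LHS]eq_integral do rewrite EFinM.
rewrite !ge0_integralZl//; last 3 first.
- by apply: emeasurable_funM => //; exact/measurable_EFinP/measurable_indic.
- by move=> x _; rewrite mule_ge0 ?lee_fin.
- exact/measurable_EFinP/measurable_indic.
congr (_ * _); rewrite integral_indic// setIT QE//.
rewrite integral_mkcond; apply: eq_integral => x _.
rewrite /patch indicE; case: ifPn => _; by rewrite ?mul1e ?mul0e.
Qed.

Let density_nnsfun (h : {nnsfun T >-> R}) :
  \int[Q]_x (h x)%:E = \int[mu]_x ((h x)%:E * (w x)%:E).
Proof.
under [LHS]eq_integral do rewrite fimfunE -fsumEFin//.
rewrite [LHS]ge0_integral_fsum//; last 2 first.
  - by move=> r; exact/measurable_EFinP/measurableT_comp.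
  - by move=> n x _; rewrite EFinM nnfun_muleindic_ge0.
under [RHS]eq_integral.
  move=> x xD; rewrite fimfunE -fsumEFin// ge0_mule_fsuml; last first.
    by move=> r; rewrite EFinM nnfun_muleindic_ge0.
  over.
rewrite [RHS]ge0_integral_fsum//; last 2 first.
  - move=> r; apply: emeasurable_funM => //.
    by apply/measurable_EFinP; do 2 apply/measurableT_comp => //.
  - move=> n x _; apply: mule_ge0; last by rewrite lee_fin.
    by rewrite EFinM nnfun_muleindic_ge0.
apply: eq_fsbigr => r _; have [r0|r0] := leP 0%R r; first exact: density_indic.
rewrite preimage_nnfun0//; under eq_integral do rewrite indic0 mulr0.
by under [RHS]eq_integral do rewrite indic0 mulr0 mul0e; rewrite !integral0.
Qed.

(** The identity holds for indicators by the definition of Q, hence for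
    nonnegative simple functions by linearity, hence for their monotone limits. *)
Lemma ge0_integral_density (f : T -> \bar R) : measurable_fun setT f ->
  (forall x, 0 <= f x) -> \int[Q]_x f x = \int[mu]_x (f x * (w x)%:E).
Proof.
move=> mf f0; pose f_ := nnsfun_approx measurableT mf.
transitivity (limn (fun n => \int[Q]_x (f_ n x)%:E)).
  rewrite -monotone_convergence//=.
  - apply: eq_integral => x /[!inE] xD; apply/esym/cvg_lim => //=.
    exact: cvg_nnsfun_approx.
  - by move=> n; apply: measurableT_comp => //; exact: measurable_funTS.
  - by move=> n x _; rewrite lee_fin.
  - by move=> x _ a b ab; rewrite lee_fin//; exact/lefP/nd_nnsfun_approx.
have -> : \int[mu]_x (f x * (w x)%:E) =
    limn (fun n => \int[mu]_x ((f_ n x)%:E * (w x)%:E)).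
  rewrite -monotone_convergence//=.
  - apply: eq_integral => x /[!inE] xD; apply/esym/cvg_lim => //.
    apply: cvgeZr => //; exact: cvg_nnsfun_approx.
  - by move=> n; apply: emeasurable_funM => //; exact/measurable_EFinP/measurable_funTS.
  - by move=> n x _; rewrite mule_ge0 ?lee_fin.
  - move=> x _ a b ab; rewrite lee_wpmul2r ?lee_fin//.
    exact/lefP/nd_nnsfun_approx.
by congr (limn _); apply/funext => n; exact: density_nnsfun.
Qed.

Lemma integral_density (f : T -> R) : measurable_fun setT f ->
  \int[Q]_x (f x)%:E = \int[mu]_x (f x * w x)%:E.
Proof.
move=> mf; have mEf : measurable_fun setT (EFin \o f) by exact/measurable_EFinP.
rewrite integralE [RHS]integralE; congr (_ - _).
  rewrite ge0_integral_density//; last exact: measurable_funepos.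
  by apply: eq_integral => x _; rewrite !funeposE/= -!EFin_max -EFinM maxr_pMl ?mul0r.
rewrite ge0_integral_density//; last exact: measurable_funeneg.
by apply: eq_integral => x _; rewrite !funenegE/= -!EFin_max -EFinM maxr_pMl ?mul0r ?mulNr.
Qed.

Lemma L1_density (f : T -> R) : measurable_fun setT f ->
  L1 mu (fun x => f x * w x)%R -> L1 Q f.
Proof.
move=> mf /integrableP[_ Lf]; apply/integrableP; split; first exact/measurable_EFinP.
rewrite ge0_integral_density//; last by apply/measurableT_comp => //; exact/measurable_EFinP.
apply: le_lt_trans Lf; rewrite le_eqVlt; apply/orP; left; apply/eqP.
by apply: eq_integral => x _; rewrite /= normrM EFinM (ger0_norm (w0 x)).
Qed.

End density.

(** * Tilted laws *)

Section density_probability.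
Context d (T : measurableType d) (R : realType) (P : probability T R).
Variable w : T -> R.
Hypothesis Lw : L1 P w.
Hypothesis w0 : forall x, 0 <= w x.
Hypothesis w1 : \int[P]_x w x = 1.

(** The hypotheses on w are arguments, so that the instances of measure and of
    probability below can be attached to the function itself. *)
Definition density_prob (_ : L1 P w) (_ : forall x, 0 <= w x)
    (_ : \int[P]_x w x = 1) : set T -> \bar R :=
  fun A => (\int[P]_(x in A) (w x)%:E)%E.

Local Notation D := (density_prob Lw w0 w1).

Let density0 : D set0 = 0%E.
Proof. by rewrite /density_prob integral_set0. Qed.

Let density_ge0 A : (0 <= D A)%E.
Proof. by apply: integral_ge0 => x _; rewrite lee_fin. Qed.

Let density_sigma_additive : semi_sigma_additive D.
Proof.
move=> /= F mF tF mUF; rewrite /density_prob integral_bigcup//=; last first.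
  exact: (integrableS _ _ (subsetT _)).
apply: is_cvg_ereal_nneg_natsum_cond => n _ _.
by apply: integral_ge0 => x _; rewrite lee_fin.
Qed.

HB.instance Definition _ := isMeasure.Build _ _ _
  D density0 density_ge0 density_sigma_additive.

Let density_setT : D setT = 1%E.
Proof. by rewrite /density_prob EFinE// w1. Qed.

HB.instance Definition _ :=
  @Measure_isProbability.Build _ _ R D density_setT.

Lemma exists_density_prob : exists Q : probability T R,
  forall A, measurable A -> Q A = (\int[P]_(x in A) (w x)%:E)%E.
Proof. by exists D. Qed.

End density_probability.

Section tilt.
Context (R : realType) (P : probability (R * R)%type R).
Variables (g : R * R -> R) (M : R).
Hypothesis mg : measurable_fun setT g.
Hypothesis gM : forall x, `|g x| <= M.
Hypothesis g0 : \int[P]_x g x = 0.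
Variable t : R.
Hypothesis tM : `|t| * M <= 1.

Let Lg : L1 P g. Proof. exact: L1_bounded gM. Qed.

Let w x := 1 + t * g x.

Let mw : measurable_fun setT w.
Proof. by apply: measurable_funD => //; exact: measurable_funM. Qed.

Let Lw : L1 P w.
Proof. by apply: L1D; [exact: L1_cst|exact: L1Zl]. Qed.

Let tg1 x : `|t * g x| <= 1.
Proof. by rewrite normrM (le_trans _ tM)// ler_wpM2l. Qed.

Let w0 x : 0 <= w x.
Proof. by have := tg1 x; rewrite ler_norml => /andP[+ _]; rewrite /w; lra. Qed.

Let w1 : \int[P]_x w x = 1.
Proof.
rewrite ED; [|exact: L1_cst|exact: L1Zl].
by rewrite Ecst EZl// g0 mulr0 addr0.
Qed.

(** [tilt] is a choice among the probabilities with density 1 + t g, and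
    [density_prob] shows that the choice is not vacuous when |t| M <= 1. *)
Lemma tiltE A : measurable A ->
  tilt P g t A = (\int[P]_(x in A) (1 + t * g x)%:E)%E.
Proof.
rewrite /tilt; case: xgetP => [Q _|nQ]; first exact.
by have [Q QE] := exists_density_prob Lw w0 w1; have := nQ Q.
Qed.

Lemma L1_tilt f : L1 P f -> L1 (tilt P g t) f.
Proof.
move=> Lf; apply: (L1_density mw w0 tiltE); first exact: L1_measurable Lf.
apply: (@L1Mb _ _ _ _ _ _ 2) => // x.
by have := tg1 x; rewrite /w !ler_norml => /andP[? ?]; lra.
Qed.

(** Moments are affine in t along a tilt. This makes psi a rational function of t
    and its derivative explicit. *)
Lemma E_tilt f : L1 P f ->
  \int[tilt P g t]_x f x = \int[P]_x f x + t * \int[P]_x (f x * g x).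
Proof.
move=> Lf; rewrite /Rintegral (integral_density mw w0 tiltE); last first.
  exact: L1_measurable Lf.
have Lfg : L1 P (fun x => f x * g x) by exact: L1Mb gM.
rewrite -/(Rintegral P setT (fun x => f x * w x)) -EZl// -ED//; last exact: L1Zl.
by apply: eq_Rintegral => x _; rewrite /w; ring.
Qed.

Lemma L2_tilt f : L2 P f -> L2 (tilt P g t) f.
Proof. by move=> [mf Lf]; split => //; exact: L1_tilt. Qed.

(** The density 1 + t g is at most 2: whatever is small in mean under P is small
    under all the tilts at once. *)
Lemma E_tilt_le f : L1 P f -> (forall x, 0 <= f x) ->
  \int[tilt P g t]_x f x <= 2 * \int[P]_x f x.
Proof.
move=> Lf f0; rewrite E_tilt// mulr2n mulrDl !mul1r lerD2l -EZl; last exact: L1Mb gM.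
apply: Ele => //; first by apply: L1Zl; exact: L1Mb gM.
move=> x; rewrite mulrCA ler_piMr//.
by have := tg1 x; rewrite ler_norml => /andP[].
Qed.

End tilt.

(** * Averaging smooth test functions over one step *)

Section test_functions.
Context (R : realType).
Implicit Types (K : R) (f : R -> R).

Definition bounded_lipschitz K f :=
  (forall x, `|f x| <= K) /\ (forall x y, `|f x - f y| <= K * `|x - y|).

(** f1 and f2 stand for the first two derivatives of f. The remainder is compared
    with the minimum of h^2 and |h|^3, as in Lindeberg's condition: the cube makes
    it small for small steps, and the square keeps its expectation finite when
    only second moments exist. Since the definition consists of inequalities
    between values, averaging preserves it with the same K. *)
Definition test_function K f f1 f2 :=
  [/\ bounded_lipschitz K f, bounded_lipschitz K f1, bounded_lipschitz K f2 &
      forall x h, `|f (x + h) - f x - f1 x * h - f2 x * (h ^+ 2 / 2)| <=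
        K * Num.min (h ^+ 2) (`|h| ^+ 3)].

Lemma bounded_lipschitz_continuous K f : bounded_lipschitz K f -> continuous f.
Proof.
move=> [fK fL] x.
have K0 : 0 <= K by apply: le_trans (fK 0).
apply/cvgrPdist_lt => e e0; near=> y.
rewrite (le_lt_trans (fL _ _))//.
have : `|x - y| < e / (K + 1).
  by near: y; apply: cvgr_dist_lt => //; rewrite divr_gt0// ltr_wpDl.
rewrite ltr_pdivlMr ?ltr_wpDl// => h.
by have := normr_ge0 (x - y); nra.
Unshelve. all: by end_near. Qed.

Lemma bounded_lipschitz_measurable K f :
  bounded_lipschitz K f -> measurable_fun setT f.
Proof. by move=> /bounded_lipschitz_continuous/continuous_measurable_fun. Qed.

End test_functions.

Section averaging.
Context d (S : measurableType d) (R : realType) (Q : probability S R).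
Variable xi : S -> R.
Hypothesis mxi : measurable_fun setT xi.

(** The transition operator of the random walk with steps xi: iterating it n times
    gives expectations over the sum of n independent steps. *)
Definition average (f : R -> R) (x : R) : R := \int[Q]_w f (x + xi w).

Lemma bounded_lipschitz_L1 K f x : bounded_lipschitz K f ->
  L1 Q (fun w => f (x + xi w)).
Proof.
move=> fK; apply: (@L1_bounded _ _ _ _ _ K); last by move=> w; exact: fK.1.
apply: measurableT_comp; first exact: bounded_lipschitz_measurable fK.
exact: measurable_funD.
Qed.

Lemma average_bounded_lipschitz K f :
  bounded_lipschitz K f -> bounded_lipschitz K (average f).
Proof.
move=> fK; split=> [x|x y].
  rewrite -[leRHS](Ecst Q); apply: Ele_norm => //; last by move=> w; exact: fK.1.
    exact: bounded_lipschitz_L1 fK.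
  exact: L1_cst.
rewrite /average -EB; [|exact: bounded_lipschitz_L1 fK..].
rewrite -[leRHS](Ecst Q); apply: Ele_norm; [|exact: L1_cst|].
  by apply: L1B; exact: bounded_lipschitz_L1 fK.
by move=> w; rewrite (le_trans (fK.2 _ _))// opprD addrACA subrr addr0.
Qed.

Lemma average_test K f f1 f2 : test_function K f f1 f2 ->
  test_function K (average f) (average f1) (average f2).
Proof.
move=> [fK f1K f2K fT]; split; try exact: average_bounded_lipschitz.
move=> x h; have Lf y := bounded_lipschitz_L1 y fK.
have Lf1 y := L1Zl h (bounded_lipschitz_L1 y f1K).
have Lf2 y := L1Zl (h ^+ 2 / 2) (bounded_lipschitz_L1 y f2K).
have La := L1B (Lf (x + h)) (Lf x).
have Lb := L1B La (Lf1 x).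
have -> : average f (x + h) - average f x - average f1 x * h -
    average f2 x * (h ^+ 2 / 2) = \int[Q]_w (f (x + h + xi w) - f (x + xi w) -
      h * f1 (x + xi w) - h ^+ 2 / 2 * f2 (x + xi w)).
  rewrite (EB Lb (Lf2 x)) (EB La (Lf1 x)) (EB (Lf _) (Lf x)).
  rewrite !EZl; [|exact: bounded_lipschitz_L1 f2K|exact: bounded_lipschitz_L1 f1K].
  by rewrite [h * _]mulrC [_ / 2 * _]mulrC.
rewrite -[leRHS](Ecst Q); apply: Ele_norm; [exact: L1B|exact: L1_cst|].
move=> w; have := fT (x + xi w) h.
by rewrite [x + xi w + h]addrAC [h * _]mulrC [(h ^+ 2 / 2) * _]mulrC.
Qed.

Lemma average_le_dist f g dlt K1 K2 : bounded_lipschitz K1 f -> bounded_lipschitz K2 g ->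
  (forall x, `|f x - g x| <= dlt) -> forall x, `|average f x - average g x| <= dlt.
Proof.
move=> fK gK fg x; have Lf := bounded_lipschitz_L1 x fK.
have Lg := bounded_lipschitz_L1 x gK.
rewrite /average -EB// -[leRHS](Ecst Q).
by apply: Ele_norm; [exact: L1B|exact: L1_cst|].
Qed.

Lemma iter_average_bounded_lipschitz K f n :
  bounded_lipschitz K f -> bounded_lipschitz K (iter n average f).
Proof. by move=> fK; elim: n => //= n; exact: average_bounded_lipschitz. Qed.

Lemma iter_average_test K f f1 f2 n : test_function K f f1 f2 ->
  test_function K (iter n average f) (iter n average f1) (iter n average f2).
Proof. by move=> fT; elim: n => //= n; exact: average_test. Qed.

(** The Taylor expansion at x, integrated term by term. The three errors are the
    defects of the first two moments and the truncated third moment. *)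
Lemma average_second_order K f f1 f2 v x : test_function K f f1 f2 ->
  L2 Q xi ->
  `|average f x - f x - v / 2 * f2 x| <=
  K * (`|\int[Q]_w xi w| + `|\int[Q]_w (xi w ^+ 2) - v| +
       \int[Q]_w Num.min (xi w ^+ 2) (`|xi w| ^+ 3)).
Proof.
move=> [fK f1K f2K fT] xi2; have L1xi := L2_L1 xi2.
have Lf := bounded_lipschitz_L1 x fK.
have Lm : L1 Q (fun w => Num.min (xi w ^+ 2) (`|xi w| ^+ 3)).
  apply: L1_le xi2.2 _.
    apply: measurable_minr; apply: measurable_funX => //.
    exact: measurableT_comp.
  by move=> w; rewrite ger0_norm ?ge_min ?lexx// le_min sqr_ge0 exprn_ge0.
have La := L1B Lf (L1_cst Q (f x)).
have Lb := L1Zl (f1 x) L1xi.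
have Lc := L1Zl (f2 x / 2) xi2.2.
have E1 : `|\int[Q]_w (f (x + xi w) - f x - f1 x * xi w - f2 x / 2 * xi w ^+ 2)|
    <= K * \int[Q]_w Num.min (xi w ^+ 2) (`|xi w| ^+ 3).
  rewrite -EZl//; apply: Ele_norm; [exact: (L1B (L1B La Lb) Lc)|exact: L1Zl|].
  by move=> w; rewrite mulrAC -mulrA; exact: fT.
move: E1; rewrite (EB (L1B La Lb) Lc) (EB La Lb) (EB Lf (L1_cst Q _)) Ecst !EZl//.
  2: exact: xi2.2.
rewrite -/(average f x).
set m := \int[Q]_w xi w; set s := \int[Q]_w (xi w ^+ 2).
set A := average f x; set I := Rintegral _ _ _ => E1.
have -> : A - f x - v / 2 * f2 x =
    (A - f x - f1 x * m - f2 x / 2 * s) + f1 x * m + f2 x / 2 * (s - v) by field.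
have K0 : 0 <= K by apply: le_trans (fK.1 0).
rewrite (le_trans (ler_normD _ _))// (le_trans (lerD (ler_normD _ _) (lexx _)))//.
have h1 : `|f1 x * m| <= K * `|m| by rewrite normrM ler_wpM2r// f1K.1.
have h2 : `|f2 x / 2 * (s - v)| <= K * `|s - v|.
  rewrite normrM ler_wpM2r// normrM [`|2^-1|]ger0_norm//.
  by have := f2K.1 x; lra.
lra.
Qed.

(** The counterpart for steps that are only integrable: the second-order term is
    charged to the remainder where |xi| <= 1, and elsewhere the Lipschitz bound
    gives an error linear in |xi|. *)
Lemma average_first_order K f f1 f2 x : test_function K f f1 f2 ->
  L1 Q xi ->
  `|average f x - f x| <=
  K * (`|\int[Q]_w xi w| + 2 * \int[Q]_w Num.min `|xi w| (xi w ^+ 2)).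
Proof.
move=> [fK f1K f2K fT] L1xi.
have K0 : 0 <= K by apply: le_trans (fK.1 0).
have Lf := bounded_lipschitz_L1 x fK.
have Lm : L1 Q (fun w => Num.min `|xi w| (xi w ^+ 2)).
  apply: L1_le (L1_norm L1xi) _.
    by apply: measurable_minr; [exact: measurableT_comp|exact: measurable_funX].
  by move=> w; rewrite ger0_norm ?ge_min ?lexx// le_min sqr_ge0 normr_ge0.
have La := L1B Lf (L1_cst Q (f x)).
have Lb := L1Zl (f1 x) L1xi.
have E1 : `|\int[Q]_w (f (x + xi w) - f x - f1 x * xi w)|
    <= K * 2 * \int[Q]_w Num.min `|xi w| (xi w ^+ 2).
  rewrite -EZl//; apply: Ele_norm; [exact: (L1B La Lb)|exact: L1Zl|].
  move=> w; rewrite -mulrA; set h := xi w.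
  have b1 : `|f (x + h) - f x| <= K * `|h|.
    by rewrite (le_trans (fK.2 _ _))// addrAC subrr add0r.
  have b2 : `|f1 x * h| <= K * `|h| by rewrite normrM ler_wpM2r// f1K.1.
  have b3 : `|f2 x * (h ^+ 2 / 2)| <= K * (h ^+ 2 / 2).
    rewrite normrM [`|_ / 2|]ger0_norm ?divr_ge0 ?sqr_ge0//.
    by rewrite ler_wpM2r ?f2K.1 ?divr_ge0 ?sqr_ge0.
  have b4 : `|f (x + h) - f x - f1 x * h - f2 x * (h ^+ 2 / 2)| <= K * h ^+ 2.
    by rewrite (le_trans (fT x h))// ler_wpM2l// ge_min lexx.
  have h20 := sqr_ge0 h.
  have [_|_] := leP `|h| (h ^+ 2).
    by rewrite (le_trans (ler_normB _ _))//; lra.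
  have := ler_normD (f (x + h) - f x - f1 x * h - f2 x * (h ^+ 2 / 2))
    (f2 x * (h ^+ 2 / 2)).
  by rewrite subrK; nra.
move: E1; rewrite (EB La Lb) (EB Lf (L1_cst Q _)) Ecst EZl// -/(average f x).
set m := \int[Q]_w xi w; set A := average f x; set I := Rintegral _ _ _ => E1.
have h1 : `|f1 x * m| <= K * `|m| by rewrite normrM ler_wpM2r// f1K.1.
have := ler_normD (A - f x - f1 x * m) (f1 x * m).
by rewrite subrK; nra.
Qed.

End averaging.

Section telescoping.
Context d1 d2 (S1 : measurableType d1) (S2 : measurableType d2) (R : realType).
Variables (Q1 : probability S1 R) (Q2 : probability S2 R).
Variables (xi1 : S1 -> R) (xi2 : S2 -> R).
Hypotheses (mxi1 : measurable_fun setT xi1) (mxi2 : measurable_fun setT xi2).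

(** Lindeberg's replacement argument: the n steps are exchanged one at a time, and
    averaging does not increase the uniform distance between two functions. *)
Lemma iter_average_dist (K dlt : R) n :
  (forall f f1 f2, test_function K f f1 f2 ->
    forall x, `|average Q1 xi1 f x - average Q2 xi2 f x| <= dlt) ->
  forall f f1 f2, test_function K f f1 f2 ->
    forall x, `|iter n (average Q1 xi1) f x - iter n (average Q2 xi2) f x|
      <= n%:R * dlt.
Proof.
move=> H f f1 f2 fT; elim: n => [|n IH] x; first by rewrite /= subrr normr0 mul0r.
rewrite /= -(subrK (average Q1 xi1 (iter n (average Q2 xi2) f) x)
  (average Q1 xi1 (iter n (average Q1 xi1) f) x)) -addrA.
rewrite (le_trans (ler_normD _ _))// -natr1 mulrDl mul1r lerD//.
  have [fK _ _ _] := fT.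
  have b1 := iter_average_bounded_lipschitz Q1 mxi1 n fK.
  have b2 := iter_average_bounded_lipschitz Q2 mxi2 n fK.
  exact: (average_le_dist Q1 mxi1 b1 b2 IH).
by apply: H; exact: (iter_average_test Q2 mxi2 n fT).
Qed.

End telescoping.

(** * Moments of the centred normal law *)

Section lebesgue_invariance.
Context (R : realType).
Local Notation mu := (@lebesgue_measure R).

Let shift_measurable (a : R) :
  measurable_fun setT (fun x : measurableTypeR R => x + a : measurableTypeR R).
Proof. exact: measurable_funD. Qed.

Lemma lebesgue_measure_shift (a : R) (A : set (measurableTypeR R)) : measurable A ->
  pushforward mu (fun x : measurableTypeR R => x + a : measurableTypeR R) A = mu A.
Proof.
move=> mA; apply/esym.
pose m := pushforward mu (fun x : measurableTypeR R => x + a : measurableTypeR R).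
apply: (@lebesgue_measure_unique _ m) => //= _ [[b c]] _ <-.
rewrite /pushforward.
have -> : (fun x : measurableTypeR R => x + a) @^-1` `]b, c]%classic =
    `]b - a, c - a]%classic.
  by apply/seteqP; split=> x /=; rewrite !in_itv/= ltrBlDr lerBrDr.
rewrite !lebesgue_measure_itv/= !lte_fin ltrD2r.
by case: ifPn => // _; rewrite -!EFinD; congr EFin; ring.
Qed.

Lemma ge0_integral_shift (a : R) (f : R -> \bar R) : measurable_fun setT f ->
  (forall x, 0 <= f x)%E -> (\int[mu]_x f (x + a)%R = \int[mu]_x f x)%E.
Proof.
move=> mf f0.
have := @ge0_integral_pushforward _ _ _ _ R _ (shift_measurable a) mu setT f
  measurableT mf (fun x _ => f0 x).
rewrite preimage_setT => <-.
by apply: eq_measure_integral => A mA _; rewrite -[RHS](lebesgue_measure_shift a).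
Qed.

Lemma ge0_integral_opp (f : R -> \bar R) : measurable_fun setT f ->
  (forall x, 0 <= f x)%E -> (\int[mu]_x f (- x)%R = \int[mu]_x f x)%E.
Proof.
move=> mf f0.
have mo : measurable_fun setT (-%R : measurableTypeR R -> measurableTypeR R).
  exact: measurable_funN.
have := @ge0_integral_pushforward _ _ _ _ R _ mo mu setT f
  measurableT mf (fun x _ => f0 x).
rewrite preimage_setT => <-.
by apply: eq_measure_integral => A mA _; rewrite -[RHS]lebesgue_measureN.
Qed.

Lemma odd_integral0 (h : R -> R) : mu.-integrable setT (EFin \o h) ->
  (forall x, h (- x) = - h x) -> (\int[mu]_x (h x)%:E = 0)%E.
Proof.
move=> Lh oh; rewrite integralE.
have mh : measurable_fun setT (EFin \o h) by exact: measurable_int Lh.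
have -> : (\int[mu]_x (EFin \o h)^\- x = \int[mu]_x (EFin \o h)^\+ x)%E.
  rewrite -[LHS]ge0_integral_opp//; last exact: measurable_funeneg.
  by apply: eq_integral => x _; rewrite funeposE funenegE/= oh opprK.
rewrite subee//; apply: integrable_pos_fin_num => //.
Qed.

End lebesgue_invariance.

Section centered_normal.
Context (R : realType).
Local Notation mu := (@lebesgue_measure R).

Section density.
Variable s : R.
Hypothesis s0 : 0 < s.
Let sN0 : s != 0. Proof. by rewrite gt_eqF. Qed.
Local Notation p := (normal_pdf 0 s).

Let pE x : p x = normal_peak s * expR (- (x ^+ 2 / (s ^+ 2 *+ 2))).
Proof. by rewrite normal_pdfE// /normal_fun subr0 mulNr. Qed.

Lemma normal_pdf_opp x : p (- x) = p x.
Proof. by rewrite !pE sqrrN. Qed.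

Lemma is_derive_normal_pdf (x : R) : is_derive x 1 p (- (x / s ^+ 2) * p x).
Proof.
have -> : p = (fun x => normal_peak s * expR (- (x ^+ 2 / (s ^+ 2 *+ 2)))).
  by apply/funext => y; exact: pE.
apply: is_derive_eq; rewrite !scaler0 !add0r.
rewrite /GRing.scale/= -mulr_natl.
by field.
Qed.

Let cp : continuous p. Proof. exact: continuous_normal_pdf. Qed.
Let mp : measurable_fun setT p. Proof. exact: measurable_normal_pdf. Qed.
Let p0 x : 0 <= p x. Proof. exact: normal_pdf_ge0. Qed.

Let is_derive_scaled_pdf (x : R) : is_derive x 1 (fun x => - s ^+ 2 * p x) (x * p x).
Proof.
have := is_derive_normal_pdf x => dp.
by apply: is_derive_eq; rewrite /GRing.scale/=; field.
Qed.

Let scaled_pdf_continuous x : {for x, continuous (fun x => - s ^+ 2 * p x)}.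
Proof.
apply: differentiable_continuous; apply/derivable1_diffP.
by case: (is_derive_scaled_pdf x).
Qed.

Let cvg_symmetric_integral (h : R -> R) : measurable_fun setT h ->
  (forall x, 0 <= h x) ->
  (\int[mu]_(x in `[(- n.+1%:R)%R, n.+1%:R]) (h x)%:E @[n --> \oo] -->
  \int[mu]_x (h x)%:E)%E.
Proof.
move=> mh h0; pose F (n : nat) : set R := `[- n.+1%:R, n.+1%:R]%classic.
have nF : nondecreasing_seq F.
  move=> m n mn; apply/subsetPset => x; rewrite /F/= !in_itv/= => /andP[h1 h2].
  have : m.+1%:R <= n.+1%:R :> R by rewrite ler_nat.
  by move=> h3; apply/andP; split; lra.
have mF n : measurable (F n) by exact: measurable_itv.
have UF : \bigcup_n F n = setT.
  apply/seteqP; split=> // x _; exists (Num.truncn `|x|) => //=.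
  rewrite /F/= in_itv/= -ler_norml; exact/ltW/truncnS_gt.
rewrite -UF; apply: ge0_nondecreasing_set_cvg_integral => //.
  by move=> n; apply: measurable_funTS; exact/measurable_EFinP.
by move=> n x _; rewrite lee_fin.
Qed.

(** Integration by parts, x p(x) being the derivative of - s^2 p(x). *)
Lemma truncated_second_moment (a : R) : 0 < a ->
  (\int[mu]_(x in `[(- a)%R, a]) (x ^+ 2 * p x)%:E =
   (s ^+ 2)%:E * (\int[mu]_(x in `[(- a)%R, a]) (p x)%:E) -
   (2 * a * s ^+ 2 * p a)%:E)%E.
Proof.
move=> a0; have aa : - a < a by lra.
have dG := is_derive_scaled_pdf; have cG := scaled_pdf_continuous.
have := @integration_by_parts R id (fun x => - s ^+ 2 * p x) (cst 1)
  (fun x => x * p x) (- a) a aa.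
have ccx : continuous (fun x : R => x * p x).
  by move=> x; apply: cvgM; [exact: cvg_id|exact: cp].
have Lp : mu.-integrable `[(- a)%R, a] (EFin \o p).
  exact: (integrableS _ _ (subsetT _) (integrable_normal_pdf 0 s)).
move=> IBP; under [LHS]eq_integral do rewrite expr2 -mulrA.
rewrite IBP.
- rewrite normal_pdf_opp.
  under eq_integral do rewrite /cst mul1r EFinM.
  rewrite integralZl//.
  have /fineK <- : (\int[mu]_(x in `[(- a)%R, a]) (p x)%:E)%E \is a fin_num.
    exact: integrable_fin_num.
  by rewrite -!EFinM -!EFinB; congr EFin; ring.
- by apply: continuous_subspaceT => x; exact: cvg_cst.
- split=> [x _| |]; first exact: derivable_id.
  + exact: cvg_at_right_filter.
  + exact: cvg_at_left_filter.
- by move=> x _; rewrite derive1_id.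
- exact: continuous_subspaceT.
- split=> [x _| |].
  + by case: (dG x).
  + exact/cvg_at_right_filter/cG.
  + exact/cvg_at_left_filter/cG.
- by move=> x _; rewrite derive1E; apply: derive_val.
Qed.

(** From exp (- y) <= 1 / (1 + y), the product x p(x) is of order 1 / x; the boundary
    term of the integration by parts therefore vanishes in the limit. *)
Lemma normal_pdf_tail : n.+1%:R * p n.+1%:R @[n --> \oo] --> (0 : R).
Proof.
apply: (@squeeze_cvgr _ _ _ _ (cst 0) (fun n => normal_peak s * (s ^+ 2 *+ 2) * n.+1%:R^-1)).
- apply: nearW => n; rewrite mulr_ge0 ?p0//= pE mulrCA -mulrA.
  rewrite ler_wpM2l ?normal_peak_ge0// expRN.
  set x : R := n.+1%:R; have x0 : 0 < x by rewrite ltr0n.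
  have S0 : 0 < s ^+ 2 *+ 2 by rewrite pmulrn_lgt0// exprn_gt0.
  have e0 := expR_gt0 (x ^+ 2 / (s ^+ 2 *+ 2)).
  rewrite ler_pdivrMr// -ler_pdivrMl ?divr_gt0//.
  have -> : (s ^+ 2 *+ 2 / x)^-1 * x = x ^+ 2 / (s ^+ 2 *+ 2).
    by rewrite invf_div; field; rewrite !gt_eqF.
  by apply: le_trans (expR_ge1Dx _); rewrite lerDr.
- exact: cvg_cst.
- rewrite -[X in _ --> X](mulr0 (normal_peak s * (s ^+ 2 *+ 2))).
  by apply: cvgMr; exact: cvg_harmonic.
Qed.

Lemma normal_second_moment : (\int[mu]_x (x ^+ 2 * p x)%:E = (s ^+ 2)%:E)%E.
Proof.
have mx2p : measurable_fun setT (fun x : R => x ^+ 2 * p x).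
  by apply: measurable_funM => //; exact: exprn_measurable.
have c1 := cvg_symmetric_integral mx2p (fun x => mulr_ge0 (sqr_ge0 x) (p0 x)).
have c2 := cvg_symmetric_integral mp p0; rewrite integral_normal_pdf in c2.
have c3 : ((2 * n.+1%:R * s ^+ 2 * p n.+1%:R)%:E @[n --> \oo] --> 0)%E.
  apply: cvg_EFin; first exact: nearW.
  have -> : fine \o (fun n => (2 * n.+1%:R * s ^+ 2 * p n.+1%:R)%:E) =
      (fun n => 2 * s ^+ 2 * (n.+1%:R * p n.+1%:R)).
    by apply/funext => n /=; ring.
  rewrite -[X in _ --> X](mulr0 (2 * s ^+ 2)).
  by apply: cvgMr; exact: normal_pdf_tail.
apply: (cvg_unique _ c1) => //.
have -> : (fun n => \int[mu]_(x in `[(- n.+1%:R)%R, n.+1%:R]) (x ^+ 2 * p x)%:E)%E =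
   (fun n => (s ^+ 2)%:E * (\int[mu]_(x in `[(- n.+1%:R)%R, n.+1%:R]) (p x)%:E) -
   (2 * n.+1%:R * s ^+ 2 * p n.+1%:R)%:E)%E.
  by apply/funext => n; rewrite -truncated_second_moment ?ltr0n.
rewrite /mkset -[X in _ --> X]sube0 -[in X in _ --> X](mule1 (s ^+ 2)%:E).
by apply: cvgeB => //; exact: cvgeZl.
Qed.

(** Again by parts; the boundary terms are nonpositive, so an upper bound
    holds without a limit. *)
Lemma truncated_fourth_moment_le (a : R) : 0 < a ->
  (\int[mu]_(x in `[(- a)%R, a]) (x ^+ 4 * p x)%:E <= (3 * s ^+ 4)%:E)%E.
Proof.
move=> a0; have aa : - a < a by lra.
have dF (x : R) : is_derive x 1 (fun x : R => x ^+ 3) (3 * x ^+ 2).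
  by apply: is_derive_eq; rewrite /GRing.scale/=; ring.
have cF x : {for x, continuous (fun x : R => x ^+ 3)}.
  by apply: differentiable_continuous; apply/derivable1_diffP; case: (dF x).
have := @integration_by_parts R (fun x => x ^+ 3) (fun x => - s ^+ 2 * p x)
  (fun x => 3 * x ^+ 2) (fun x => x * p x) (- a) a aa.
have dG := is_derive_scaled_pdf; have cG := scaled_pdf_continuous.
have ccx : continuous (fun x : R => x * p x).
  by move=> x; apply: cvgM; [exact: cvg_id|exact: cp].
have m2 : measurable_fun setT (fun x : R => x ^+ 2 * p x).
  by apply: measurable_funM => //; exact: exprn_measurable.
have L2p : mu.-integrable `[(- a)%R, a] (EFin \o (fun x => x ^+ 2 * p x)).
  apply: (integrableS _ _ (subsetT _)) => //; apply/integrableP; split.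
    exact/measurable_EFinP.
  have nn x : 0 <= x ^+ 2 * p x by rewrite mulr_ge0 ?sqr_ge0.
  under eq_integral => x _ do rewrite /= (ger0_norm (nn x)).
  by rewrite normal_second_moment ltry.
have le2 : (\int[mu]_(x in `[(- a)%R, a]) (x ^+ 2 * p x)%:E <= (s ^+ 2)%:E)%E.
  rewrite -normal_second_moment; apply: ge0_subset_integral => //.
    exact/measurable_EFinP.
  by move=> x _; rewrite lee_fin mulr_ge0 ?sqr_ge0.
move=> IBP.
have E4 (x : R) : x ^+ 4 * p x = x ^+ 3 * (x * p x) by ring.
under [leLHS]eq_integral do rewrite E4.
rewrite IBP; last 6 first.
- by apply: continuous_subspaceT => x; apply: cvgMr; exact: exprn_continuous.
- split=> [x _| |]; first by case: (dF x).
  + exact/cvg_at_right_filter/cF.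
  + exact/cvg_at_left_filter/cF.
- by move=> x _; rewrite derive1E; apply: derive_val.
- exact: continuous_subspaceT.
- split=> [x _| |]; first by case: (dG x).
  + exact/cvg_at_right_filter/cG.
  + exact/cvg_at_left_filter/cG.
- by move=> x _; rewrite derive1E; apply: derive_val.
have E2 (x : R) : 3 * x ^+ 2 * (- s ^+ 2 * p x) = - (3 * s ^+ 2) * (x ^+ 2 * p x) by ring.
under eq_integral do rewrite E2 EFinM.
rewrite integralZl// normal_pdf_opp.
move: le2; have /fineK <- : (\int[mu]_(x in `[(- a)%R, a]) (x ^+ 2 * p x)%:E)%E \is a fin_num.
  exact: integrable_fin_num.
set I := fine _; rewrite -EFinM -EFinB !lee_fin => le2.
have b0 : 0 <= a ^+ 3 * (s ^+ 2 * p a) by rewrite !mulr_ge0 ?exprn_ge0 ?sqr_ge0 ?p0// ltW.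
have -> : 3 * s ^+ 4 = 3 * s ^+ 2 * s ^+ 2 by ring.
have : 3 * s ^+ 2 * I <= 3 * s ^+ 2 * s ^+ 2 by rewrite ler_wpM2l// mulr_ge0// sqr_ge0.
have -> : a ^+ 3 * (- s ^+ 2 * p a) - (- a) ^+ 3 * (- s ^+ 2 * p a) -
   - (3 * s ^+ 2) * I = 3 * s ^+ 2 * I - 2 * (a ^+ 3 * (s ^+ 2 * p a)) by ring.
by lra.
Qed.

Lemma normal_fourth_moment_le :
  (\int[mu]_x (x ^+ 4 * p x)%:E <= (3 * s ^+ 4)%:E)%E.
Proof.
have m4 : measurable_fun setT (fun x : R => (x ^+ 4 * p x)%:E).
  by apply/measurable_EFinP/measurable_funM => //; exact: exprn_measurable.
have x4 (x : R) : 0 <= x ^+ 4 by rewrite -[4%N]/(2 * 2)%N exprM sqr_ge0.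
have c1 := @cvg_symmetric_integral (fun x => x ^+ 4 * p x)%R.
rewrite -(cvg_lim _ (c1 _ _))//; last 2 first.
- exact/measurable_EFinP.
- by move=> x; rewrite mulr_ge0.
apply: lime_le.
  by apply/cvg_ex; eexists; apply: c1; [exact/measurable_EFinP|move=> x; rewrite mulr_ge0].
by apply: nearW => n; apply: truncated_fourth_moment_le.
Qed.

Lemma ge0_integral_normal (f : R -> \bar R) : measurable_fun setT f ->
  (forall x, 0 <= f x)%E ->
  (\int[normal_prob 0 s]_x f x = \int[mu]_x (f x * (p x)%:E))%E.
Proof. by move=> mf f0; rewrite (@ge0_integral_density _ _ _ mu _ p mp p0). Qed.

Lemma L2_normal : L2 (normal_prob 0 s) (id : measurableTypeR R -> R).
Proof.
split; first exact: measurable_id.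
apply/integrableP; split; first by apply/measurable_EFinP; exact: exprn_measurable.
rewrite ge0_integral_normal//; last first.
  by apply: measurableT_comp => //; apply/measurable_EFinP; exact: exprn_measurable.
under eq_integral do rewrite /= ger0_norm ?sqr_ge0// -EFinM.
by rewrite normal_second_moment ltry.
Qed.

Lemma E_normal_sqr : \int[normal_prob 0 s]_x ((x : R) ^+ 2) = s ^+ 2.
Proof.
rewrite /Rintegral ge0_integral_normal//; last 2 first.
  by apply/measurable_EFinP; exact: exprn_measurable.
  by move=> x; rewrite lee_fin sqr_ge0.
by under eq_integral do rewrite -EFinM; rewrite normal_second_moment.
Qed.

Lemma E_normal_id : \int[normal_prob 0 s]_x (x : R) = 0.
Proof.
rewrite /Rintegral (@integral_density _ _ _ mu _ p mp p0)//.
rewrite odd_integral0// => [|x]; last by rewrite normal_pdf_opp mulNr.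
have /integrableP[_ L] := L2_L1 L2_normal.
apply/integrableP; split; first by apply/measurable_EFinP; exact: measurable_funM.
apply: le_lt_trans L; rewrite ge0_integral_normal//; last first.
  by apply: measurableT_comp => //; exact/measurable_EFinP.
rewrite le_eqVlt; apply/orP; left; apply/eqP; apply: eq_integral => x _.
by rewrite /= normrM EFinM (ger0_norm (p0 x)).
Qed.

End density.

(** Completing the square in y: the joint density of a step and of the sum of two
    steps is the density of the sum times a probability density in y. *)
Lemma normal_pdf_mul (s t y w : R) : 0 < s -> 0 < t ->
  normal_pdf 0 t (w - y) * normal_pdf 0 s y =
  normal_pdf 0 (Num.sqrt (s ^+ 2 + t ^+ 2)) w *
  normal_pdf (s ^+ 2 * w / (s ^+ 2 + t ^+ 2))
    (s * t / Num.sqrt (s ^+ 2 + t ^+ 2)) y.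
Proof.
move=> s0 t0; set r := Num.sqrt _.
have st0 : 0 < s ^+ 2 + t ^+ 2 by rewrite addr_gt0 ?exprn_gt0.
have r0 : 0 < r by rewrite sqrtr_gt0.
have r2 : r ^+ 2 = s ^+ 2 + t ^+ 2 by rewrite sqr_sqrtr// ltW.
have peakM (a b : R) : normal_peak a * normal_peak b =
    (2 * pi)^-1 * (`|a * b|)^-1 :> R.
  rewrite /normal_peak -invfM -sqrtrM; last first.
    by rewrite mulrn_wge0// mulr_ge0 ?sqr_ge0// pi_ge0.
  have -> : a ^+ 2 * pi *+ 2 * (b ^+ 2 * pi *+ 2) = (2 * pi * (a * b)) ^+ 2 by ring.
  by rewrite sqrtr_sqr normrM ger0_norm ?invfM// mulr_ge0// pi_ge0.
have pdfE m1 s1 x1 : 0 < s1 ->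
    normal_pdf m1 s1 x1 = normal_peak s1 * normal_fun m1 s1 x1 :> R.
  by move=> s1_gt0; rewrite normal_pdfE// gt_eqF.
rewrite !pdfE ?divr_gt0 ?mulr_gt0//.
rewrite mulrACA peakM [RHS]mulrACA peakM /normal_fun -!expRD.
congr (_ * _^-1 * expR _).
  by congr `|_|; field; rewrite gt_eqF.
rewrite !exprMn exprVn !r2; field.
by rewrite !gt_eqF.
Qed.

End centered_normal.

Section normal_semigroup.
Context (R : realType).
Local Notation mu := (@lebesgue_measure R).
Local Notation gaussian s := (normal_prob 0 s : probability (measurableTypeR R) R).
Local Notation idR := (id : measurableTypeR R -> R).

Lemma average_gaussianE (s K : R) (f : R -> R) x : 0 < s -> bounded_lipschitz K f ->
  (forall x, 0 <= f x) ->
  (average (gaussian s) idR f x)%:E =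
  (\int[mu]_y ((f (x + y))%:E * (normal_pdf 0 s y)%:E))%E.
Proof.
move=> s0 fK f0; rewrite /average -EFinE; last first.
  have mid : measurable_fun setT idR by exact: measurable_id.
  exact: (bounded_lipschitz_L1 (gaussian s) mid x fK).
rewrite (@ge0_integral_normal _ s)//.
- apply/measurable_EFinP; apply: measurableT_comp.
    exact: bounded_lipschitz_measurable fK.
  exact: measurable_funD.
- by move=> y; rewrite lee_fin.
Qed.

(** After a translation of the inner variable, Tonelli and [normal_pdf_mul] leave the
    integral of a probability density in y. *)
Lemma gaussian_convolution (s t K : R) (f : R -> R) x : 0 < s -> 0 < t ->
  bounded_lipschitz K f -> (forall x, 0 <= f x) ->
  average (gaussian s) idR (average (gaussian t) idR f) x =
  average (gaussian (Num.sqrt (s ^+ 2 + t ^+ 2))) idR f x.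
Proof.
move=> s0 t0 fK f0.
have r0 : 0 < Num.sqrt (s ^+ 2 + t ^+ 2) by rewrite sqrtr_gt0 addr_gt0 ?exprn_gt0.
have mf := bounded_lipschitz_measurable fK.
have mid : measurable_fun setT idR by exact: measurable_id.
have Er := average_gaussianE x r0 fK f0.
apply: EFin_inj; rewrite [RHS]Er {Er}.
have aK := average_bounded_lipschitz (gaussian t) mid fK.
have a0 y : 0 <= average (gaussian t) idR f y by apply: Rintegral_ge0.
rewrite [LHS](average_gaussianE x s0 aK a0).
have mfa a : measurable_fun setT (fun w : measurableTypeR R => (f (a + w))%:E).
  apply/measurable_EFinP; apply: measurableT_comp => //; exact: measurable_funD.
have mpt r : measurable_fun setT (fun w : measurableTypeR R => (normal_pdf 0 r w)%:E).
  by apply/measurable_EFinP; exact: measurable_normal_pdf.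
have mfp a r : measurable_fun setT (fun w : measurableTypeR R =>
    (f (a + w))%:E * (normal_pdf 0 r w)%:E)%E by exact: emeasurable_funM.
pose H (v : measurableTypeR R * measurableTypeR R) : \bar R :=
  ((f (x + v.2))%:E * (normal_pdf 0 t (v.2 - v.1) * normal_pdf 0 s v.1)%:E)%E.
have H0 v : (0 <= H v)%E.
  by rewrite mule_ge0// lee_fin// mulr_ge0// normal_pdf_ge0.
have mH : measurable_fun setT H.
  apply: emeasurable_funM; apply/measurable_EFinP.
    by apply: measurableT_comp => //; apply: measurable_funD.
  apply: measurable_funM; apply: measurableT_comp => //.
  - exact: measurable_normal_pdf.
  - exact: measurable_funB.
  - exact: measurable_normal_pdf.
transitivity (\int[mu]_y \int[mu]_w H (y, w))%E.
  apply: eq_integral => y _; rewrite (average_gaussianE _ t0 fK f0).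
  rewrite -ge0_integralZr//=; last 2 first.
  - by move=> w _; rewrite -EFinM lee_fin mulr_ge0// normal_pdf_ge0.
  - by rewrite lee_fin normal_pdf_ge0.
  rewrite -(ge0_integral_shift (- y)); last 2 first.
  - by apply: emeasurable_funM => //; exact (mfp (x + y) t).
  - by move=> w; rewrite -!EFinM lee_fin !mulr_ge0// normal_pdf_ge0.
  apply: eq_integral => w _; rewrite /H/= EFinM muleA.
  by rewrite [x + y + _]addrA; congr ((f _)%:E * _ * _)%E; ring.
rewrite (fubini_tonelli (m1 := mu) (m2 := mu) H)//=.
apply: eq_integral => w _; rewrite /H/=.
under eq_integral do rewrite normal_pdf_mul// EFinM muleA.
rewrite ge0_integralZl//; last 3 first.
- by apply/measurable_EFinP; exact: measurable_normal_pdf.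
- by move=> y _; rewrite lee_fin normal_pdf_ge0.
- by rewrite -EFinM lee_fin mulr_ge0// normal_pdf_ge0.
by rewrite integral_normal_pdf mule1.
Qed.

Lemma E_dirac0 (h : measurableTypeR R -> R) : measurable_fun setT h ->
  \int[(dirac (0 : measurableTypeR R) : probability _ R)]_x h x = h 0.
Proof.
move=> mh; rewrite /Rintegral integral_dirac//; last exact/measurable_EFinP.
by rewrite diracT mul1e.
Qed.

Lemma centered_normal0 : centered_normal (0 : R) = dirac (0 : measurableTypeR R).
Proof. by rewrite /centered_normal eqxx. Qed.

Lemma centered_normal_gt0 (v : R) : 0 < v ->
  centered_normal v = gaussian (Num.sqrt v).
Proof. by move=> v0; rewrite /centered_normal gt_eqF. Qed.

Lemma centered_normal_moments (v : R) : 0 <= v ->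
  [/\ L2 (centered_normal v) idR, \int[centered_normal v]_x idR x = 0 &
      \int[centered_normal v]_x (idR x ^+ 2) = v].
Proof.
have mid : measurable_fun setT idR by exact: measurable_id.
have mid2 : measurable_fun setT (fun x => idR x ^+ 2) by exact: measurable_funX.
rewrite le_eqVlt => /predU1P[<-|v0].
  rewrite centered_normal0; split.
  - split => //; apply/integrableP; split; first exact/measurable_EFinP.
    rewrite integral_dirac//; last by apply/measurableT_comp => //; exact/measurable_EFinP.
    by rewrite diracT mul1e ltry.
  - by rewrite E_dirac0.
  - by rewrite E_dirac0// expr0n.
have s0 : 0 < Num.sqrt v by rewrite sqrtr_gt0.
rewrite centered_normal_gt0//; split.
- exact: L2_normal.
- exact: E_normal_id.
- by rewrite E_normal_sqr// sqr_sqrtr// ltW.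
Qed.

Lemma average_centered_normal0 K f x : bounded_lipschitz K f ->
  average (centered_normal (0 : R)) idR f x = f x.
Proof.
move=> fK; rewrite centered_normal0 /average E_dirac0 ?addr0//.
apply: measurableT_comp; first exact: bounded_lipschitz_measurable fK.
exact: measurable_funD.
Qed.

Lemma centered_normal_convolution (u v K : R) (f : R -> R) x : 0 <= u -> 0 <= v ->
  bounded_lipschitz K f -> (forall x, 0 <= f x) ->
  average (centered_normal u) idR (average (centered_normal v) idR f) x =
  average (centered_normal (u + v)) idR f x.
Proof.
have mid : measurable_fun setT idR by exact: measurable_id.
move=> + + fK f0; rewrite le_eqVlt => /predU1P[<- _|u0].
  rewrite add0r.
  exact (average_centered_normal0 x (average_bounded_lipschitz (centered_normal v) mid fK)).
rewrite le_eqVlt => /predU1P[<-|v0].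
  rewrite addr0; congr (average _ _ _ x); apply/funext => y.
  exact: average_centered_normal0 fK.
have uv0 : 0 < u + v by rewrite addr_gt0.
rewrite (centered_normal_gt0 u0) (centered_normal_gt0 v0) (centered_normal_gt0 uv0).
have su : 0 < Num.sqrt u by rewrite sqrtr_gt0.
have sv : 0 < Num.sqrt v by rewrite sqrtr_gt0.
by rewrite [LHS](gaussian_convolution x su sv fK f0) !sqr_sqrtr ?ltW.
Qed.

Lemma iter_average_centered_normal (v K : R) (f : R -> R) n x : 0 <= v ->
  bounded_lipschitz K f -> (forall x, 0 <= f x) ->
  iter n (average (centered_normal v) idR) f x =
  average (centered_normal (n%:R * v)) idR f x.
Proof.
move=> v0 fK f0; elim: n x => [|n IH] x.
  by rewrite mul0r; apply/esym; exact (average_centered_normal0 x fK).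
rewrite iterS; have -> : iter n (average (centered_normal v) idR) f =
    average (centered_normal (n%:R * v)) idR f by apply/funext.
have -> : n.+1%:R * v = v + n%:R * v by rewrite -natr1; ring.
exact (centered_normal_convolution x v0 (mulr_ge0 (ler0n R n) v0) fK f0).
Qed.

End normal_semigroup.

(** * Sums of independent variables *)

Section pairing.
Context d d1 d2 (Om : measurableType d) (T1 : measurableType d1)
  (T2 : measurableType d2) (U : {mfun Om >-> T1}) (V : {mfun Om >-> T2}).

Definition paired (w : Om) := (U w, V w).

Lemma measurable_paired : measurable_fun setT paired.
Proof. exact: measurable_fun_pair. Qed.

HB.instance Definition _ :=
  isMeasurableFun.Build _ _ _ _ paired measurable_paired.

End pairing.

Section joint_law.
Context d d1 d2 (Om : measurableType d) (T1 : measurableType d1)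
  (T2 : measurableType d2) (R : realType) (Pr : probability Om R).
Variables (U : {mfun Om >-> T1}) (V : {mfun Om >-> T2}).
Variables (m1 : probability T1 R) (m2 : probability T2 R).
Variables (F : set Om) (c : R).
Hypothesis mF : measurable F.
Hypothesis c0 : 0 <= c.
Hypothesis UVF : forall A C, measurable A -> measurable C ->
  Pr (U @^-1` A `&` V @^-1` C `&` F) = (m1 A * m2 C * c%:E)%E.

(** A law is determined by its values on rectangles. The event F, of weight c, makes
    the lemma usable inside an induction: it carries the events about all the
    variables other than U and V. *)
Lemma joint_law (E : set (T1 * T2)) : measurable E ->
  Pr (paired U V @^-1` E `&` F) = ((m1 \x m2) E * c%:E)%E.
Proof.
move=> mE; have [cE|cN] := eqVneq c 0.
  have F0 : Pr F = 0%E.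
    have := UVF measurableT measurableT.
    by rewrite !preimage_setT !setTI cE mule0.
  rewrite cE mule0; apply/eqP; rewrite eq_le measure_ge0 andbT -F0.
  apply: le_measure; rewrite ?inE//.
  by apply: measurableI => //; exact: (measurable_funPTI (paired U V)).
have cp : 0 < c by rewrite lt_neqAle eq_sym cN.
have ci : 0 <= c^-1 by rewrite invr_ge0.
pose m' : {measure set (T1 * T2) -> \bar R} :=
  mscale (NngNum ci) (pushforward (mrestr Pr mF) (paired U V)).
rewrite (@product_measure_unique _ _ _ _ _ m1 m2 (m' (measurable_funPT (paired U V))))//.
  by rewrite /m' /= /mscale/= /pushforward /mrestr muleC muleA -EFinM divff// mul1e.
move=> A C mA mC; rewrite /m' /= /mscale/= /pushforward /mrestr.
have -> : paired U V @^-1` (A `*` C) = U @^-1` A `&` V @^-1` C by [].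
by rewrite UVF// muleC -muleA -EFinM divff// mule1.
Qed.

End joint_law.

Section iid_sum.
Context d dS (Om : measurableType d) (S : measurableType dS) (R : realType)
  (Pr : probability Om R) (n : nat) (W : 'I_n -> {RV Pr >-> S})
  (Q : probability S R) (xi : {mfun S >-> R}).
Hypothesis iidW : iid W Q.

Definition partial_sum k (w : Om) : R := \sum_(i < n | (i < k)%N) xi (W i w).

Lemma measurable_partial_sum k : measurable_fun setT (partial_sum k).
Proof.
have -> : partial_sum k =
    (fun w => \sum_(i < n) (if (i < k)%N then xi (W i w) else 0)).
  by apply/funext => w; rewrite /partial_sum big_mkcond.
apply: measurable_sum => i; case: (i < k)%N => //.
exact: measurableT_comp.
Qed.

HB.instance Definition _ k :=
  isMeasurableFun.Build _ _ _ _ (partial_sum k) (measurable_partial_sum k).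

Lemma partial_sum0 w : partial_sum 0 w = 0.
Proof. by rewrite /partial_sum big_pred0. Qed.

Lemma partial_sumS k (kn : (k < n)%N) w :
  partial_sum k.+1 w = partial_sum k w + xi (W (Ordinal kn) w).
Proof.
rewrite /partial_sum (bigD1 (Ordinal kn))//= addrC; congr (_ + _).
by apply: eq_bigl => i; rewrite ltnS ltn_neqAle andbC -val_eqE.
Qed.

Let Pr_W i B : measurable B -> fine (Pr (W i @^-1` B)) = fine (Q B).
Proof. by move=> mB; rewrite -(iidW.1 i B mB). Qed.

Let tail (B : 'I_n -> set S) k := [set w | forall j : 'I_n, (k <= j)%N -> B j (W j w)].

Let measurable_tail B k : (forall j, measurable (B j)) -> measurable (tail B k).
Proof.
move=> mB; rewrite (_ : tail B k = \bigcap_(j in [set j : 'I_n | (k <= j)%N]) (W j @^-1` B j)).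
  apply: fin_bigcap_measurable => [|j _]; first exact: finite_finset.
  exact: measurable_funPTI.
by apply/seteqP; split.
Qed.

(** Independence of a partial sum from all the later variables jointly is the form
    of mutual independence that passes from k to k + 1. *)
Let prefix_independent k := forall A (B : 'I_n -> set S), measurable A ->
  (forall j, measurable (B j)) ->
  Pr (partial_sum k @^-1` A `&` tail B k) =
  (Pr (partial_sum k @^-1` A) * (\prod_(j < n | (k <= j)%N) fine (Q (B j)))%:E)%E.

Let prefix_joint_law k (kn : (k < n)%N) : prefix_independent k ->
  forall (B : 'I_n -> set S) E, (forall j, measurable (B j)) -> measurable E ->
  Pr (paired (partial_sum k) (W (Ordinal kn)) @^-1` E `&` tail B k.+1) =
  ((distribution Pr (partial_sum k) \x Q) E *
    (\prod_(j < n | (k.+1 <= j)%N) fine (Q (B j)))%:E)%E.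
Proof.
move=> IH B' E mB' mE; pose i0 := Ordinal kn.
apply: joint_law => //; first exact: measurable_tail.
  by apply: prodr_ge0 => j _; exact: fine_ge0.
move=> A' C mA' mC.
pose B'' j := if j == i0 then C else B' j.
have mB'' j : measurable (B'' j) by rewrite /B''; case: ifP.
have Bi0 : B'' i0 = C by rewrite /B'' eqxx.
have := IH A' B'' mA' mB''; rewrite (bigD1 i0)//= Bi0 => H.
have -> : partial_sum k @^-1` A' `&` W i0 @^-1` C `&` tail B' k.+1 =
   partial_sum k @^-1` A' `&` tail B'' k.
  apply/seteqP; split => w /=.
    move=> [[hA hC] hB]; split=> // j kj; rewrite /B''.
    case: eqP => [->//|/eqP ji]; apply: hB.
    by rewrite ltn_neqAle kj andbT eq_sym -[k]/(val i0) val_eqE.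
  move=> [hA hB]; split; first by split=> //; rewrite -Bi0; exact: hB.
  move=> j kj; have := hB j (ltnW kj); rewrite /B''.
  by case: eqP => // ji; move: kj; rewrite ji ltnn.
rewrite H EFinM fineK ?fin_num_measure// muleA; congr (_ * _%:E)%E.
apply: eq_big => [j|j]; last by move=> /andP[_ /negPf h]; rewrite /B'' h.
by rewrite andbC -val_eqE/= eq_sym -ltn_neqAle.
Qed.

Lemma partial_sum_law k : (k <= n)%N -> prefix_independent k.
Proof.
elim: k => [|k IH] kn A B mA mB.
  rewrite (_ : tail B 0 = [set w | forall i, B i (W i w)]); last first.
    by apply/seteqP; split => w /= H j; [exact: H|move=> _; exact: H].
  have -> : partial_sum 0 @^-1` A = if 0 \in A then setT else set0.
    apply/seteqP; split => w /=; rewrite partial_sum0; case: ifPn => //.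
      by move=> /negP nA A0; apply: nA; exact/mem_set.
    by move=> /set_mem.
  case: ifPn => _; last by rewrite set0I measure0 mul0e.
  rewrite setTI probability_setT mul1e iidW.2//; congr EFin.
  by apply: eq_bigr => i _; exact: Pr_W.
pose i0 := Ordinal kn; have joint := prefix_joint_law kn (IH (ltnW kn)).
pose E := [set v : R * S | A (v.1 + xi v.2)].
have mE : measurable E.
  rewrite -[E]setTI; have : measurable_fun setT (fun v : R * S => v.1 + xi v.2).
    by apply: measurable_funD => //; exact: measurableT_comp.
  exact.
have pre B' : Pr (partial_sum k.+1 @^-1` A `&` tail B' k.+1) =
    Pr (paired (partial_sum k) (W i0) @^-1` E `&` tail B' k.+1).
  by congr (Pr (_ `&` _)); apply/seteqP; split => w /=; rewrite (partial_sumS kn).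
have := joint (fun=> setT) E (fun=> measurableT) mE; rewrite -pre.
have -> : tail (fun=> setT) k.+1 = setT by apply/seteqP; split.
rewrite setIT big1 ?mule1; last by move=> i _; rewrite probability_setT.
by move=> ->; rewrite pre joint.
Qed.

Lemma joint_partial_sum k (kn : (k < n)%N) E : measurable E ->
  Pr (paired (partial_sum k) (W (Ordinal kn)) @^-1` E) =
  (distribution Pr (partial_sum k) \x Q)%E E.
Proof.
move=> mE; have := prefix_joint_law kn (partial_sum_law (ltnW kn)) (fun=> measurableT) mE.
rewrite big1 ?mule1; last by move=> i _; rewrite probability_setT.
by move=> <-; congr (Pr _); rewrite -[LHS]setIT; congr (_ `&` _); apply/seteqP; split.
Qed.

(** Fubini for the product of the laws of a partial sum and of the next variable. *)
Lemma E_partial_sumS K f k : (k < n)%N -> bounded_lipschitz K f ->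
  (forall x, 0 <= f x) ->
  \int[Pr]_w f (partial_sum k.+1 w) = \int[Pr]_w average Q xi f (partial_sum k w).
Proof.
move=> kn fK f0; pose i0 := Ordinal kn.
have mf := bounded_lipschitz_measurable fK.
have mxi : measurable_fun setT xi by [].
have maf := bounded_lipschitz_measurable (average_bounded_lipschitz Q mxi fK).
pose UV := paired (partial_sum k) (W i0).
pose h (v : R * S) := (f (v.1 + xi v.2))%:E.
have mh : measurable_fun setT h.
  apply/measurable_EFinP; apply: measurableT_comp => //.
  by apply: measurable_funD => //; exact: measurableT_comp.
have h0 v : (0 <= h v)%E by rewrite lee_fin.
rewrite /Rintegral; congr fine.
transitivity (\int[distribution Pr UV]_v h v)%E.
  rewrite ge0_integral_distribution//; apply: eq_integral => w _.
  by rewrite /h/= (partial_sumS kn).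
rewrite (eq_measure_integral (distribution Pr (partial_sum k) \x Q)%E); last first.
  by move=> E mE _; exact: (joint_partial_sum kn mE).
rewrite fubini_tonelli1// -[RHS]/(\int[Pr]_w ((EFin \o average Q xi f) \o partial_sum k) w)%E.
rewrite -ge0_integral_distribution//; last 2 first.
- exact/measurable_EFinP.
- by move=> y; rewrite lee_fin; exact: Rintegral_ge0.
apply: eq_integral => s _; rewrite /fubini_F/= /h/= EFinE//.
exact: bounded_lipschitz_L1 fK.
Qed.

Lemma E_partial_sum K f k : (k <= n)%N -> bounded_lipschitz K f ->
  (forall x, 0 <= f x) ->
  \int[Pr]_w f (partial_sum k w) = iter k (average Q xi) f 0.
Proof.
elim: k f => [|k IH] f kn fK f0.
  by under eq_Rintegral do rewrite partial_sum0; rewrite Ecst.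
have mxi : measurable_fun setT xi by [].
rewrite (E_partial_sumS kn fK f0) IH ?(ltnW kn)//.
- by rewrite -iterSr.
- exact: average_bounded_lipschitz.
- by move=> x; exact: Rintegral_ge0.
Qed.

End iid_sum.

(** * Smooth steps *)

Section smooth_test_functions.
Context (R : realType).
Implicit Types (K : R) (f : R -> R).

Lemma mean_value_le (f df : R -> R) (h C : R) :
  (forall u : R, is_derive u 1 f (df u)) ->
  (forall u, `|u| <= `|h| -> `|df u| <= C) -> `|f h - f 0| <= C * `|h|.
Proof.
move=> fdf dfC.
have cf (a b : R) : {within `[a, b], continuous f}.
  apply: continuous_subspaceT => u.
  by apply: differentiable_continuous; apply/derivable1_diffP; case: (fdf u).
have [h0|h0] := leP 0 h.
  have [c + ->] := MVT_segment h0 (fun u _ => fdf u) (cf 0 h).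
  rewrite in_itv/= subr0 => /andP[c0 ch].
  by rewrite normrM ler_wpM2r// dfC// !ger0_norm.
have [c + E] := MVT_segment (ltW h0) (fun u _ => fdf u) (cf h 0).
rewrite in_itv/= => /andP[c0 ch].
rewrite distrC E sub0r normrM normrN ler_wpM2r// dfC//.
by rewrite (ler0_norm ch) (ltr0_norm h0) lerN2.
Qed.

Lemma is_derive_shift (f df : R -> R) (x u : R) :
  (forall u : R, is_derive u 1 f (df u)) ->
  is_derive u 1 (fun u => f (x + u)) (df (x + u)).
Proof.
move=> fdf; have h : is_derive u (1 : R) (fun u : R => x + u) 1.
  by apply: is_derive_eq; rewrite add0r mulr1.
have := @is_derive1_comp _ f (fun u => x + u) u (df (x + u)) 1 (fdf (x + u)) h.
by rewrite mulr1.
Qed.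

(** The derivative in h of the remainder is the first-order remainder of f1. By the
    mean value inequality, the bounds on f3 give the cube; those on f2 alone
    give the square. *)
Lemma smooth_test_function K f f1 f2 f3 :
  (forall u : R, is_derive u 1 f (f1 u)) ->
  (forall u : R, is_derive u 1 f1 (f2 u)) ->
  (forall u : R, is_derive u 1 f2 (f3 u)) ->
  (forall u, `|f u| <= K) -> (forall u, `|f1 u| <= K) ->
  (forall u, `|f2 u| <= K) -> (forall u, `|f3 u| <= K) ->
  test_function (2 * K) f f1 f2.
Proof.
move=> d0 d1 d2 b0 b1 b2 b3.
have K0 : 0 <= K by apply: le_trans (b0 0).
have K2 (z : R) : z <= K -> z <= 2 * K by lra.
have lip (g dg : R -> R) : (forall u : R, is_derive u 1 g (dg u)) ->
    (forall u, `|dg u| <= K) -> forall x h, `|g (x + h) - g x| <= K * `|h|.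
  move=> dgg dgK x h.
  have := mean_value_le (fun u => is_derive_shift x u dgg) (fun u _ => dgK (x + u)).
  by move=> /(_ h); rewrite addr0.
have bl (g dg : R -> R) : (forall u : R, is_derive u 1 g (dg u)) -> (forall u, `|g u| <= K) ->
    (forall u, `|dg u| <= K) -> bounded_lipschitz (2 * K) g.
  move=> dgg gK dgK; split=> [x|x y]; first by rewrite K2.
  have := lip _ _ dgg dgK y (x - y); rewrite subrKC.
  by have := normr_ge0 (x - y); nra.
split; [exact: (bl _ _ d0)|exact: (bl _ _ d1)|exact: (bl _ _ d2)|].
move=> x h.
pose r1 u := f1 (x + u) - f1 x - f2 x * u.
pose r0 u := f (x + u) - f x - f1 x * u - f2 x * (u ^+ 2 / 2).
have dr1 (u : R) : is_derive u 1 r1 (f2 (x + u) - f2 x).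
  have := is_derive_shift x u d1 => ?.
  by apply: is_derive_eq; rewrite /GRing.scale/=; ring.
have dr0 (u : R) : is_derive u 1 r0 (r1 u).
  have := is_derive_shift x u d0 => ?.
  by apply: is_derive_eq; rewrite /r1 /GRing.scale/=; field.
have h0 := normr_ge0 h.
have e1 u : `|u| <= `|h| -> `|r1 u| <= K * `|h| * `|h|.
  move=> uh; have := @mean_value_le r1 (fun u => f2 (x + u) - f2 x) u (K * `|h|) dr1.
  rewrite {2}/r1 mulr0 addr0 !subrr subr0 => /(_ _) H.
  apply: le_trans (H _) _; last by rewrite ler_wpM2l// mulr_ge0.
  move=> v vu; apply: le_trans (lip _ _ d2 b3 x v) _.
  by rewrite ler_wpM2l// (le_trans vu).
have r00 : r0 0 = 0 by rewrite /r0 addr0 subrr mulr0 expr0n/= mul0r mulr0 !subr0.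
have cubic := mean_value_le dr0 e1; rewrite r00 subr0 in cubic.
rewrite -/(r0 h); have [_|_] := leP (h ^+ 2) (`|h| ^+ 3); last first.
  apply: le_trans cubic _; rewrite !exprS expr0 mulr1.
  have : 0 <= K * (`|h| * (`|h| * `|h|)) by rewrite !mulr_ge0.
  by lra.
pose g u := f (x + u) - f x - f1 x * u.
have dg (u : R) : is_derive u 1 g (f1 (x + u) - f1 x).
  have := is_derive_shift x u d0 => ?.
  by apply: is_derive_eq; rewrite /GRing.scale/=; ring.
have := @mean_value_le g (fun u => f1 (x + u) - f1 x) h (K * `|h|) dg.
rewrite {2}/g mulr0 addr0 !subrr subr0 -mulrA -expr2 sqr_norm => /(_ _) H.
have gh : `|g h| <= K * h ^+ 2.
  apply: H => v vh; apply: le_trans (lip _ _ d1 b2 x v) _.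
  by rewrite ler_wpM2l.
rewrite /r0 -/(g h) (le_trans (ler_normB _ _))//.
have b : `|f2 x * (h ^+ 2 / 2)| <= K * (h ^+ 2 / 2).
  rewrite normrM [`|_ / 2|]ger0_norm ?divr_ge0 ?sqr_ge0//.
  by rewrite ler_wpM2r ?b2 ?divr_ge0 ?sqr_ge0.
have := sqr_ge0 h.
by nra.
Qed.

(** A smooth step whose derivatives are polynomials in the step itself, hence
    bounded. *)
Definition logistic (l b t : R) := (1 + expR (l * t + b))^-1.

Lemma logistic_itv l b t : 0 <= logistic l b t <= 1.
Proof.
have := expR_gt0 (l * t + b) => e0.
have p : 0 < 1 + expR (l * t + b) by lra.
by rewrite /logistic invr_ge0 invf_le1// ltW//= lerDl ltW.
Qed.

Lemma is_derive_logistic l b (t : R) :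
  is_derive t 1 (logistic l b) (- l * (logistic l b t * (1 - logistic l b t))).
Proof.
have e0 := expR_gt0 (l * t + b).
have ne : 1 + expR (l * t + b) != 0 by rewrite gt_eqF// ltr_wpDl.
have d : is_derive t (1 : R) (fun t : R => l * t + b) l.
  by apply: is_derive_eq; rewrite /GRing.scale/=; ring.
have d1 : is_derive t (1 : R) (fun t : R => expR (l * t + b)) (expR (l * t + b) * l).
  exact: (@is_derive1_comp _ expR (fun t : R => l * t + b)).
have d2 : is_derive t (1 : R) (fun t : R => 1 + expR (l * t + b)) (expR (l * t + b) * l).
  by apply: is_derive_eq; rewrite add0r mul1r.
have := is_deriveV (f := fun t => 1 + expR (l * t + b)) ne d2.
congr (is_derive _ _ _ _); rewrite /logistic /GRing.scale/=.
by field.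
Qed.

Lemma logistic_test l b : 0 <= l ->
  exists K f1 f2, test_function K (logistic l b) f1 f2.
Proof.
move=> l0; move: (logistic l b) (is_derive_logistic l b) (logistic_itv l b).
move=> s ds s_itv.
pose f1 t := - l * (s t * (1 - s t)).
pose f2 t := l ^+ 2 * (s t * (1 - s t) * (1 - 2 * s t)).
pose f3 t := - l ^+ 3 * (s t * (1 - s t) * (1 - 6 * s t + 6 * s t ^+ 2)).
exists (2 * (1 + l + l ^+ 2 + l ^+ 3)), f1, f2.
have s01 t : 0 <= s t /\ s t <= 1 by apply/andP.
have l2 : 0 <= l ^+ 2 by rewrite exprn_ge0.
have l3 : 0 <= l ^+ 3 by rewrite exprn_ge0.
have q0 t : 0 <= s t * (1 - s t) <= 1.
  have [h0 h1] := s01 t; have h2 : 0 <= 1 - s t by lra.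
  by rewrite mulr_ge0//= mulr_ile1//; lra.
have bnd (k q c : R) : 0 <= k -> 0 <= q <= 1 -> `|c| <= 1 -> `|k * (q * c)| <= k.
  move=> k0 /andP[qq0 q1] c1; rewrite normrM (ger0_norm k0) ler_piMr//.
  by rewrite normrM (ger0_norm qq0) mulr_ile1.
have d1 u : is_derive u (1 : R) f1 (f2 u).
  by apply: is_derive_eq; rewrite /f2 /GRing.scale/=; ring.
have d2 u : is_derive u (1 : R) f2 (f3 u).
  by apply: is_derive_eq; rewrite /f3 /GRing.scale/=; ring.
have b0 u : `|s u| <= 1 + l + l ^+ 2 + l ^+ 3.
  by have [h0 h1] := s01 u; rewrite ger0_norm//; lra.
have b1 u : `|f1 u| <= 1 + l + l ^+ 2 + l ^+ 3.
  rewrite /f1 mulNr normrN -[s u * _]mulr1.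
  by rewrite (le_trans (bnd _ _ _ l0 (q0 u) _)) ?normr1//; lra.
have b2 u : `|f2 u| <= 1 + l + l ^+ 2 + l ^+ 3.
  have [h0 h1] := s01 u; rewrite (le_trans (bnd _ _ _ l2 (q0 u) _))//; last by lra.
  by rewrite ler_norml; apply/andP; split; lra.
have b3 u : `|f3 u| <= 1 + l + l ^+ 2 + l ^+ 3.
  have [h0 h1] := s01 u; rewrite /f3 mulNr normrN.
  rewrite (le_trans (bnd _ _ _ l3 (q0 u) _))//; last by lra.
  have -> : 1 - 6 * s u + 6 * s u ^+ 2 = 1 - 6 * (s u * (1 - s u)) by ring.
  have /andP[q00 _] := q0 u.
  have : s u * (1 - s u) <= 1 / 4.
    by have := sqr_ge0 (2 * s u - 1); rewrite expr2; lra.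
  by rewrite ler_norml => q4; apply/andP; split; lra.
exact: (smooth_test_function ds d1 d2).
Qed.

(** With slope 2 / e^2 the logistic function falls from 1 - e to e over an interval
    of length e, because exp (- 1 / e) <= e. *)
Lemma smooth_step (x e : R) : 0 < e ->
  exists f, [/\ exists K f1 f2, test_function K f f1 f2,
    forall t, 0 <= f t,
    forall t, t <= x -> 1 - e <= f t,
    forall t, f t <= 1 &
    forall t, x + e < t -> f t <= e].
Proof.
move=> e0; pose l := 2 / e ^+ 2; pose b := - (l * (x + e / 2)).
have l0 : 0 < l by rewrite divr_gt0// exprn_gt0.
have le2 : l * (e / 2) = e^-1 by rewrite /l; field; rewrite gt_eqF.
have step : expR (- e^-1) <= e.
  rewrite expRN -[leRHS]invrK lef_pV2 ?posrE ?invr_gt0 ?expR_gt0//.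
  by apply: le_trans (expR_ge1Dx _); rewrite lerDr.
exists (logistic l b); split.
- exact/logistic_test/ltW.
- by move=> t; have /andP[] := logistic_itv l b t.
- move=> t tx; have : expR (l * t + b) <= e.
    apply: le_trans step; rewrite ler_expR /b -le2.
    have : l * t <= l * x by rewrite ler_pM2l.
    by lra.
  have e1 := expR_gt0 (l * t + b); rewrite /logistic => ee.
  have p : 0 < 1 + expR (l * t + b) by lra.
  rewrite -(ler_pM2r p) mulVf ?gt_eqF//.
  have : 0 <= e * expR (l * t + b) by rewrite mulr_ge0 ?ltW.
  by lra.
- by move=> t; have /andP[] := logistic_itv l b t.
- move=> t tx; have e1 := expR_gt0 (l * t + b).
  have : e^-1 <= expR (l * t + b).
    rewrite -ler_pV2 ?inE ?unitfE ?gt_eqF ?invr_gt0// invrK -expRN.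
    apply: le_trans step; rewrite ler_expR lerN2 /b -le2.
    have : l * (x + e) < l * t by rewrite ltr_pM2l.
    by lra.
  move=> ee; have p : 0 < 1 + expR (l * t + b) by lra.
  rewrite /logistic -(ler_pM2r p) mulVf ?gt_eqF// mulrDr mulr1.
  have : e * e^-1 <= e * expR (l * t + b) by rewrite ler_pM2l.
  by rewrite divff ?gt_eqF//; lra.
Qed.

End smooth_test_functions.

(** * A central limit theorem for triangular arrays *)

Section centered_normal_local_error.
Context (R : realType).
Local Notation idR := (id : measurableTypeR R -> R).

Lemma centered_normal_fourth (v : R) : 0 <= v ->
  L1 (centered_normal v) (fun x => idR x ^+ 4) /\
  \int[centered_normal v]_x (idR x ^+ 4) <= 3 * v ^+ 2.
Proof.
have m4 : measurable_fun setT (fun x => idR x ^+ 4) by exact: measurable_funX.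
have x4 (x : R) : 0 <= x ^+ 4 by rewrite -[4%N]/(2 * 2)%N exprM sqr_ge0.
rewrite le_eqVlt => /predU1P[<-|v0].
  rewrite centered_normal0; split; last by rewrite E_dirac0// !expr0n/= mulr0.
  apply/integrableP; split; first exact/measurable_EFinP.
  rewrite integral_dirac//; last by apply/measurableT_comp => //; exact/measurable_EFinP.
  by rewrite diracT mul1e ltry.
have s0 : 0 < Num.sqrt v by rewrite sqrtr_gt0.
have fourth := normal_fourth_moment_le s0.
rewrite centered_normal_gt0//.
have E : (\int[normal_prob 0 (Num.sqrt v)]_x (idR x ^+ 4)%:E <= (3 * v ^+ 2)%:E)%E.
  rewrite (@ge0_integral_normal _ (Num.sqrt v))//; last exact/measurable_EFinP.
  have -> : v ^+ 2 = Num.sqrt v ^+ 4.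
    by rewrite -[4%N]/(2 * 2)%N exprM sqr_sqrtr// ltW.
  by under eq_integral do rewrite -EFinM.
have L4 : L1 (normal_prob 0 (Num.sqrt v)) (fun x => idR x ^+ 4).
  apply/integrableP; split; first exact/measurable_EFinP.
  under eq_integral => x _ do rewrite /= (ger0_norm (x4 x)).
  by rewrite (le_lt_trans E)// ltry.
by split=> //; rewrite -lee_fin -(EFinE L4).
Qed.

(** From |x|^3 <= t x^2 + x^4 / t. The parameter t is free so that it can later be
    taken of the order of the standard deviation. *)
Lemma centered_normal_min_moment (v t : R) : 0 <= v -> 0 < t ->
  \int[centered_normal v]_x Num.min (idR x ^+ 2) (`|idR x| ^+ 3) <=
  t * v + 3 * v ^+ 2 / t.
Proof.
move=> v0 t0; have [L2id _ E2] := centered_normal_moments v0.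
have [L4 E4] := centered_normal_fourth v0.
have mid : measurable_fun setT idR by exact: measurable_id.
have Lr := L1D (L1Zl t L2id.2) (L1Zl t^-1 L4).
have Lm : L1 (centered_normal v) (fun x => Num.min (idR x ^+ 2) (`|idR x| ^+ 3)).
  apply: L1_le L2id.2 _.
    by apply: measurable_minr; apply: measurable_funX => //; exact: measurableT_comp.
  by move=> w; rewrite ger0_norm ?ge_min ?lexx// le_min sqr_ge0 exprn_ge0.
apply: (@le_trans _ _ (t * v + t^-1 * \int[centered_normal v]_x (idR x ^+ 4))); last first.
  by rewrite lerD2l mulrC ler_wpM2r// invr_ge0 ltW.
rewrite -[X in t * X]E2 -(EZl t L2id.2) -(EZl t^-1 L4) -ED; [|exact: L1Zl L2id.2|exact: L1Zl].
apply: Ele => // x; rewrite ge_min; apply/orP; right.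
set y := idR x; rewrite -[y ^+ 2]sqr_norm.
have -> : y ^+ 4 = `|y| ^+ 4.
  by rewrite -normrX ger0_norm// -[4%N]/(2 * 2)%N exprM sqr_ge0.
have := normr_ge0 y; set z := `|y| => z0.
have tz0 : 0 <= t * z by rewrite mulr_ge0// ltW.
have : 0 <= z ^+ 2 * ((t - z) ^+ 2 + t * z).
  by apply: mulr_ge0; rewrite ?sqr_ge0// addr_ge0// sqr_ge0.
have -> : z ^+ 2 * ((t - z) ^+ 2 + t * z) = t * t * z ^+ 2 + z ^+ 4 - t * z ^+ 3.
  by ring.
move=> H; rewrite -(ler_pM2l t0) -subr_ge0.
have -> : t * (t * z ^+ 2 + t^-1 * z ^+ 4) - t * z ^+ 3 =
    t * t * z ^+ 2 + z ^+ 4 - t * z ^+ 3 by field; rewrite gt_eqF.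
exact: H.
Qed.

End centered_normal_local_error.

Section step_bounds.
Context d (Om : measurableType d) (R : realType) (Pr : probability Om R).
Variables (S : Om -> R) (f : R -> R) (x e : R).
Hypotheses (mS : measurable_fun setT S).
Hypotheses (fb : exists K, bounded_lipschitz K f) (f0 : forall t, 0 <= f t).

Let mle y : measurable [set w | S w <= y]. Proof. exact: measurable_le. Qed.

Let EI y : \int[Pr]_w \1_[set w | S w <= y] w = fine (Pr [set w | S w <= y]).
Proof. by rewrite /Rintegral integral_indic// setIT. Qed.

Let LI y : L1 Pr (\1_[set w | S w <= y] : Om -> R).
Proof.
apply: (@L1_bounded _ _ _ _ _ 1) => // w.
by rewrite indicE; case: (_ \in _); rewrite /= ?normr1 ?normr0.
Qed.

Let Lf : L1 Pr (fun w => f (S w)).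
Proof.
have [K fK] := fb; apply: (@L1_bounded _ _ _ _ _ K) => [|w]; last exact: fK.1.
by apply: measurableT_comp => //; exact: bounded_lipschitz_measurable fK.
Qed.

Lemma step_ge : (forall t, t <= x -> 1 - e <= f t) -> 0 <= e ->
  fine (Pr [set w | S w <= x]) <= \int[Pr]_w f (S w) + e.
Proof.
move=> fx e0; rewrite -EI -[X in _ <= _ + X](Ecst Pr) -ED//; last exact: L1_cst.
apply: Ele => [||w]; [exact: LI|by apply: L1D => //; exact: L1_cst|].
rewrite indicE; case: (boolP (w \in _)) => [/set_mem/= /fx|_] /=; first by lra.
by rewrite addr_ge0.
Qed.

Lemma step_le : (forall t, f t <= 1) -> (forall t, x < t -> f t <= e) -> 0 <= e ->
  \int[Pr]_w f (S w) <= fine (Pr [set w | S w <= x]) + e.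
Proof.
move=> f1 fx e0; rewrite -EI -[X in _ <= _ + X](Ecst Pr) -ED//; last exact: L1_cst.
apply: Ele => [||w]; [by []|by apply: L1D => //; exact: L1_cst|].
rewrite indicE; case: (boolP (w \in _)) => [_|] /=; first by rewrite (le_trans (f1 _))// lerDl.
by rewrite notin_setE/= => /negP; rewrite -ltNge add0r; exact: fx.
Qed.

End step_bounds.

Section inverse_square_root.
Context (R : realType).
Local Notation tN N := ((Num.sqrt N%:R)^-1 : R).

Lemma invsqrtn_ge0 N : 0 <= tN N. Proof. by rewrite invr_ge0 sqrtr_ge0. Qed.

Lemma invsqrtn_le1 N : tN N <= 1.
Proof.
case: N => [|N]; first by rewrite sqrtr0 invr0.
rewrite invf_le1 ?sqrtr_gt0 ?ltr0n//.
by rewrite -[leLHS]sqrtr1 ler_wsqrtr// ler1n.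
Qed.

Lemma sqr_invsqrtn N : tN N ^+ 2 = N%:R^-1.
Proof. by rewrite exprVn sqr_sqrtr. Qed.

Lemma cvg_invsqrtn : tN N @[N --> \oo] --> (0 : R).
Proof.
apply/cvgrPdist_le => e e0; near=> N.
have eN : e ^- 2 <= N%:R by near: N; exact: nbhs_infty_ger.
have e2 : 0 < e ^- 2 by rewrite invr_gt0 exprn_gt0.
rewrite sub0r normrN ger0_norm ?invr_ge0 ?sqrtr_ge0// -[leRHS]invrK.
rewrite lef_pV2 ?posrE ?invr_gt0 ?sqrtr_gt0//; last exact: lt_le_trans eN.
have -> : e^-1 = Num.sqrt (e ^- 2).
  by rewrite -exprVn sqrtr_sqr ger0_norm// invr_ge0 ltW.
exact: ler_wsqrtr.
Unshelve. all: by end_near.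
Qed.

End inverse_square_root.

Section central_limit.
Context (R : realType) dS (S : measurableType dS) (d : nat -> measure_display)
  (Om : forall N, measurableType (d N)) (Pr : forall N, probability (Om N) R)
  (Q : nat -> probability S R) (xi : nat -> {mfun S >-> R})
  (W : forall N, 'I_N -> {RV (Pr N) >-> S}) (v : R).
Local Notation idR := (id : measurableTypeR R -> R).

(** A step of the row N agrees, up to K (eps N), with f + (v / N) f2 / 2, which is an
    explicit step of length v / N for the heat equation. Over the N steps of the row
    the errors add up to N (eps N). *)
Definition local_error (eps : nat -> R) (N : nat) :=
  forall K f f1 f2, test_function K f f1 f2 -> forall x,
    `|average (Q N) (xi N) f x - f x - v / N%:R / 2 * f2 x| <= K * eps N.

Definition row_sum N (w : Om N) : R := \sum_(i < N) xi N (W i w).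

Hypothesis v0 : 0 <= v.
Hypothesis iidW : forall N, iid (@W N) (Q N).
Variable eps : nat -> R.
Hypothesis eps_small : N%:R * eps N @[N --> \oo] --> (0 : R).
Hypothesis eps_error : \forall N \near \oo, local_error eps N.

Lemma measurable_row_sum N : measurable_fun setT (@row_sum N).
Proof. by apply: measurable_sum => i; exact: measurableT_comp. Qed.

Lemma E_row_sum N K f : bounded_lipschitz K f -> (forall x, 0 <= f x) ->
  \int[Pr N]_w f (row_sum w) = iter N (average (Q N) (xi N)) f 0.
Proof.
move=> fK f0; rewrite -(E_partial_sum (xi N) (iidW N) (leqnn N) fK f0).
apply: eq_Rintegral => w _; congr f; apply: eq_bigl => i.
by rewrite ltn_ord.
Qed.

(** The steps N(0, v / N) have the same expansion and compose exactly to N(0, v).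
    Replacing the N steps of the row by them costs N times the sum of the two
    local errors, the second of which is of order N^(-3/2). *)
Lemma cvg_E_row_sum K f f1 f2 : test_function K f f1 f2 -> (forall x, 0 <= f x) ->
  \int[Pr N]_w f (row_sum w) @[N --> \oo] --> average (centered_normal v) idR f 0.
Proof.
move=> fT f0; have [fK _ _ _] := fT.
have K0 : 0 <= K by apply: le_trans (fK.1 0).
have mid : measurable_fun setT idR by exact: measurable_id.
pose delta (N : nat) : R := (Num.sqrt N%:R)^-1.
have delta_cvg : delta N @[N --> \oo] --> (0 : R) by exact: cvg_invsqrtn.
apply/cvgrPdist_le => e e0.
(* N times the local errors of the row and of the Gaussian steps, the latter with
   t := delta N in [centered_normal_min_moment]. *)
pose bound N := K * (N%:R * eps N) + K * (v + 3 * v ^+ 2) * delta N.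
have bound_cvg : bound N @[N --> \oo] --> (0 : R).
  rewrite -[X in _ --> X](addr0 0); apply: cvgD.
    by rewrite -[X in _ --> X](mulr0 K); apply: cvgMr.
  by rewrite -[X in _ --> X](mulr0 (K * (v + 3 * v ^+ 2))); apply: cvgMr.
near=> N.
have N0 : (0 < N)%N by near: N; exact: nbhs_infty_gt.
have NR : 0 < N%:R :> R by rewrite ltr0n.
have eN : local_error eps N by near: N.
apply: (@le_trans _ _ (bound N)); last first.
  apply: le_trans (ler_norm _) _; rewrite -[bound N]subr0 distrC.
  by near: N; apply: cvgr_dist_le.
have vN0 : 0 <= v / N%:R by rewrite divr_ge0// ltW.
have sN0 : 0 < Num.sqrt N%:R :> R by rewrite sqrtr_gt0.
have dN0 : 0 < delta N by rewrite invr_gt0.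
have d2 : delta N ^+ 2 = N%:R^-1 by rewrite exprVn sqr_sqrtr// ltW.
have Ec : average (centered_normal v) idR f 0 =
    iter N (average (centered_normal (v / N%:R)) idR) f 0.
  have := iter_average_centered_normal N 0 vN0 fK f0.
  have -> : N%:R * (v / N%:R) = v by rewrite mulrC divfK// gt_eqF.
  by move=> ->.
rewrite Ec (E_row_sum _ fK f0) distrC.
pose dl := K * eps N + K * (delta N * (v / N%:R) + 3 * (v / N%:R) ^+ 2 / delta N).
have mxi : measurable_fun setT (xi N) by [].
have := @iter_average_dist _ _ _ _ R (Q N) (centered_normal (v / N%:R)) (xi N) idR
  mxi mid K dl N _ f f1 f2 fT 0.
have -> : N%:R * dl = bound N.
  rewrite /dl /bound.
  have -> : delta N * (v / N%:R) = delta N ^+ 2 * v * delta N by rewrite d2; ring.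
  have -> : 3 * (v / N%:R) ^+ 2 / delta N = 3 * v ^+ 2 * delta N ^+ 3.
    by rewrite exprMn -d2; field; rewrite gt_eqF.
  have -> : N%:R = delta N ^- 2 by rewrite d2 invrK.
  by field; rewrite gt_eqF.
apply=> u u1 u2 uT x.
have h1 := eN _ _ _ _ uT x.
have [L2id E1 E2] := centered_normal_moments vN0.
have := average_second_order mid (v / N%:R) x uT L2id.
rewrite E1 E2 subrr normr0 !add0r => h2.
have h3 := centered_normal_min_moment vN0 dN0.
set A := average (Q N) _ _ _ in h1 *.
set B := average (centered_normal _) _ _ _ in h2 *.
have -> : A - B = (A - u x - v / N%:R / 2 * u2 x) - (B - u x - v / N%:R / 2 * u2 x) by ring.
rewrite (le_trans (ler_normB _ _))// lerD//.
by rewrite (le_trans h2)// ler_wpM2l.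
Unshelve. all: by end_near.
Qed.

(** Smooth steps on either side of x turn the convergence of expectations into
    closeness of the distribution functions in Levy's metric. The shifts of x by e
    accommodate the jumps of the limit, in particular the point mass for v = 0. *)
Lemma levy_clt (x e : R) : 0 < e -> \forall N \near \oo,
  fine (centered_normal v `]-oo, x - e]%classic) - e <=
    fine (Pr N [set w | row_sum w <= x]) <=
  fine (centered_normal v `]-oo, x + e]%classic) + e.
Proof.
move=> e0; pose e' := e / 3; have e'0 : 0 < e' by rewrite divr_gt0.
have ee : e = e' + e' + e' by rewrite /e'; field.
have mid : measurable_fun setT idR by exact: measurable_id.
have cdfE y : centered_normal v `]-oo, y]%classic =
    centered_normal v [set z | idR z <= y].
  by congr (centered_normal v _); apply/seteqP; split=> z /=; rewrite in_itv.
have row_le N y : measurable [set w | @row_sum N w <= y].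
  by apply: measurable_le; exact: measurable_row_sum.
have [fu [[K [f1 [f2 fuT]]] fu0 fux fu1 fue]] := smooth_step x e'0.
have [fl [[K' [g1 [g2 flT]]] fl0 flx fl1 fle]] := smooth_step (x - e) e'0.
have [fuK _ _ _] := fuT; have [flK _ _ _] := flT.
have fub : exists K, bounded_lipschitz K fu by exists K.
have flb : exists K, bounded_lipschitz K fl by exists K'.
have cu := cvg_E_row_sum fuT fu0; have cl := cvg_E_row_sum flT fl0.
have cdf_mono (a b : R) : a <= b -> fine (centered_normal v `]-oo, a]%classic) <=
    fine (centered_normal v `]-oo, b]%classic).
  by move=> ab; apply: fine_prob_le => // z /=; rewrite !in_itv/= => /le_trans; exact.
have Eid (f : R -> R) :
    average (centered_normal v) idR f 0 = \int[centered_normal v]_z f (idR z).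
  by apply: eq_Rintegral => z _; rewrite add0r.
near=> N; apply/andP; split.
- have h1 := step_ge (centered_normal v) mid flb fl0 flx (ltW e'0).
  have h2 : average (centered_normal v) idR fl 0 <= \int[Pr N]_w fl (row_sum w) + e'.
    have : `|average (centered_normal v) idR fl 0 - \int[Pr N]_w fl (row_sum w)| <= e'.
      by near: N; apply: cvgr_dist_le.
    by rewrite ler_norml => /andP[_]; lra.
  have h3 := step_le (Pr N) (@measurable_row_sum N) flb fl1 fle (ltW e'0).
  have h4 : fine (Pr N [set w | row_sum w <= x - e + e']) <=
      fine (Pr N [set w | row_sum w <= x]).
    by apply: fine_prob_le => // w /= /le_trans; apply; lra.
  by rewrite cdfE -Eid in h1 *; lra.
- have h1 := step_ge (Pr N) (@measurable_row_sum N) fub fu0 fux (ltW e'0).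
  have h2 : \int[Pr N]_w fu (row_sum w) <= average (centered_normal v) idR fu 0 + e'.
    have : `|average (centered_normal v) idR fu 0 - \int[Pr N]_w fu (row_sum w)| <= e'.
      by near: N; apply: cvgr_dist_le.
    by rewrite ler_norml => /andP[+ _]; lra.
  have h3 := step_le (centered_normal v) mid fub fu1 fue (ltW e'0).
  have h4 : x + e' <= x + e by lra.
  have := cdf_mono _ _ h4; rewrite [X in fine X <= _]cdfE => h5.
  by rewrite -Eid in h3; lra.
Unshelve. all: by end_near.
Qed.

End central_limit.

(** * The influence function *)

Section psi_moments.
Context (R : realType).
Local Notation pr1 := (fst : R * R -> R).
Local Notation pr2 := (snd : R * R -> R).

Lemma psiE (Q : probability (R * R)%type R) : L2 Q pr1 -> L2 Q pr2 ->
  psi Q = (\int[Q]_y (y.1 * y.2) - \int[Q]_y y.1 * \int[Q]_y y.2) /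
          (\int[Q]_y (y.1 ^+ 2) - (\int[Q]_y y.1) ^+ 2).
Proof.
move=> L2a L2b; have La := L2_L1 L2a; have Lb := L2_L1 L2b.
have Lab := L2M L2a L2b; have Laa := L2M L2a L2a.
rewrite /psi /variance !covarianceE ?Lfun1_integrable//; try exact/Lfun1_integrable.
have -> : ('E_Q[(pr1 * pr2)%R] = (\int[Q]_y (y.1 * y.2))%:E)%E.
  by rewrite unlock -EFinE.
have -> : ('E_Q[(pr1 * pr1)%R] = (\int[Q]_y (y.1 ^+ 2))%:E)%E.
  by rewrite unlock -EFinE//; exact: L2a.2.
have -> : ('E_Q[pr1] = (\int[Q]_y y.1)%:E)%E by rewrite unlock -EFinE.
have -> : ('E_Q[pr2] = (\int[Q]_y y.2)%:E)%E by rewrite unlock -EFinE.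
by rewrite -!EFinM -!EFinB/= expr2.
Qed.

End psi_moments.

Section influence_function.
Context (R : realType) (P : probability (R * R)%type R).
Local Notation pr1 := (fst : R * R -> R).
Local Notation pr2 := (snd : R * R -> R).
Hypotheses (L2a : L2 P pr1) (L2b : L2 P pr2).
Hypothesis swapP : forall h : R * R -> R, L1 P h ->
  \int[P]_y h (y.2, y.1) = \int[P]_y h y.

Definition mean := \int[P]_y y.1.
Definition var := \int[P]_y (y.1 ^+ 2) - mean ^+ 2.
Hypothesis var_neq0 : var != 0.

Definition cross_term (y : R * R) := (y.1 - mean) * (y.2 - mean).
Definition square_term (y : R * R) := ((y.1 - mean) ^+ 2 + (y.2 - mean) ^+ 2) / 2.
(** The first-order effect on Cov / Var of a small point mass at y, symmetrized
    over the two coordinates. *)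
Definition influence (y : R * R) := (cross_term y - psi P * square_term y) / var.

Let La := L2_L1 L2a.
Let Lb := L2_L1 L2b.
Let Lab := L2M L2a L2b.

Lemma mean_snd : \int[P]_y y.2 = mean.
Proof. exact: (swapP La). Qed.

Lemma sqr_snd : \int[P]_y (y.2 ^+ 2) = \int[P]_y (y.1 ^+ 2).
Proof. exact: (swapP L2a.2). Qed.

Let L2a0 : L2 P (fun y => y.1 - mean). Proof. exact: L2B L2a (L2_cst P _). Qed.
Let L2b0 : L2 P (fun y => y.2 - mean). Proof. exact: L2B L2b (L2_cst P _). Qed.

Lemma L1_cross : L1 P cross_term. Proof. exact: L2M. Qed.

Lemma L1_square : L1 P square_term.
Proof.
have := L1Zl 2^-1 (L1D L2a0.2 L2b0.2); congr (L1 P _).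
by apply/funext => y; rewrite mulrC.
Qed.

Lemma L1_influence : L1 P influence.
Proof.
have := L1Zl var^-1 (L1B L1_cross (L1Zl (psi P) L1_square)); congr (L1 P _).
by apply/funext => y; rewrite mulrC.
Qed.

Lemma influence_swap a b : influence (a, b) = influence (b, a).
Proof.
by rewrite /influence /cross_term /square_term/=; congr (_ / _); ring.
Qed.

Lemma psi_var : psi P * var = \int[P]_y (y.1 * y.2) - mean ^+ 2.
Proof. by rewrite psiE// mean_snd -/mean -/var -expr2 divfK. Qed.

(** By exchangeability the two coordinates have the same moments against a symmetric
    weight, so that symmetrized statistics reduce to moments of the first
    coordinate and of the product. *)
Lemma E_influence_weight (g : R * R -> R) (M : R) :
  measurable_fun setT g -> (forall x, `|g x| <= M) ->
  (forall a b : R, g (a, b) = g (b, a)) ->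
  var * \int[P]_y (influence y * g y) =
  \int[P]_y (y.1 * y.2 * g y) - 2 * mean * \int[P]_y (y.1 * g y) +
    mean ^+ 2 * \int[P]_y g y -
  psi P * (\int[P]_y (y.1 ^+ 2 * g y) - 2 * mean * \int[P]_y (y.1 * g y) +
    mean ^+ 2 * \int[P]_y g y).
Proof.
move=> mg gM gs.
have Lg : L1 P g by exact: L1_bounded gM.
have Lag := L1Mb La mg gM; have Lbg := L1Mb Lb mg gM.
have Labg := L1Mb Lab mg gM.
have Laag := L1Mb L2a.2 mg gM; have Lbbg := L1Mb L2b.2 mg gM.
have gsw (y : R * R) : g (y.2, y.1) = g y by case: y => a b; rewrite -gs.
have Ebg : \int[P]_y (y.2 * g y) = \int[P]_y (y.1 * g y).
  by rewrite -(swapP Lag); apply: eq_Rintegral => y _; rewrite /= gsw.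
have Ebbg : \int[P]_y (y.2 ^+ 2 * g y) = \int[P]_y (y.1 ^+ 2 * g y).
  by rewrite -(swapP Laag); apply: eq_Rintegral => y _; rewrite /= gsw.
have Lig := L1Mb L1_influence mg gM.
rewrite -EZl//.
pose ps := psi P; rewrite -/ps.
have L1' := L1B Labg (L1Zl mean (L1D Lag Lbg)).
have L2' := L1D L1' (L1Zl (mean ^+ 2) Lg).
have L3' := L1D Laag Lbbg.
have L4' := L1B (L1Zl 2^-1 L3') (L1Zl mean (L1D Lag Lbg)).
have L5' := L1D L4' (L1Zl (mean ^+ 2) Lg).
transitivity (\int[P]_y ((y.1 * y.2 * g y - mean * (y.1 * g y + y.2 * g y) +
    mean ^+ 2 * g y) -
   ps * (2^-1 * (y.1 ^+ 2 * g y + y.2 ^+ 2 * g y) - mean * (y.1 * g y + y.2 * g y)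
    + mean ^+ 2 * g y))).
  apply: eq_Rintegral => y _; rewrite /influence /cross_term /square_term -/ps.
  by field.
rewrite (EB L2' (L1Zl ps L5')) (EZl ps L5') (ED L1' (L1Zl _ Lg)).
rewrite (EB Labg (L1Zl mean (L1D Lag Lbg))) (EZl _ (L1D Lag Lbg)) (ED Lag Lbg).
rewrite (ED L4' (L1Zl _ Lg)) (EB (L1Zl _ L3') (L1Zl _ (L1D Lag Lbg))).
rewrite !(EZl _ (L1D Lag Lbg)) (EZl _ L3') (EZl _ Lg) (ED Lag Lbg) (ED Laag Lbbg).
by rewrite Ebg Ebbg; field.
Qed.

Lemma E_influence : \int[P]_y influence y = 0.
Proof.
have := @E_influence_weight (cst 1) 1.
have E1 (h : R * R -> R) : \int[P]_y (h y * cst 1 y) = \int[P]_y h y.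
  by apply: eq_Rintegral => y _; rewrite mulr1.
rewrite !E1 /= Ecst => H; apply: (mulfI var_neq0); rewrite mulr0.
rewrite H//; last by move=> x; rewrite normr1.
have := psi_var; rewrite /var -/mean => E.
have -> : \int[P]_y (y.1 * y.2) = psi P * (\int[P]_y y.1 ^+ 2 - mean ^+ 2) + mean ^+ 2.
  by rewrite E; ring.
by ring.
Qed.

Section score.
Variable g : R * R -> R.
Hypothesis gS : score_set P g.

Lemma score_mean0 : \int[P]_y g y = 0.
Proof. by case: gS => _ _ _; rewrite unlock /Rintegral => ->. Qed.

Let mg : measurable_fun setT g. Proof. by case: gS. Qed.

(** The variance of the first coordinate under the tilt by t. *)
Definition psi_tilt_den t := var +
  t * (\int[P]_y (y.1 ^+ 2 * g y) - 2 * mean * \int[P]_y (y.1 * g y)) -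
  t ^+ 2 * (\int[P]_y (y.1 * g y)) ^+ 2.

Definition psi_tilt_num t := var * \int[P]_y (influence y * g y) +
  t * ((psi P - 1) * (\int[P]_y (y.1 * g y)) ^+ 2).

Lemma psi_tilt M t : (forall x, `|g x| <= M) -> `|t| * M <= 1 -> psi_tilt_den t != 0 ->
  psi (tilt P g t) - psi P = t * (psi_tilt_num t / psi_tilt_den t).
Proof.
move=> gM tM den0; have [_ _ gs _] := gS.
have g0 := score_mean0.
have Et h Lh := @E_tilt _ _ _ _ mg gM g0 t tM h Lh.
have L2t h L2h := @L2_tilt _ _ _ _ mg gM g0 t tM h L2h.
have gsw (y : R * R) : g (y.2, y.1) = g y by case: y => a b; rewrite -gs.
have Lag := L1Mb La mg gM.
have Ebg : \int[P]_y (y.2 * g y) = \int[P]_y (y.1 * g y).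
  by rewrite -(swapP Lag); apply: eq_Rintegral => y _; rewrite /= gsw.
rewrite psiE; [|exact: L2t|exact: L2t].
rewrite (Et _ La) (Et _ Lb) (Et _ Lab) (Et _ L2a.2) mean_snd -/mean Ebg.
rewrite /psi_tilt_num (E_influence_weight mg gM gs) g0.
have Eab : \int[P]_y (y.1 * y.2) = psi P * var + mean ^+ 2 by rewrite psi_var subrK.
have Eaa : \int[P]_y (y.1 ^+ 2) = var + mean ^+ 2 by rewrite /var subrK.
move: den0; rewrite /psi_tilt_den Eab Eaa.
set A1 := \int[P]_y (y.1 * y.2 * g y); set B1 := \int[P]_y (y.1 * g y).
set D1 := \int[P]_y (y.1 ^+ 2 * g y).
move: (psi P) var mean => ps V m den0.
have -> : V + m ^+ 2 + t * D1 - (m + t * B1) ^+ 2 =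
  V + t * (D1 - 2 * m * B1) - t ^+ 2 * B1 ^+ 2 by ring.
by field; rewrite exprMn.
Qed.

(** The filter is arbitrary because the derivative is needed both for t tending to 0
    and along the sequence t = 1 / sqrt N. *)
Lemma cvg_psi_tilt_den (F : set_system R) {FF : Filter F} : t @[t --> F] --> (0 : R) ->
  psi_tilt_den t @[t --> F] --> var.
Proof.
move=> F0.
rewrite -[X in _ --> X]subr0 -[X in _ --> X - _]addr0 /psi_tilt_den.
apply: cvgB.
  apply: cvgD; first exact: cvg_cst.
  pose k := \int[P]_y (y.1 ^+ 2 * g y) - 2 * mean * \int[P]_y (y.1 * g y).
  by rewrite -[X in _ --> X](mul0r k); apply: cvgMl.
have -> : (0 : R) = (0 * 0) * (\int[P]_y (y.1 * g y)) ^+ 2 by rewrite !mul0r.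
by apply: cvgMl; under eq_fun do rewrite expr2; exact: cvgM.
Qed.

Lemma cvg_psi_tilt_quotient (F : set_system R) {FF : Filter F} : t @[t --> F] --> (0 : R) ->
  psi_tilt_num t / psi_tilt_den t @[t --> F] --> \int[P]_y (influence y * g y).
Proof.
move=> F0; have cden := @cvg_psi_tilt_den F FF F0.
have cnum : psi_tilt_num t @[t --> F] --> var * \int[P]_y (influence y * g y).
  rewrite -[X in _ --> X]addr0 /psi_tilt_num; apply: cvgD; first exact: cvg_cst.
  have -> : (0 : R) = 0 * ((psi P - 1) * (\int[P]_y (y.1 * g y)) ^+ 2) by rewrite !mul0r.
  exact: cvgMl.
have -> : \int[P]_y (influence y * g y) = var * \int[P]_y (influence y * g y) * var^-1.
  by rewrite mulrAC divff// mul1r.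
by apply: (cvgM cnum); exact: (cvgV var_neq0 cden).
Qed.

Lemma near_psi_tilt (F : set_system R) {FF : Filter F} : t @[t --> F] --> (0 : R) ->
  \forall t \near F, psi (tilt P g t) - psi P = t * (psi_tilt_num t / psi_tilt_den t).
Proof.
move=> F0; have [_ [M gM] _ _] := gS.
have M0 : 0 <= M by apply: le_trans (gM (0, 0)).
have M1 : 0 < (M + 1)^-1 by rewrite invr_gt0 ltr_wpDl.
near=> t; apply: (@psi_tilt M) => //.
  have : `|0 - t| <= (M + 1)^-1 by near: t; exact: cvgr_dist_le.
  rewrite sub0r normrN => tM.
  rewrite (le_trans (ler_wpM2r M0 tM))// mulrC ler_pdivrMr ?ltr_wpDl//.
  by rewrite mul1r lerDl.
near: t; exact: (cvgr_neq0 _ (cvg_psi_tilt_den F0)).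
Unshelve. all: by end_near.
Qed.

Lemma psi_derivative :
  (psi (tilt P g t) - psi P) / t @[t --> 0^'] --> \int[P]_y (influence y * g y).
Proof.
have F0 : t @[t --> (0 : R)^'] --> (0 : R) by exact: cvg_within.
apply: cvg_trans (cvg_psi_tilt_quotient F0); apply: near_eq_cvg.
near=> t; have -> : psi (tilt P g t) - psi P = t * (psi_tilt_num t / psi_tilt_den t).
  by near: t; exact: near_psi_tilt.
have t0 : t != 0 by near: t; exact: nbhs_dnbhs_neq.
by rewrite mulrAC divff// mul1r.
Unshelve. all: by end_near.
Qed.

Lemma psi_derivative_seq :
  Num.sqrt N%:R * (psi (tilt P g (Num.sqrt N%:R)^-1) - psi P) @[N --> \oo] -->
  \int[P]_y (influence y * g y).
Proof.
have c0 := @cvg_invsqrtn R.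
have F0 : t @[t --> ((Num.sqrt N%:R)^-1 : R) @[N --> \oo]] --> (0 : R) by exact: c0.
apply: cvg_trans (cvg_psi_tilt_quotient F0); apply: near_eq_cvg.
near=> N; have -> : psi (tilt P g (Num.sqrt N%:R)^-1) - psi P = (Num.sqrt N%:R)^-1 *
    (psi_tilt_num (Num.sqrt N%:R)^-1 / psi_tilt_den (Num.sqrt N%:R)^-1).
  by near: N; exact: (near_psi_tilt F0).
have N0 : 0 < Num.sqrt N%:R :> R.
  by rewrite sqrtr_gt0 ltr0n; near: N; exact: nbhs_infty_gt.
by rewrite mulrA divff ?gt_eqF// mul1r.
Unshelve. all: by end_near.
Qed.

End score.

End influence_function.

(** * The tangent set *)

Section truncation.
Context (R : realType).
Implicit Types (z c : R).

Definition clamp c z := Num.max (- c) (Num.min c z).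

Lemma clamp_bound c z : 0 <= c -> `|clamp c z| <= c.
Proof.
by move=> c0; rewrite ler_norml /clamp le_max lexx/= ge_max ge_min lexx/= andbT; lra.
Qed.

Lemma clamp_id c z : `|z| <= c -> clamp c z = z.
Proof.
rewrite ler_norml => /andP[h1 h2].
by rewrite /clamp (min_idPr h2); apply/max_idPr.
Qed.

Lemma clamp_le c z : 0 <= c -> `|clamp c z| <= `|z|.
Proof.
move=> c0; have [zc|cz] := leP `|z| c; first by rewrite clamp_id.
by rewrite (le_trans (clamp_bound _ c0))// ltW.
Qed.

Lemma sqr_clamp_le c z : 0 <= c -> clamp c z ^+ 2 <= z * clamp c z.
Proof.
move=> c0; have [zc|cz] := leP `|z| c; first by rewrite clamp_id// expr2.
rewrite /clamp; have [z0|z0] := leP 0 z.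
  have cz' : c <= z by rewrite -(ger0_norm z0) ltW.
  rewrite (min_idPl cz'); have -> : Num.max (- c) c = c by apply/max_idPr; lra.
  by rewrite expr2 ler_wpM2r.
have cz' : c <= - z by rewrite -(ltr0_norm z0) ltW.
have -> : Num.min c z = z by apply/min_idPr; lra.
have -> : Num.max (- c) z = - c by apply/max_idPl; lra.
by nra.
Qed.

Lemma cvg_clamp z : clamp n%:R z @[n --> \oo] --> z.
Proof.
apply: cvg_near_cst; near=> n; rewrite clamp_id//.
by near: n; exact: nbhs_infty_ger.
Unshelve. all: by end_near.
Qed.

Lemma measurable_clamp d (T : measurableType d) c (h : T -> R) :
  measurable_fun setT h -> measurable_fun setT (fun x => clamp c (h x)).
Proof. by move=> mh; apply: measurable_maxr => //; exact: measurable_minr. Qed.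

End truncation.

Section tangent.
Context (R : realType) (P : probability (R * R)%type R).
Implicit Types h : R * R -> R.

Definition truncated_score h n y := clamp n%:R (h y) - \int[P]_x clamp n%:R (h x).

Lemma score_truncation h n : measurable_fun setT h ->
  (forall a b, h (a, b) = h (b, a)) -> score_set P (truncated_score h n).
Proof.
move=> mh hs; have mc := measurable_clamp n%:R mh.
have cb x : `|clamp n%:R (h x)| <= n%:R by rewrite clamp_bound.
have Lc : L1 P (fun x => clamp n%:R (h x)) by exact: L1_bounded cb.
split.
- exact: measurable_funB.
- exists (n%:R + `|\int[P]_x clamp n%:R (h x)|) => x.
  by rewrite (le_trans (ler_normB _ _))// lerD2r.
- by move=> a b; rewrite /truncated_score hs.
- have L : L1 P (truncated_score h n) by apply: L1B => //; exact: L1_cst.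
  rewrite unlock (EFinE L) /truncated_score EB//; last exact: L1_cst.
  by rewrite Ecst subrr.
Qed.

Lemma cvg_truncated_score h : L2 P h -> \int[P]_x h x = 0 ->
  \int[P]_x ((h x - truncated_score h n x) ^+ 2) @[n --> \oo] --> (0 : R).
Proof.
move=> L2h E0; have Lh := L2_L1 L2h; have [mh _] := L2h.
have mc n := measurable_clamp n%:R mh.
have cb n x : `|clamp n%:R (h x)| <= `|h x| by rewrite clamp_le.
have Lc n : L1 P (fun x => clamp n%:R (h x)) by apply: L1_le (L1_norm Lh) _.
have m0 : \int[P]_x clamp n%:R (h x) @[n --> \oo] --> (0 : R).
  rewrite -E0; apply: (dominated_E _ _ (L1_norm Lh)) => //.
  by move=> x; exact: cvg_clamp.
pose A := \int[P]_x `|h x|.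
have mA n : `|\int[P]_x clamp n%:R (h x)| <= A by apply: Ele_norm => //; exact: L1_norm.
have A0 : 0 <= A by apply: le_trans (mA 0%N).
rewrite -(Ecst P 0).
apply: (@dominated_E _ _ _ P _ _ (fun x => 8 * h x ^+ 2 + 2 * A ^+ 2)) => //.
- move=> n; apply: measurable_funX; apply: measurable_funB => //.
  exact: measurable_funB.
- by apply: L1D (L1Zl _ L2h.2) (L1_cst _ _).
- move=> n x; rewrite ger0_norm ?sqr_ge0// -sqr_norm.
  have : `|h x - truncated_score h n x| <= 2 * `|h x| + A.
    rewrite (le_trans (ler_normB _ _))//.
    have := ler_normB (clamp n%:R (h x)) (\int[P]_x clamp n%:R (h x)).
    by have := cb n x; have := mA n; rewrite /truncated_score; lra.
  have := normr_ge0 (h x); have := normr_ge0 (h x - truncated_score h n x).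
  rewrite -[h x ^+ 2]sqr_norm.
  move: `|h x| `|_ - _| => p q q0 p0 qp.
  have : q ^+ 2 <= (2 * p + A) ^+ 2 by rewrite lerXn2r ?nnegrE// addr_ge0// mulr_ge0.
  have := sqr_ge0 (2 * p - A).
  by rewrite !expr2; lra.
- move=> x; rewrite -[X in _ --> X](expr0n _ 2).
  have c : h x - truncated_score h n x @[n --> \oo] --> (0 : R).
    rewrite -(subrr (h x)); apply: cvgB; first exact: cvg_cst.
    rewrite -[X in _ --> X](subr0 (h x)); apply: cvgB => //; exact: cvg_clamp.
  by rewrite expr2; exact: (cvgM c c).
Qed.

Lemma Lnorm2_lt h (e : R) : L2 P h -> 0 < e -> \int[P]_x (h x ^+ 2) < e ^+ 2 ->
  ('N[P]_(2%:E)[EFin \o h] < e%:E)%E.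
Proof.
move=> L2h e0 he; rewrite unlock/=.
have -> : (\int[P]_x (`|h x| `^ 2)%:E = (\int[P]_x (h x ^+ 2))%:E)%E.
  rewrite -EFinE; last exact: L2h.2.
  by apply: eq_integral => x _; rewrite powR_mulrn// -normrX ger0_norm ?sqr_ge0.
have I0 : 0 <= \int[P]_x (h x ^+ 2) by apply: Rintegral_ge0 => x _; rewrite sqr_ge0.
rewrite poweR_EFin lte_fin powR12_sqrt//.
by rewrite -[ltRHS]ger0_norm ?ltW// -sqrtr_sqr ltr_sqrt// exprn_gt0.
Qed.

(** The recentred truncations of h are bounded symmetric scores that converge to h
    in L^2 by dominated convergence. *)
Lemma tangent_of_L2 h : L2 P h -> (forall a b, h (a, b) = h (b, a)) ->
  \int[P]_x h x = 0 -> tangent_set P h.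
Proof.
move=> L2h hs E0; split; first exact/L2_Lfun.
move=> e e0; have [mh _] := L2h.
have c := cvg_truncated_score L2h E0.
have : \forall n \near \oo, \int[P]_x ((h x - truncated_score h n x) ^+ 2) < e ^+ 2.
  by apply: (cvgr_lt _ c); rewrite exprn_gt0.
move=> [n _ /(_ n (leqnn n)) he]; exists (truncated_score h n).
  exact: score_truncation.
apply: Lnorm2_lt => //; apply: L2B => //.
apply: L2B; last exact: L2_cst.
apply: (@L2_bounded _ _ _ _ _ n%:R); first exact: measurable_clamp.
by move=> x; rewrite clamp_bound.
Qed.

(** Let h_n be the truncation of h at level n. Its recentring is a score, and pairing
    with it gives E (h_n^2) <= E (h h_n) = E (k0 h_n), where k0 is k minus its mean;
    hence E (h_n^2) <= E (k0^2) whatever n is. Fatou's lemma concludes. *)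
Lemma L2_of_pairing h k : L1 P h -> (forall a b, h (a, b) = h (b, a)) ->
  \int[P]_x h x = 0 -> L2 P k ->
  (forall g, score_set P g -> \int[P]_x (k x * g x) = \int[P]_x (h x * g x)) ->
  L2 P h.
Proof.
move=> Lh hs E0 L2k pairing; have mh := L1_measurable Lh.
have mc n := measurable_clamp n%:R mh.
have cb n x : `|clamp n%:R (h x)| <= n%:R by rewrite clamp_bound.
have L2c n : L2 P (fun x => clamp n%:R (h x)) by exact: L2_bounded (cb n).
have Lk := L2_L1 L2k.
pose B := \int[P]_x ((k x - \int[P]_y k y) ^+ 2).
have L2k0 : L2 P (fun x => k x - \int[P]_y k y) by apply: L2B => //; exact: L2_cst.
have bound n : \int[P]_x (clamp n%:R (h x) ^+ 2) <= B.
  have Lc := L2_L1 (L2c n); set m := \int[P]_x clamp n%:R (h x).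
  have Lhc := L1Mb Lh (mc n) (cb n).
  have Lkc := L1Mb Lk (mc n) (cb n).
  have e1 : \int[P]_x (h x * truncated_score h n x) = \int[P]_x (h x * clamp n%:R (h x)).
    rewrite -[RHS]subr0 -(mulr0 m) -E0 -(EZl m Lh) -(EB Lhc (L1Zl m Lh)).
    by apply: eq_Rintegral => x _; rewrite /truncated_score -/m; ring.
  have e2 : \int[P]_x (k x * truncated_score h n x) =
      \int[P]_x ((k x - \int[P]_y k y) * clamp n%:R (h x)).
    transitivity (\int[P]_x (k x * clamp n%:R (h x)) - m * \int[P]_x k x).
      rewrite -(EZl m Lk) -(EB Lkc (L1Zl m Lk)).
      by apply: eq_Rintegral => x _; rewrite /truncated_score -/m; ring.
    rewrite [m * _]mulrC /m -(EZl _ Lc) -(EB Lkc (L1Zl _ Lc)).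
    by apply: eq_Rintegral => x _; rewrite mulrBl.
  have := pairing _ (score_truncation n mh hs); rewrite e1 e2 => e12.
  have h1 : \int[P]_x (clamp n%:R (h x) ^+ 2) <= \int[P]_x (h x * clamp n%:R (h x)).
    by apply: Ele => [||x]; [exact: (L2c n).2|by []|rewrite sqr_clamp_le].
  have h2 : 2 * \int[P]_x ((k x - \int[P]_y k y) * clamp n%:R (h x)) <=
      B + \int[P]_x (clamp n%:R (h x) ^+ 2).
    rewrite -(EZl 2 (L2M L2k0 (L2c n))) /B -(ED L2k0.2 (L2c n).2).
    apply: Ele => [||x]; [exact: L1Zl (L2M _ _)|exact: L1D L2k0.2 (L2c n).2|].
    by have := sqr_ge0 (k x - \int[P]_y k y - clamp n%:R (h x)); rewrite !expr2; lra.
  by lra.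
split=> //; apply/integrableP; split; first exact/measurable_EFinP/measurable_funX.
apply: (@le_lt_trans _ _ B%:E); last exact: ltry.
rewrite (_ : (\int[P]_x _)%E = (\int[P]_x (limn_einf (fun n => (clamp n%:R (h x) ^+ 2)%:E)))%E).
  apply: le_trans (fatou _ _ _ _) _ => //.
  - by move=> n; apply/measurable_EFinP/measurable_funX.
  - by move=> n x _; rewrite lee_fin sqr_ge0.
  rewrite limn_einf_lim; apply: lime_le; first exact: is_cvg_einfs.
  apply: nearW => n; apply: (@le_trans _ _ (\int[P]_x (clamp n%:R (h x) ^+ 2)%:E)%E).
    by apply: ereal_inf_lbound; exists n => /=.
  by rewrite (EFinE (L2c n).2) lee_fin.
apply: eq_integral => x _; rewrite /= ger0_norm ?sqr_ge0//.
have cv : (clamp n%:R (h x) ^+ 2)%:E @[n --> \oo] --> (h x ^+ 2)%:E.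
  apply: cvg_EFin; first exact: nearW.
  by have c := @cvg_clamp _ (h x); rewrite expr2; exact: (cvgM c c).
rewrite is_cvg_limn_einfE; first by apply/esym/cvg_lim.
by apply/cvg_ex; eexists; exact: cv.
Qed.

End tangent.

(** * The estimator near the truth *)

Section estimator_measurable.
Context (R : realType).

(** Real powers are measurable also across 0, and 1 / x is x times the power -1
    of x^2. *)
Lemma measurable_invr : measurable_fun setT (fun x : R => x^-1).
Proof.
rewrite (_ : (fun x : R => x^-1) = (fun x => x * (x ^+ 2) `^ (-1))); last first.
  apply/funext => x; rewrite powR_inv1 ?sqr_ge0//.
  have [->|x0] := eqVneq x 0; first by rewrite invr0 mul0r.
  by rewrite expr2 invfM mulrA divff// mul1r.
apply: measurable_funM => //.
by apply: (@measurableT_comp _ _ _ _ _ _ (fun x : R => x `^ (-1))).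
Qed.

Lemma measurable_sobol_estimator (c : R) N :
  measurable_fun setT (@sobol_estimator R c N).
Proof.
have mmean (F : R * R -> R) : measurable_fun setT F ->
    measurable_fun setT (fun w : N.-tuple (R * R) => N%:R^-1 * \sum_(i < N) F (tnth w i)).
  move=> mF; apply: measurable_funM => //; apply: measurable_sum => i.
  by apply: measurableT_comp => //; exact: measurable_tnth.
rewrite /sobol_estimator /=.
have m1 := @measurable_fst _ _ R R; have m2 := @measurable_snd _ _ R R.
have m1' : measurable_fun setT (fst : R * R -> R) by [].
have m2' : measurable_fun setT (snd : R * R -> R) by [].
have mcen : measurable_fun setT (fun w : N.-tuple (R * R) =>
    (N%:R^-1 * \sum_(i < N) (((tnth w i).1 + (tnth w i).2) / 2)) ^+ 2).
  apply: measurable_funX; apply: (mmean (fun y => (y.1 + y.2) / 2)).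
  by apply: measurable_funM => //; exact: measurable_funD.
have mnum := measurable_funB (mmean _ (measurable_funM m1' m2')) mcen.
have mden : measurable_fun setT (fun w : N.-tuple (R * R) =>
    N%:R^-1 * (\sum_(i < N) (((tnth w i).1 ^+ 2 + (tnth w i).2 ^+ 2) / 2)) -
    (N%:R^-1 * \sum_(i < N) (((tnth w i).1 + (tnth w i).2) / 2)) ^+ 2).
  apply: measurable_funB => //; apply: (mmean (fun y => (y.1 ^+ 2 + y.2 ^+ 2) / 2)).
  by apply: measurable_funM => //; apply: measurable_funD; exact: measurable_funX.
apply: measurable_fun_ifT => //.
- by apply: measurable_fun_eqr => //.
- apply: measurable_funM => //.
  exact: (measurableT_comp measurable_invr mden).
Qed.

End estimator_measurable.

Section event_comparison.
Context (R : realType).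

(** The deterministic part of the delta method. Here t is 1 / sqrt N, num / den is the
    estimator, psN is the target under the tilt, and G, C, D are normalized sums.
    Multiplying t^-1 (num / den - psN) <= x by den > 0 turns it into G <= x up to
    terms controlled by C, D and s - e. *)
Lemma event_comparison (x e eps eta t s G C D V ps psN num den : R) :
  0 < V -> 0 < t -> t <= 1 -> 0 < eta -> eta <= 1 -> eta <= V / 4 ->
  eta * (`|1 - ps| + 2 * (`|x| + `|e| + 1)) <= V * (eps / 2) ->
  s = (psN - ps) / t -> `|s - e| <= eps / 2 -> `|s - e| <= 1 ->
  `|C| <= eta -> `|D| <= eta ->
  den = V + D - t * C ^+ 2 ->
  num - ps * den = V * t * (G + e) - (1 - ps) * (t * C ^+ 2) ->
  [/\ den != 0, G <= x - eps -> t^-1 * (num / den - psN) <= x &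
      t^-1 * (num / den - psN) <= x -> G <= x + eps].
Proof.
move=> V0 t0 t1 eta0 eta1 etaV etaA sE se se1 Ceta Deta denE numE.
have C2' : C ^+ 2 <= eta.
  have : C ^+ 2 <= eta ^+ 2 by rewrite -sqr_norm lerXn2r ?nnegrE// ltW.
  by move=> /le_trans; apply; rewrite expr2 ler_piMr// ltW.
have C2 : `|t * C ^+ 2| <= eta.
  rewrite (ger0_norm (mulr_ge0 (ltW t0) (sqr_ge0 C))).
  by apply: le_trans C2'; rewrite ler_piMl ?sqr_ge0.
have DC : `|D - t * C ^+ 2| <= 2 * eta.
  by rewrite (le_trans (ler_normB _ _))//; lra.
have den0 : 0 < den.
  have : - (2 * eta) <= D - t * C ^+ 2 by move: DC; rewrite ler_norml => /andP[].
  by rewrite denE; lra.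
have psNE : psN = ps + t * s by rewrite sE; field; rewrite gt_eqF.
pose Z := (1 - ps) * C ^+ 2 + (x + s) * (D - t * C ^+ 2).
have key : (t^-1 * (num / den - psN) <= x) = (V * G <= V * x + V * (s - e) + Z).
  have -> : (V * G <= V * x + V * (s - e) + Z) =
      (t * (V * G) <= t * (V * x + V * (s - e) + Z)) by rewrite ler_pM2l.
  have -> : (t^-1 * (num / den - psN) <= x) = (num <= (t * x + psN) * den).
    by rewrite mulrC ler_pdivrMr// lerBlDr ler_pdivrMr// [x * t]mulrC.
  rewrite -subr_ge0 -[in RHS]subr_ge0; congr (0 <= _).
  have -> : num = V * t * (G + e) - (1 - ps) * (t * C ^+ 2) + ps * den.
    by rewrite -numE subrK.
  by rewrite psNE denE /Z; ring.
have s1 : `|s| <= `|e| + 1.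
  by have := ler_normD (s - e) e; rewrite subrK; lra.
have Zle : `|Z| <= V * (eps / 2).
  apply: le_trans etaA; rewrite /Z (le_trans (ler_normD _ _))//.
  rewrite (normrM (1 - ps)) (normrM (x + s)).
  rewrite (ger0_norm (sqr_ge0 C)).
  have xs : `|x + s| <= `|x| + `|e| + 1 by have := ler_normD x s; lra.
  have n1 := normr_ge0 (1 - ps); have n2 := normr_ge0 (x + s).
  have h1 : `|1 - ps| * C ^+ 2 <= `|1 - ps| * eta by rewrite ler_wpM2l.
  have h2 : `|x + s| * `|D - t * C ^+ 2| <= (`|x| + `|e| + 1) * (2 * eta).
    by rewrite ler_pM.
  by lra.
have Vse : `|V * (s - e)| <= V * (eps / 2) by rewrite normrM gtr0_norm// ler_pM2l.
move: Zle Vse; rewrite !ler_norml => /andP[z1 z2] /andP[v1 v2].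
split; first by rewrite gt_eqF.
- move=> GX; rewrite key.
  have : V * G <= V * (x - eps) by rewrite ler_pM2l.
  by lra.
- rewrite key => GX; rewrite -(ler_pM2l V0); lra.
Qed.

End event_comparison.

(** * Expansion errors under the tilted laws *)

Section local_errors.
Context (R : realType) (P : probability (R * R)%type R).
Variables (g : R * R -> R) (M : R).
Hypothesis mg : measurable_fun setT g.
Hypothesis gM : forall x, `|g x| <= M.
Hypothesis g0 : \int[P]_x g x = 0.
Implicit Types h : R * R -> R.

Local Notation E h := (\int[P]_y h y).
Local Notation tN N := ((Num.sqrt N%:R)^-1 : R).

Lemma near_tilt_small : \forall N \near \oo, `|tN N| * M <= 1.
Proof.
have M0 : 0 <= M by apply: le_trans (gM (0, 0)).
have M1 : 0 < (M + 1)^-1 by rewrite invr_gt0 ltr_wpDl.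
near=> N; have : `|0 - tN N| <= (M + 1)^-1.
  by near: N; apply: cvgr_dist_le => //; exact: cvg_invsqrtn.
rewrite sub0r normrN => tM.
rewrite (le_trans (ler_wpM2r M0 tM))// mulrC ler_pdivrMr ?ltr_wpDl//.
by rewrite mul1r lerDl.
Unshelve. all: by end_near.
Qed.

(** Under the tilt by t the function t h has mean e t^2, where e = E (h g); the
    subtraction makes the summand centred under that tilt. *)
Definition clt_term h e t y : R := t * h y - e * t ^+ 2.

(** What [average_second_order] leaves for this summand, with the truncated moment
    transferred from the tilt to P by [E_tilt_le]. *)
Definition clt_error h e t : R := t ^+ 2 *
  (`|t * \int[P]_y (h y ^+ 2 * g y) - e ^+ 2 * t ^+ 2| +
   2 * \int[P]_y Num.min ((h y - e * t) ^+ 2) (t * `|h y - e * t| ^+ 3)).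

Lemma clt_term_error h t : L2 P h -> E h = 0 -> 0 <= t -> `|t| * M <= 1 ->
  let e := \int[P]_y (h y * g y) in
  forall K f f1 f2, test_function K f f1 f2 -> forall x,
  `|average (tilt P g t) (clt_term h e t) f x - f x -
    t ^+ 2 * \int[P]_y (h y ^+ 2) / 2 * f2 x| <= K * clt_error h e t.
Proof.
move=> L2h E0 t0 tM e K f f1 f2 fT x.
have [mh _] := L2h; have Lh := L2_L1 L2h.
have Et k Lk := @E_tilt _ _ _ _ mg gM g0 t tM k Lk.
have L2t k L2k := @L2_tilt _ _ _ _ mg gM g0 t tM k L2k.
pose k y := h y - e * t.
have L2k : L2 P k by apply: L2B L2h (L2_cst P _).
have Lxi : L2 P (clt_term h e t) by exact: L2B (L2Zl t L2h) (L2_cst P _).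
have xiE y : clt_term h e t y = t * k y by rewrite /clt_term /k; ring.
have K0 : 0 <= K by have [[fK _] _ _ _] := fT; apply: le_trans (fK 0).
apply: le_trans (average_second_order Lxi.1 _ x fT (L2t _ Lxi)) _.
apply: ler_wpM2l => //; rewrite /clt_error mulrDr; apply: lerD.
- have -> : \int[tilt P g t]_w clt_term h e t w = 0.
    rewrite Et; last exact: L2_L1 Lxi.
    have -> : \int[P]_y clt_term h e t y = - (e * t ^+ 2).
      by rewrite EB; [rewrite (EZl t Lh) E0 mulr0 Ecst sub0r|exact: L1Zl|exact: L1_cst].
    have Lhg := L1Mb Lh mg gM.
    have Lg : L1 P g by exact: L1_bounded gM.
    have -> : \int[P]_y (clt_term h e t y * g y) = t * e.
      transitivity (\int[P]_y (t * (h y * g y) - e * t ^+ 2 * g y)).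
        by apply: eq_Rintegral => y _; rewrite /clt_term; ring.
      by rewrite (EB (L1Zl t Lhg) (L1Zl _ Lg)) (EZl t Lhg) (EZl _ Lg) g0 mulr0 subr0.
    by ring.
  rewrite normr0 add0r.
  have nt (z : R) : t ^+ 2 * `|z| = `|t ^+ 2 * z|.
    by rewrite normrM (ger0_norm (sqr_ge0 t)).
  rewrite nt le_eqVlt; apply/orP; left; apply/eqP; congr `|_|; rewrite Et; last exact: Lxi.2.
  have Lhhg := L1Mb L2h.2 mg gM; have Lhg := L1Mb Lh mg gM.
  have Lg : L1 P g by exact: L1_bounded gM.
  have L1c : L1 P (fun y => t ^+ 2 * h y ^+ 2 - 2 * e * t ^+ 3 * h y).
    exact: L1B (L1Zl _ L2h.2) (L1Zl _ Lh).
  have -> : \int[P]_y (clt_term h e t y ^+ 2) =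
      t ^+ 2 * \int[P]_y (h y ^+ 2) + e ^+ 2 * t ^+ 4.
    transitivity (\int[P]_y (t ^+ 2 * h y ^+ 2 - 2 * e * t ^+ 3 * h y + e ^+ 2 * t ^+ 4)).
      by apply: eq_Rintegral => y _; rewrite /clt_term; ring.
    rewrite (ED L1c (L1_cst _ _)) Ecst (EB (L1Zl _ L2h.2) (L1Zl _ Lh)).
    by rewrite (EZl _ L2h.2) (EZl _ Lh) E0 mulr0 subr0.
  have -> : \int[P]_y (clt_term h e t y ^+ 2 * g y) =
      t ^+ 2 * \int[P]_y (h y ^+ 2 * g y) - 2 * e * t ^+ 3 * e.
    transitivity (\int[P]_y (t ^+ 2 * (h y ^+ 2 * g y) - 2 * e * t ^+ 3 * (h y * g y)
        + e ^+ 2 * t ^+ 4 * g y)).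
      by apply: eq_Rintegral => y _; rewrite /clt_term; ring.
    rewrite (ED (L1B (L1Zl _ Lhhg) (L1Zl _ Lhg)) (L1Zl _ Lg)).
    rewrite (EB (L1Zl _ Lhhg) (L1Zl _ Lhg)).
    by rewrite (EZl _ Lhhg) (EZl _ Lhg) (EZl _ Lg) g0 mulr0 addr0.
  by ring.
- have mn (c : R) : measurable_fun setT (fun y => Num.min (k y ^+ 2) (c * `|k y| ^+ 3)).
    apply: measurable_minr; first by apply: measurable_funX; exact: L2k.1.
    apply: measurable_funM => //; apply: measurable_funX; apply: measurableT_comp => //.
    exact: L2k.1.
  have Lm : L1 P (fun y => Num.min (k y ^+ 2) (t * `|k y| ^+ 3)).
    apply: L1_le L2k.2 _ => // y.
    rewrite ger0_norm ?ge_min ?lexx// le_min sqr_ge0/=.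
    by rewrite mulr_ge0 ?exprn_ge0.
  have -> : \int[tilt P g t]_w Num.min (clt_term h e t w ^+ 2) (`|clt_term h e t w| ^+ 3) =
      \int[tilt P g t]_w (t ^+ 2 * Num.min (k w ^+ 2) (t * `|k w| ^+ 3)).
    apply: eq_Rintegral => y _; rewrite minr_pMr ?sqr_ge0// xiE normrM (ger0_norm t0).
    by congr Num.min; ring.
  rewrite EZl; last exact: (L1_tilt mg gM g0 tM).
  rewrite ler_wpM2l ?sqr_ge0//; apply: (E_tilt_le mg gM g0 tM Lm) => y.
  by rewrite le_min sqr_ge0/= mulr_ge0 ?exprn_ge0.
Qed.

(** Since N t^2 = 1, only the bracket remains. Its second term tends to 0 by dominated
    convergence: this is Lindeberg's condition for a square-integrable function. *)
Lemma clt_error_small h e : L2 P h ->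
  N%:R * clt_error h e (tN N) @[N --> \oo] --> (0 : R).
Proof.
move=> L2h; have [mh _] := L2h.
have ct := @cvg_invsqrtn R.
have ct2 : tN N ^+ 2 @[N --> \oo] --> (0 : R).
  by have c := cvgM ct ct; rewrite mulr0 in c; exact: c.
pose rest N := `|tN N * \int[P]_y (h y ^+ 2 * g y) - e ^+ 2 * tN N ^+ 2| +
   2 * \int[P]_y Num.min ((h y - e * tN N) ^+ 2) (tN N * `|h y - e * tN N| ^+ 3).
have : rest N @[N --> \oo] --> (0 : R).
  rewrite -[X in _ --> X](addr0 0); apply: cvgD.
    rewrite -[X in _ --> X](@normr0 _ R); apply: cvg_norm.
    rewrite -[X in _ --> X](subr0 0); apply: cvgB.
      by rewrite -[X in _ --> X](mul0r (\int[P]_y (h y ^+ 2 * g y))); apply: cvgMl.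
    by rewrite -[X in _ --> X](mulr0 (e ^+ 2)); apply: cvgMr.
  rewrite -[X in _ --> X](mulr0 2); apply: cvgMr; rewrite -[X in _ --> X](Ecst P 0).
  have mk N : measurable_fun setT (fun y => h y - e * tN N) by exact: measurable_funB.
  apply: (@dominated_E _ _ _ P _ _ (fun y => 2 * h y ^+ 2 + 2 * e ^+ 2)) => //.
  - move=> N; apply: measurable_minr; first exact: measurable_funX.
    by apply: measurable_funM => //; apply: measurable_funX; exact: measurableT_comp.
  - exact: L1D (L1Zl _ L2h.2) (L1_cst _ _).
  - move=> N y; rewrite ger0_norm; last first.
      by rewrite le_min sqr_ge0/= mulr_ge0 ?exprn_ge0 ?invsqrtn_ge0.
    rewrite ge_min; apply/orP; left.
    have et : (e * tN N) ^+ 2 <= e ^+ 2.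
      by rewrite exprMn ler_piMr ?sqr_ge0// expr_le1 ?invsqrtn_ge0 ?invsqrtn_le1.
    have := sqr_ge0 (h y + e * tN N); move: et; rewrite !expr2; lra.
  - move=> y; have ck : h y - e * tN N @[N --> \oo] --> h y.
      rewrite -[X in _ --> X]subr0; apply: cvgB; first exact: cvg_cst.
      by rewrite -[X in _ --> X](mulr0 e); apply: cvgMr.
    apply: (@squeeze_cvgr _ _ _ _ (cst 0) (fun N => tN N * `|h y - e * tN N| ^+ 3)).
    + apply: nearW => N; rewrite ge_min lexx orbT andbT.
      by rewrite le_min sqr_ge0/= mulr_ge0 ?exprn_ge0 ?invsqrtn_ge0.
    + exact: cvg_cst.
    + rewrite -[X in _ --> X](mul0r (`|h y| ^+ 3)); apply: cvgM => //.
      have ca : `|h y - e * tN N| @[N --> \oo] --> `|h y| by exact: cvg_norm.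
      exact: (cvgM ca (cvgM ca ca)).
apply: cvg_trans; apply: near_eq_cvg; near=> N.
have N0 : N%:R != 0 :> R by rewrite pnatr_eq0 -lt0n; near: N; exact: nbhs_infty_gt.
have NN : N%:R * tN N ^+ 2 = 1 by rewrite sqr_invsqrtn divff.
by rewrite /clt_error mulrA NN mul1r.
Unshelve. all: by end_near.
Qed.

(** What [average_first_order] leaves for the summand xi t under the tilt by t. *)
Definition lln_error (xi : R -> R * R -> R) t : R :=
  `|\int[tilt P g t]_y xi t y| +
  2 * \int[tilt P g t]_y Num.min `|xi t y| (xi t y ^+ 2).

(** Under the tilt, c h has mean c t E (h g), which the first condition on c controls;
    the truncated moment at most doubles, which leaves the second condition. *)
Lemma scaled_lln_error_small h (c : R -> R) : L1 P h -> E h = 0 ->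
  (forall N, 0 <= c (tN N)) ->
  c (tN N) * N%:R * tN N @[N --> \oo] --> (0 : R) ->
  N%:R * \int[P]_y Num.min `|c (tN N) * h y| ((c (tN N) * h y) ^+ 2)
    @[N --> \oo] --> (0 : R) ->
  N%:R * lln_error (fun t y => c t * h y) (tN N) @[N --> \oo] --> (0 : R).
Proof.
move=> Lh E0 c0 c1 c2; have mh := L1_measurable Lh.
pose b N := c (tN N) * N%:R * tN N * `|\int[P]_y (h y * g y)| +
  4 * (N%:R * \int[P]_y Num.min `|c (tN N) * h y| ((c (tN N) * h y) ^+ 2)).
have cb : b N @[N --> \oo] --> (0 : R).
  rewrite -[X in _ --> X](addr0 0); apply: cvgD.
    by rewrite -[X in _ --> X](mul0r (`|\int[P]_y (h y * g y)|)); apply: cvgMl.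
  by rewrite -[X in _ --> X](mulr0 4); apply: cvgMr.
apply: (squeeze_cvgr _ (@cvg_cst _ 0 _ _ _) cb).
near=> N; have tM : `|tN N| * M <= 1 by near: N; exact: near_tilt_small.
have Lm : L1 P (fun y => Num.min `|c (tN N) * h y| ((c (tN N) * h y) ^+ 2)).
  apply: L1_le (L1_norm (L1Zl (c (tN N)) Lh)) _.
    apply: measurable_minr; first by apply: measurableT_comp => //; exact: measurable_funM.
    by apply: measurable_funX; exact: measurable_funM.
  by move=> w; rewrite ger0_norm ?ge_min ?lexx// le_min sqr_ge0 normr_ge0.
have m0 y : 0 <= Num.min `|c (tN N) * h y| ((c (tN N) * h y) ^+ 2).
  by rewrite le_min sqr_ge0 normr_ge0.
apply/andP; split.
  by rewrite mulr_ge0// addr_ge0// mulr_ge0//; apply: Rintegral_ge0.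
rewrite /lln_error mulrDr lerD//.
- rewrite EZl; last exact: (L1_tilt mg gM g0 tM).
  rewrite (E_tilt mg gM g0 tM Lh) E0 add0r !normrM.
  rewrite (ger0_norm (c0 N)) (ger0_norm (invsqrtn_ge0 R N)).
  by rewrite !mulrA [N%:R * _]mulrC.
- have -> : 4 * (N%:R * \int[P]_y Num.min `|c (tN N) * h y| ((c (tN N) * h y) ^+ 2)) =
    N%:R * (2 * (2 * \int[P]_y Num.min `|c (tN N) * h y| ((c (tN N) * h y) ^+ 2))) by ring.
  by rewrite !ler_wpM2l//; exact: (E_tilt_le mg gM g0 tM Lm).
Unshelve. all: by end_near.
Qed.

End local_errors.

(** * Sums that vanish in probability *)

Section vanishing_sums.
Context (R : realType) dS (S : measurableType dS) (d : nat -> measure_display)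
  (Om : forall N, measurableType (d N)) (Pr : forall N, probability (Om N) R)
  (Q : nat -> probability S R) (xi : nat -> {mfun S >-> R})
  (W : forall N, 'I_N -> {RV (Pr N) >-> S}).
Hypothesis iidW : forall N, iid (@W N) (Q N).
Variable eps : nat -> R.
Hypothesis eps_small : N%:R * eps N @[N --> \oo] --> (0 : R).
Hypothesis eps_error : \forall N \near \oo, local_error Q xi 0 eps N.

Lemma fine_dirac0 (y : R) :
  fine (centered_normal (0 : R) `]-oo, y]%classic) = (0 <= y)%R%:R.
Proof.
rewrite centered_normal0 /= /dirac indicE/=; congr (_%:R); congr nat_of_bool.
by apply/idP/idP => [/set_mem|h]; [|apply/mem_set]; rewrite /= in_itv.
Qed.

(** For v = 0 the limit in [levy_clt] is the point mass at 0, and closeness to its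
    distribution function is convergence in probability to 0. *)
Lemma vanishing_row_sum (eta e : R) : 0 < eta -> 0 < e -> \forall N \near \oo,
  fine (Pr N [set w | eta < `|row_sum xi W w|]) <= e.
Proof.
move=> eta0 e0; pose e' := Num.min (e / 2) (eta / 2).
have e'0 : 0 < e' by rewrite lt_min !divr_gt0.
have e1 : e' <= e / 2 by rewrite ge_min lexx.
have e2 : e' <= eta / 2 by rewrite ge_min lexx orbT.
have c1 := levy_clt (lexx 0) iidW eps_small eps_error eta e'0.
have c2 := levy_clt (lexx 0) iidW eps_small eps_error (- eta) e'0.
near=> N.
have /andP[h1 _] : fine (centered_normal 0 `]-oo, eta - e']%classic) - e' <=
    fine (Pr N [set w | row_sum xi W w <= eta]) <=
    fine (centered_normal 0 `]-oo, eta + e']%classic) + e' by near: N.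
have /andP[_ h2] : fine (centered_normal 0 `]-oo, - eta - e']%classic) - e' <=
    fine (Pr N [set w | row_sum xi W w <= - eta]) <=
    fine (centered_normal 0 `]-oo, - eta + e']%classic) + e' by near: N.
have p1 : 0 <= eta - e' by lra.
have p2 : (0 <= - eta + e') = false by apply/negbTE; rewrite -ltNge; lra.
rewrite fine_dirac0 p1 in h1; rewrite fine_dirac0 p2 in h2.
have mS : measurable_fun setT (row_sum xi W (N:=N)) by exact: measurable_row_sum.
have m1 := measurable_le eta mS; have m2 := measurable_le (- eta) mS.
have sub : [set w : Om N | eta < `|row_sum xi W w|] `<=`
    [set w : Om N | row_sum xi W w <= - eta] `|` ~` [set w : Om N | row_sum xi W w <= eta].
  move=> w /= h; have [r0|r0] := leP 0 (row_sum xi W w).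
    by right => /=; apply/negP; rewrite -ltNge -(ger0_norm r0).
  by left; rewrite lerNr -(ltr0_norm r0) ltW.
have mset := measurable_norm_gt eta mS.
have := fine_prob_le (Pr N) mset (measurableU _ _ m2 (measurableC m1)) sub.
move=> /le_trans; apply; apply: le_trans (fine_probU (Pr N) m2 (measurableC m1)) _.
by rewrite fine_probC//; move: h1 h2; rewrite /=; lra.
Unshelve. all: by end_near.
Qed.

End vanishing_sums.

(** * The estimator in terms of normalized sums *)

Section sample_moments.
Context (R : realType) (P : probability (R * R)%type R).
Variables (N : nat) (y : N.-tuple (R * R)) (e : R).
Hypothesis N0 : (0 < N)%N.
Hypothesis var_neq0 : var P != 0.

Local Notation t := ((Num.sqrt N%:R)^-1 : R).
Local Notation smean F := (N%:R^-1 * \sum_(i < N) F (tnth y i)).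

Definition average_term (z : R * R) := (z.1 + z.2) / 2 - mean P.
Definition sample_num := smean (fun z : R * R => z.1 * z.2) -
  (smean (fun z : R * R => (z.1 + z.2) / 2)) ^+ 2.
Definition sample_den := smean (fun z : R * R => (z.1 ^+ 2 + z.2 ^+ 2) / 2) -
  (smean (fun z : R * R => (z.1 + z.2) / 2)) ^+ 2.

(* The factor sqrt t * t = t^(3/2) makes t C^2 the square of the deviation of the
   sample centre from the mean. *)
Let G := \sum_(i < N) clt_term (influence P) e t (tnth y i).
Let C := \sum_(i < N) (Num.sqrt t * t * average_term (tnth y i)).
Let D := \sum_(i < N) (t ^+ 2 * (square_term P (tnth y i) - var P)).

Let m := mean P.
Let A := \sum_(i < N) ((tnth y i).1 * (tnth y i).2).
Let B := \sum_(i < N) (((tnth y i).1 + (tnth y i).2) / 2).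
Let B2 := \sum_(i < N) (((tnth y i).1 ^+ 2 + (tnth y i).2 ^+ 2) / 2).

Let sum_cst (c : R) : \sum_(i < N) c = N%:R * c.
Proof. by rewrite sumr_const card_ord mulr_natl. Qed.

Let sum_average : \sum_(i < N) average_term (tnth y i) = B - N%:R * m.
Proof. by rewrite sumrB sum_cst. Qed.

Let sum_square : \sum_(i < N) square_term P (tnth y i) = B2 - 2 * m * B + N%:R * m ^+ 2.
Proof.
rewrite -sum_cst mulr_sumr -sumrB -big_split/=.
by apply: eq_bigr => i _; rewrite /square_term -/m; field.
Qed.

Let sum_cross : \sum_(i < N) cross_term P (tnth y i) = A - 2 * m * B + N%:R * m ^+ 2.
Proof.
rewrite -sum_cst mulr_sumr -sumrB -big_split/=.
by apply: eq_bigr => i _; rewrite /cross_term -/m; field.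
Qed.

Let sum_influence : \sum_(i < N) influence P (tnth y i) =
  (A - 2 * m * B + N%:R * m ^+ 2 - psi P * (B2 - 2 * m * B + N%:R * m ^+ 2)) / var P.
Proof.
rewrite -sum_cross -sum_square mulr_sumr -sumrB mulr_suml.
by apply: eq_bigr.
Qed.

Let NR : 0 < N%:R :> R. Proof. by rewrite ltr0n. Qed.
Let t0 : 0 < t. Proof. by rewrite invr_gt0 sqrtr_gt0. Qed.
Let Nt : N%:R = t ^- 2. Proof. by rewrite sqr_invsqrtn invrK. Qed.

Let tC2 : t * C ^+ 2 = (N%:R^-1 * B - m) ^+ 2.
Proof.
rewrite /C -mulr_sumr sum_average !exprMn sqr_sqrtr ?ltW//.
by move: t0 Nt; move: t => s s0 ->; field; rewrite gt_eqF.
Qed.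

Lemma sample_denE : sample_den = var P + D - t * C ^+ 2.
Proof.
rewrite tC2 /sample_den -/B -/B2 /D -mulr_sumr sumrB sum_cst sum_square.
by move: t0 Nt; move: t => s s0 ->; field; rewrite gt_eqF.
Qed.

(** An exact identity. Up to the factor var P, the part of num - psi den that is
    linear in the sample is the sum of the influence function; the squared centre
    contributes the rest. *)
Lemma sample_numE : sample_num - psi P * sample_den =
  var P * t * (G + e) - (1 - psi P) * (t * C ^+ 2).
Proof.
rewrite tC2 /sample_num /sample_den -/A -/B -/B2 /G sumrB sum_cst -mulr_sumr.
rewrite sum_influence.
by move: t0 Nt; move: t => s s0 ->; field; rewrite var_neq0 gt_eqF.
Qed.

Lemma sobol_estimatorE c : sample_den != 0 ->
  sobol_estimator c y = sample_num / sample_den.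
Proof. by move=> /negPf den0; rewrite /sobol_estimator -/sample_den den0. Qed.

End sample_moments.

(** * Regularity *)

Section regularity.
Context (R : realType) (P : probability (R * R)%type R).
Local Notation pr1 := (fst : R * R -> R).
Local Notation pr2 := (snd : R * R -> R).
Hypotheses (L2a : L2 P pr1) (L2b : L2 P pr2).
Hypothesis swapP : forall h : R * R -> R, L1 P h ->
  \int[P]_y h (y.2, y.1) = \int[P]_y h y.
Hypothesis var_neq0 : var P != 0.
Hypothesis L2i : L2 P (influence P).
Variable c : R.

Local Notation tN N := ((Num.sqrt N%:R)^-1 : R).

Let La := L2_L1 L2a.
Let Lb := L2_L1 L2b.

Lemma var_gt0 : 0 < var P.
Proof.
rewrite lt_neqAle eq_sym var_neq0/=.
have L2a0 : L2 P (fun y => y.1 - mean P) by exact: L2B L2a (L2_cst P _).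
have -> : var P = \int[P]_y ((y.1 - mean P) ^+ 2).
  have Lc : L1 P (fun y => y.1 ^+ 2 - 2 * mean P * y.1) by exact: L1B L2a.2 (L1Zl _ La).
  transitivity (\int[P]_y (y.1 ^+ 2 - 2 * mean P * y.1 + mean P ^+ 2)).
    rewrite (ED Lc (L1_cst _ _)) Ecst (EB L2a.2 (L1Zl _ La)) (EZl _ La) -/(mean P).
    by rewrite /var; ring.
  by apply: eq_Rintegral => y _; ring.
by apply: Rintegral_ge0 => y _; rewrite sqr_ge0.
Qed.

Lemma L2_average_term : L2 P (average_term P).
Proof.
have := L2B (L2Zl 2^-1 (L2D L2a L2b)) (L2_cst P (mean P)); congr (L2 P).
by apply/funext => y; rewrite /average_term mulrC.
Qed.

Lemma E_average_term : \int[P]_y average_term P y = 0.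
Proof.
have Lab := L1D La Lb.
transitivity (\int[P]_y (2^-1 * (y.1 + y.2) - mean P)).
  by apply: eq_Rintegral => y _; rewrite /average_term mulrC.
rewrite (EB (L1Zl _ Lab) (L1_cst _ _)) Ecst (EZl _ Lab) (ED La Lb).
by rewrite (mean_snd L2a swapP) -/(mean P); field.
Qed.

Lemma E_square_term : \int[P]_y (square_term P y - var P) = 0.
Proof.
have Lab := L1D La Lb; have L2ab := L1D L2a.2 L2b.2.
have Lc := L1B (L1Zl 2^-1 L2ab) (L1Zl (mean P) Lab).
transitivity (\int[P]_y (2^-1 * (y.1 ^+ 2 + y.2 ^+ 2) - mean P * (y.1 + y.2) +
    (mean P ^+ 2 - var P))).
  by apply: eq_Rintegral => y _; rewrite /square_term; field.
rewrite (ED Lc (L1_cst _ _)) Ecst (EB (L1Zl _ L2ab) (L1Zl _ Lab)).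
rewrite (EZl _ L2ab) (EZl _ Lab) (ED La Lb) (ED L2a.2 L2b.2).
rewrite (mean_snd L2a swapP) (sqr_snd L2a swapP) -/(mean P) /var.
by field.
Qed.

Section score.
Variable g : R * R -> R.
Hypothesis gS : score_set P g.
Variable M : R.
Hypothesis gM : forall x, `|g x| <= M.
Let mg : measurable_fun setT g. Proof. by case: gS. Qed.
Let g0 : \int[P]_x g x = 0. Proof. exact: score_mean0. Qed.

Let ct := @cvg_invsqrtn R.

Let NtN N : (0 < N)%N -> N%:R * tN N ^+ 2 = 1.
Proof. by move=> N0; rewrite sqr_invsqrtn divff// pnatr_eq0 -lt0n. Qed.

(** With N t^2 = 1, the sum of the N summands has variance of order N t^3 = t. *)
Lemma average_lln_small :
  N%:R * lln_error P g (fun t y => Num.sqrt t * t * average_term P y) (tN N)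
    @[N --> \oo] --> (0 : R).
Proof.
have L2h := L2_average_term; have Lh := L2_L1 L2h.
have E0 := E_average_term; have [mh _] := L2h.
apply: (scaled_lln_error_small (c := fun t => Num.sqrt t * t) mg gM g0 Lh E0).
- by move=> N; rewrite mulr_ge0 ?sqrtr_ge0 ?invsqrtn_ge0.
- have cs : Num.sqrt (tN N) @[N --> \oo] --> (0 : R).
    rewrite -[X in _ --> X](@sqrtr0 R).
    by apply: continuous_cvg; [exact: sqrt_continuous|exact: ct].
  apply: cvg_trans cs; apply: near_eq_cvg; near=> N.
  have N0 : (0 < N)%N by near: N; exact: nbhs_infty_gt.
  have -> : Num.sqrt (tN N) * tN N * N%:R * tN N = Num.sqrt (tN N) * (N%:R * tN N ^+ 2) by ring.
  by rewrite NtN// mulr1.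
- apply: (@squeeze_cvgr _ _ _ _ (cst 0) (fun N => tN N * \int[P]_y (average_term P y ^+ 2))).
  + near=> N; have N0 : (0 < N)%N by near: N; exact: nbhs_infty_gt.
    apply/andP; split.
      by rewrite mulr_ge0//; apply: Rintegral_ge0 => y _; rewrite le_min sqr_ge0 normr_ge0.
    set k := fun y => Num.sqrt (tN N) * tN N * average_term P y.
    have L2k : L2 P k by exact: L2Zl.
    have -> : tN N * \int[P]_y (average_term P y ^+ 2) = N%:R * \int[P]_y (k y ^+ 2).
      have kE y : k y ^+ 2 = tN N ^+ 3 * average_term P y ^+ 2.
        by rewrite /k !exprMn sqr_sqrtr ?invsqrtn_ge0//; ring.
      under [in RHS]eq_Rintegral do rewrite kE.
      rewrite (EZl _ L2h.2).
      have -> : N%:R * (tN N ^+ 3 * \int[P]_y (average_term P y ^+ 2)) =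
        (N%:R * tN N ^+ 2) * tN N * \int[P]_y (average_term P y ^+ 2) by ring.
      by rewrite NtN// mul1r.
    rewrite ler_wpM2l//; apply: Ele; [|exact: L2k.2|by move=> y; rewrite ge_min lexx orbT].
    apply: L1_le L2k.2 _.
      apply: measurable_minr; last exact: measurable_funX L2k.1.
      by apply: measurableT_comp => //; exact: L2k.1.
    by move=> w; rewrite ger0_norm ?ge_min ?lexx ?orbT// le_min sqr_ge0 normr_ge0.
  + exact: cvg_cst.
  + by rewrite -[X in _ --> X](mul0r (\int[P]_y (average_term P y ^+ 2))); apply: cvgMl.
Unshelve. all: by end_near.
Qed.

(** Here the summands need not have a variance; the truncated moment is scaled by
    N t^2 = 1 and tends to 0 by dominated convergence. *)
Lemma square_lln_small :
  N%:R * lln_error P g (fun t y => t ^+ 2 * (square_term P y - var P)) (tN N)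
    @[N --> \oo] --> (0 : R).
Proof.
have Lh : L1 P (fun y => square_term P y - var P).
  exact: L1B (L1_square L2a L2b) (L1_cst _ _).
have E0 := E_square_term; have mh := L1_measurable Lh.
apply: (scaled_lln_error_small (c := fun t => t ^+ 2) mg gM g0 Lh E0).
- by move=> N; rewrite sqr_ge0.
- apply: cvg_trans ct; apply: near_eq_cvg; near=> N.
  have N0 : (0 < N)%N by near: N; exact: nbhs_infty_gt.
  have -> : tN N ^+ 2 * N%:R * tN N = (N%:R * tN N ^+ 2) * tN N by ring.
  by rewrite NtN// mul1r.
- set h := fun y => square_term P y - var P.
  have : \int[P]_y Num.min `|h y| ((tN N * h y) ^+ 2) @[N --> \oo] --> (0 : R).
    rewrite -[X in _ --> X](Ecst P 0).
    apply: (@dominated_E _ _ _ P _ _ (fun y => `|h y|)) => //.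
    + move=> N; apply: measurable_minr; first exact: measurableT_comp.
      by apply: measurable_funX; exact: measurable_funM.
    + exact: L1_norm.
    + move=> N y; rewrite ger0_norm; first by rewrite ge_min lexx.
      by rewrite le_min normr_ge0 sqr_ge0.
    + move=> y; apply: (@squeeze_cvgr _ _ _ _ (cst 0) (fun N => (tN N * h y) ^+ 2)).
      * by apply: nearW => N; rewrite ge_min lexx orbT andbT le_min normr_ge0 sqr_ge0.
      * exact: cvg_cst.
      * have cth : tN N * h y @[N --> \oo] --> (0 : R).
          by rewrite -[X in _ --> X](mul0r (h y)); apply: cvgMl.
        by have cc := cvgM cth cth; rewrite mulr0 in cc; exact: cc.
  apply: cvg_trans; apply: near_eq_cvg; near=> N.
  have N0 : (0 < N)%N by near: N; exact: nbhs_infty_gt.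
  have Lm : L1 P (fun y => Num.min `|h y| ((tN N * h y) ^+ 2)).
    apply: L1_le (L1_norm Lh) _.
      apply: measurable_minr; first exact: measurableT_comp.
      by apply: measurable_funX; exact: measurable_funM.
    by move=> w; rewrite ger0_norm ?ge_min ?lexx// le_min sqr_ge0 normr_ge0.
  set I := (LHS); have -> : I = N%:R * (tN N ^+ 2 * I) by rewrite mulrA NtN// mul1r.
  rewrite /I -(EZl _ Lm); congr (_ * _).
  apply: eq_Rintegral => y _; rewrite minr_pMr ?sqr_ge0//; congr Num.min.
    by rewrite normrM ger0_norm ?sqr_ge0.
  by rewrite /h; ring.
Unshelve. all: by end_near.
Qed.

End score.

Lemma lln_local_error (g : R * R -> R) M (xi : R -> R * R -> R)
    (X : nat -> {mfun (R * R)%type >-> R}) :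
  score_set P g -> (forall x, `|g x| <= M) ->
  (forall N, X N = xi (tN N) :> (R * R -> R)) -> (forall t, L1 P (xi t)) ->
  \forall N \near \oo, local_error (fun N => tilt P g (tN N)) X 0
    (fun N => lln_error P g xi (tN N)) N.
Proof.
move=> gS gM XE Lxi; have [mg _ _ _] := gS; have g0 := score_mean0 gS.
near=> N => K f f1 f2 fT x; rewrite !mul0r subr0 XE.
have tM : `|tN N| * M <= 1 by near: N; exact: near_tilt_small gM.
apply: average_first_order fT _; last exact: (L1_tilt mg gM g0 tM).
exact: L1_measurable (Lxi _).
Unshelve. all: by end_near.
Qed.

Let sandwich (eps r p pu pl F0 Fu Fl : R) : eps <= r ->
  `|F0 - Fu| <= r -> `|F0 - Fl| <= r ->
  p <= pu + (r + r) -> pl <= p + (r + r) -> pu <= Fu + eps -> Fl - eps <= pl ->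
  `|F0 - p| <= 4 * r.
Proof.
rewrite !ler_norml => ? /andP[? ?] /andP[? ?] *.
by apply/andP; split; lra.
Qed.

(** By [sample_denE], [sample_numE] and [event_comparison], outside the events where C
    or D exceeds eta, the normalized error lies below x when G lies below x - eps, and
    only if G lies below x + eps. The sum G obeys [levy_clt]; C and D vanish in
    probability by [vanishing_row_sum]. *)
Lemma regular_sobol : regular_with_limit (sobol_estimator c) (@psi R) P
  (centered_normal (\int[P]_x (influence P x ^+ 2))).
Proof.
split; first exact: measurable_sobol_estimator.
move=> g gS d Om Pr W iidW x cx.
have [mg [M gM] gs _] := gS; have g0 := score_mean0 gS.
set v := \int[P]_x (influence P x ^+ 2).
have v0 : 0 <= v by apply: Rintegral_ge0 => y _; rewrite sqr_ge0.
pose e := \int[P]_y (influence P y * g y).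
have Ei := E_influence L2a L2b swapP var_neq0.
have [mi _] := L2i.
pose xi1 N := clt_term (influence P) e (tN N).
pose xi2 t (y : R * R) := Num.sqrt t * t * average_term P y.
pose xi3 t (y : R * R) := t ^+ 2 * (square_term P y - var P).
have mxi1 N : measurable_fun setT (xi1 N).
  by apply: measurable_funB => //; exact: measurable_funM.
have Lxi2 t : L1 P (xi2 t) by apply: L1Zl; exact: L2_L1 L2_average_term.
have Lxi3 t : L1 P (xi3 t).
  by apply: L1Zl; exact: L1B (L1_square L2a L2b) (L1_cst _ _).
pose X1 N : {mfun (R * R)%type >-> R} := HB.pack (xi1 N)
  (isMeasurableFun.Build _ _ _ _ _ (mxi1 N)).
pose X2 N : {mfun (R * R)%type >-> R} := HB.pack (xi2 (tN N))
  (isMeasurableFun.Build _ _ _ _ _ (L1_measurable (Lxi2 (tN N)))).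
pose X3 N : {mfun (R * R)%type >-> R} := HB.pack (xi3 (tN N))
  (isMeasurableFun.Build _ _ _ _ _ (L1_measurable (Lxi3 (tN N)))).
pose Q N := tilt P g (tN N).
have err1 : \forall N \near \oo,
    local_error Q X1 v (fun N => clt_error P g (influence P) e (tN N)) N.
  near=> N => K f f1 f2 fT z.
  have tM : `|tN N| * M <= 1 by near: N; exact: near_tilt_small gM.
  have := clt_term_error mg gM g0 L2i Ei (invsqrtn_ge0 R N) tM fT z.
  by rewrite sqr_invsqrtn [_ * v]mulrC.
have small1 := clt_error_small g e L2i.
have err2 := lln_local_error (X := X2) gS gM (fun N => erefl) Lxi2.
have small2 := average_lln_small gS gM.
have err3 := lln_local_error (X := X3) gS gM (fun N => erefl) Lxi3.
have small3 := square_lln_small gS gM.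
pose S N (w : Om N) : R := Num.sqrt N%:R *
  (sobol_estimator c [tuple W N i w | i < N] - psi (Q N)).
have mS N : measurable_fun setT (@S N).
  apply: measurable_funM => //; apply: measurable_funB => //.
  have mt : measurable_fun setT (fun w : Om N => [tuple W N i w | i < N]).
    apply/measurable_fun_tnthP => i.
    rewrite (_ : _ \o _ = W N i)//.
    by apply/funext => w /=; rewrite tnth_mktuple.
  exact: (measurableT_comp (measurable_sobol_estimator c (N:=N)) mt).
pose L := centered_normal v; pose F y := fine (L `]-oo, y]%classic).
have FE y : L `]-oo, y]%classic = (F y)%:E by rewrite fineK// fin_num_measure.
have cF : F y @[y --> x] --> F x.
  by apply: fine_cvg; rewrite -FE; exact: cx.
rewrite -/L FE; apply: cvg_EFin.
  by apply: nearW => N; rewrite fin_num_measure//; exact: measurable_le.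
apply/cvgrPdist_le => rho rho0.
pose r := rho / 4; have r0 : 0 < r by rewrite divr_gt0.
have [/= del del0 Fdel] : \forall y \near x, `|F x - F y| <= r.
  by move/cvgrPdist_le : cF; apply.
(* Shifts of x by at most 2 eps stay where the limit distribution function varies
   by at most r; eta is what [event_comparison] asks for with this eps. *)
pose eps := Num.min (del / 4) r.
have eps0 : 0 < eps by rewrite lt_min divr_gt0.
have epsr : eps <= r by rewrite ge_min lexx orbT.
have epsd : eps <= del / 4 by rewrite ge_min lexx.
have Fle y : `|y - x| <= 2 * eps -> `|F x - F y| <= r.
  by move=> yx; apply: Fdel; rewrite /= distrC; apply: le_lt_trans yx _; lra.
have V0 := var_gt0.
pose A := `|1 - psi P| + 2 * (`|x| + `|e| + 1).
have A0 : 0 < A by rewrite ltr_wpDl// mulr_gt0// ltr_wpDl// addr_ge0.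
pose eta := Num.min (Num.min 1 (var P / 4)) (var P * (eps / 2) / A).
have eta0 : 0 < eta by rewrite !lt_min ltr01 !divr_gt0// mulr_gt0// divr_gt0.
have eta1 : eta <= 1 by rewrite !ge_min lexx.
have etaV : eta <= var P / 4 by rewrite !ge_min lexx orbT.
have etaA : eta * A <= var P * (eps / 2).
  by rewrite -ler_pdivlMr// !ge_min lexx !orbT.
have eps2 : 0 < eps / 2 by rewrite divr_gt0.
have cs := psi_derivative_seq L2a L2b swapP var_neq0 gS.
have lu := levy_clt v0 iidW small1 err1 (x + eps) eps0.
have ll := levy_clt v0 iidW small1 err1 (x - eps) eps0.
have pC := vanishing_row_sum iidW small2 err2 eta0 r0.
have pD := vanishing_row_sum iidW small3 err3 eta0 r0.
near=> N.
have N0 : (0 < N)%N by near: N; exact: nbhs_infty_gt.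
have t0 : 0 < tN N by rewrite invr_gt0 sqrtr_gt0 ltr0n.
pose s := (psi (Q N) - psi P) / tN N.
have sE : s = Num.sqrt N%:R * (psi (tilt P g (tN N)) - psi P).
  by rewrite /s /Q invrK mulrC.
have se1 : `|s - e| <= eps / 2.
  by rewrite distrC sE; near: N; apply: (cvgrPdist_le _ _).1 cs _ _.
have se2 : `|s - e| <= 1.
  by rewrite distrC sE; near: N; apply: (cvgrPdist_le _ _).1 cs _ _.
have pCN : fine (Pr N [set w | eta < `|row_sum X2 W w|]) <= r by near: N.
have pDN : fine (Pr N [set w | eta < `|row_sum X3 W w|]) <= r by near: N.
have /andP[_ luN] : F (x + eps - eps) - eps <=
    fine (Pr N [set w | row_sum X1 W w <= x + eps]) <=
    F (x + eps + eps) + eps by near: N; exact: lu.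
have /andP[llN _] : F (x - eps - eps) - eps <=
    fine (Pr N [set w | row_sum X1 W w <= x - eps]) <=
    F (x - eps + eps) + eps by near: N; exact: ll.
pose GN (w : Om N) := row_sum X1 W w.
pose CN (w : Om N) := row_sum X2 W w.
pose DN (w : Om N) := row_sum X3 W w.
have mG : measurable_fun setT GN by exact: measurable_row_sum.
have mC : measurable_fun setT CN by exact: measurable_row_sum.
have mD : measurable_fun setT DN by exact: measurable_row_sum.
have compare w : `|CN w| <= eta -> `|DN w| <= eta ->
    (GN w <= x - eps -> S N w <= x) /\ (S N w <= x -> GN w <= x + eps).
  move=> Ce De; pose y := [tuple W N i w | i < N].
  have row (X : nat -> {mfun (R * R)%type >-> R}) :
      row_sum X W w = \sum_(i < N) X N (tnth y i).
    by apply: eq_bigr => i _; rewrite tnth_mktuple.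
  have GE : GN w = \sum_(i < N) clt_term (influence P) e (tN N) (tnth y i) by exact: row.
  have CE : CN w = \sum_(i < N) (Num.sqrt (tN N) * tN N * average_term P (tnth y i)) by exact: row.
  have DE : DN w = \sum_(i < N) (tN N ^+ 2 * (square_term P (tnth y i) - var P)) by exact: row.
  have denE := sample_denE P y N0; rewrite -CE -DE in denE.
  have numE := sample_numE y e N0 var_neq0; rewrite -CE -GE in numE.
  have [den0 h1 h2] := event_comparison V0 t0 (invsqrtn_le1 R N) eta0 eta1 etaV etaA
    (erefl s) se1 se2 Ce De denE numE.
  by rewrite /S -/y (sobol_estimatorE c den0) -[Num.sqrt _]invrK.
have mle (f : Om N -> R) z : measurable_fun setT f -> measurable [set w | f w <= z].
  exact: measurable_le.
have mlt (f : Om N -> R) : measurable_fun setT f -> measurable [set w | eta < `|f w|].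
  exact: measurable_norm_gt.
have bad w : ~ ([set w | eta < `|CN w|] `|` [set w | eta < `|DN w|]) w ->
    `|CN w| <= eta /\ `|DN w| <= eta.
  move=> nb; split; rewrite leNgt; apply/negP => h; apply: nb; by [left|right].
have mbad := measurableU _ _ (mlt _ mC) (mlt _ mD).
have pbad := le_trans (fine_probU (Pr N) (mlt _ mC) (mlt _ mD)) (lerD pCN pDN).
have up : fine (Pr N [set w | S N w <= x]) <=
    fine (Pr N [set w | GN w <= x + eps]) + (r + r).
  have sub : [set w | S N w <= x] `<=` [set w | GN w <= x + eps] `|`
      ([set w | eta < `|CN w|] `|` [set w | eta < `|DN w|]).
    move=> w Sx.
    have [b|/bad[Ce De]] := pselect (([set w | eta < `|CN w|] `|` [set w | eta < `|DN w|]) w).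
      by right.
    by left; have [_] := compare w Ce De; apply.
  apply: le_trans (fine_prob_le _ (mle _ _ (mS N)) (measurableU _ _ (mle _ _ mG) mbad) sub) _.
  by apply: le_trans (fine_probU _ (mle _ (x + eps) mG) mbad) _; rewrite lerD2l.
have down : fine (Pr N [set w | GN w <= x - eps]) <=
    fine (Pr N [set w | S N w <= x]) + (r + r).
  have sub : [set w | GN w <= x - eps] `<=` [set w | S N w <= x] `|`
      ([set w | eta < `|CN w|] `|` [set w | eta < `|DN w|]).
    move=> w Gx.
    have [b|/bad[Ce De]] := pselect (([set w | eta < `|CN w|] `|` [set w | eta < `|DN w|]) w).
      by right.
    by left; have [+ _] := compare w Ce De; apply.
  apply: le_trans (fine_prob_le _ (mle _ _ mG) (measurableU _ _ (mle _ _ (mS N)) mbad) sub) _.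
  by apply: le_trans (fine_probU _ (mle _ x (mS N)) mbad) _; rewrite lerD2l.
have eps20 : 0 <= 2 * eps by rewrite mulr_ge0// ltW.
have Fu : `|F x - F (x + eps + eps)| <= r.
  apply: Fle; have -> : x + eps + eps - x = 2 * eps by ring.
  by rewrite ger0_norm.
have Fl : `|F x - F (x - eps - eps)| <= r.
  apply: Fle; have -> : x - eps - eps - x = - (2 * eps) by ring.
  by rewrite normrN ger0_norm.
have -> : rho = 4 * r by rewrite mulrC divfK.
exact: sandwich epsr Fu Fl up down luN llN.
Unshelve. all: by end_near.
Qed.

End regularity.

(** * Conditional means by integration over one variable *)

Section almost_everywhere.
Context d (T : measurableType d) (R : realType) (P : probability T R).
Implicit Types g h : T -> R.

Lemma L1_ae g h : measurable_fun setT g -> L1 P h ->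
  {ae P, forall x, g x = h x} -> L1 P g.
Proof.
move=> mg Lh gh; have mh := L1_measurable Lh.
apply/integrableP; split; first exact/measurable_EFinP.
have [_] := integrableP _ _ _ Lh; congr (_ < _)%E.
apply: ae_eq_integral => //; last by apply: filterS gh => x /= -> _.
- by apply: measurableT_comp => //; exact/measurable_EFinP.
- by apply: measurableT_comp => //; exact/measurable_EFinP.
Qed.

Lemma E_ae g h : measurable_fun setT g -> measurable_fun setT h ->
  {ae P, forall x, g x = h x} -> \int[P]_x g x = \int[P]_x h x.
Proof.
move=> mg mh gh; rewrite /Rintegral; congr fine; apply: ae_eq_integral => //.
- exact/measurable_EFinP.
- exact/measurable_EFinP.
- by apply: filterS gh => x /= -> _.
Qed.

End almost_everywhere.

Section fubini_real.
Context d1 d2 (T1 : measurableType d1) (T2 : measurableType d2) (R : realType)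
  (mu : probability T1 R) (nu : probability T2 R).
Variable k : T1 * T2 -> R.
Hypothesis Lk : L1 (mu \x nu)%E k.

Definition partial_integral x := \int[nu]_z k (x, z).

Let F := fubini_F nu (EFin \o k).
Let mF : measurable_fun setT F.
Proof. exact: (@measurable_fubini_F _ _ _ _ _ mu nu _ Lk). Qed.
Let LF : mu.-integrable setT F.
Proof. exact: (@integrable_fubini_F _ _ _ _ _ mu nu _ Lk). Qed.

Lemma measurable_partial_integral : measurable_fun setT partial_integral.
Proof. exact: (measurableT_comp (fine_measurable measurableT) mF). Qed.

Lemma L1_partial_integral : L1 mu partial_integral.
Proof.
apply: le_integrable LF => //; first exact/measurable_EFinP/measurable_partial_integral.
move=> x _; rewrite /= /partial_integral /Rintegral -[(\int[_]_(_ in _) _)%E]/(F x).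
by case: (F x) => [r| |] //=; rewrite normr0 leey.
Qed.

Lemma E_partial_integral :
  \int[mu]_x partial_integral x = \int[(mu \x nu)%E]_v k v.
Proof.
rewrite /Rintegral; congr fine.
rewrite -[RHS](@integral12_prod_meas1 _ _ _ _ _ mu nu _ Lk).
apply: ae_eq_integral => //.
- exact/measurable_EFinP/measurable_partial_integral.
- have := integrable_ae measurableT LF; apply: filterS => x /(_ I) Fx _.
  by rewrite /= /partial_integral /Rintegral fineK.
Qed.

Lemma ae_partial_integrable : {ae mu, forall x, L1 nu (fun z => k (x, z))}.
Proof. exact: (@ae_integrable1 _ _ _ _ _ mu nu _ Lk). Qed.

End fubini_real.

(** For two independent copies z and z' of the second variable, integrating
    f(x, z) f(x, z') over both gives the square of the mean of f(x, .), for almost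
    every x. In particular integrability of the product makes the conditional mean
    square integrable. *)
Section conditional_mean.
Context d1 d2 (T1 : measurableType d1) (T2 : measurableType d2) (R : realType)
  (mu : probability T1 R) (nu : probability T2 R).
Variable f : T1 * T2 -> R.
Hypothesis Lf : L1 (mu \x nu)%E f.
Local Notation product v := (f v.1 * f (v.1.1, v.2)).
Hypothesis Lff : L1 ((mu \x nu) \x nu)%E (fun v => product v).

Let ae_sqr : {ae mu, forall x,
  partial_integral nu f x ^+ 2 =
  partial_integral nu (partial_integral nu (fun v => product v)) x}.
Proof.
have := ae_partial_integrable Lf; apply: filterS => x Lx.
rewrite [RHS]/partial_integral expr2 -(EZl _ Lx); apply: eq_Rintegral => z _.
by rewrite [RHS]/partial_integral/= (EZl _ Lx) mulrC.
Qed.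

Lemma L2_partial_integral : L2 mu (partial_integral nu f).
Proof.
have mp := measurable_partial_integral Lf; split=> //.
apply: L1_ae ae_sqr; first exact: measurable_funX.
exact: L1_partial_integral (L1_partial_integral Lff).
Qed.

Lemma E_sqr_partial_integral : \int[mu]_x (partial_integral nu f x ^+ 2) =
  \int[((mu \x nu) \x nu)%E]_v product v.
Proof.
have LFF := L1_partial_integral Lff.
rewrite -(E_partial_integral Lff) -(E_partial_integral LFF).
apply: E_ae ae_sqr; last exact: measurable_partial_integral LFF.
exact: measurable_funX (measurable_partial_integral Lf).
Qed.

End conditional_mean.

(** * Transport to the law of a variable *)

Section law.
Context d dT (Om : measurableType d) (T : measurableType dT) (R : realType)
  (Pr : probability Om R) (V : {mfun Om >-> T}) (Q : probability T R).
Hypothesis VQ : forall A, measurable A -> Pr (V @^-1` A) = Q A.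
Implicit Types h : T -> R.

Lemma integral_law (h : T -> \bar R) A : measurable A ->
  (\int[Q]_(x in A) h x = \int[distribution Pr V]_(x in A) h x)%E.
Proof. by move=> mA; apply: eq_measure_integral => B mB _; exact/esym/VQ. Qed.

Lemma L1_law h : measurable_fun setT h -> L1 Q h <-> L1 Pr (fun w => h (V w)).
Proof.
move=> mh; have mhe : measurable_fun setT (EFin \o h) by exact/measurable_EFinP.
have mn : measurable_fun setT (fun x => `|(h x)%:E|%E) by exact: measurableT_comp.
have E : (\int[Q]_x `|(h x)%:E| = \int[Pr]_w `|(h (V w))%:E|)%E.
  by rewrite integral_law// ge0_integral_distribution.
have mhV : measurable_fun setT (fun w => h (V w)) by exact: measurableT_comp.
split=> /integrableP[_ L]; apply/integrableP; split; try exact/measurable_EFinP.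
  by move: L; rewrite -[X in (X < _)%E -> _]/(\int[Q]_x `|(h x)%:E|)%E E.
by rewrite -[X in (X < _)%E]/(\int[Q]_x `|(h x)%:E|)%E E.
Qed.

Lemma E_in_law h A : measurable A -> L1 Q h ->
  (\int[Q]_(x in A) (h x)%:E = \int[Pr]_(w in V @^-1` A) (h (V w))%:E)%E.
Proof.
move=> mA Lh; have mh := L1_measurable Lh.
rewrite integral_law// integral_pushforward//; first exact/measurable_EFinP.
have LV := (L1_law mh).1 Lh.
apply: integrableS LV => //.
exact: measurable_funPTI.
Qed.

Lemma E_law h : L1 Q h -> \int[Q]_x h x = \int[Pr]_w h (V w).
Proof. by move=> Lh; rewrite /Rintegral E_in_law. Qed.

Lemma L2_law h : measurable_fun setT h -> L2 Q h <-> L2 Pr (fun w => h (V w)).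
Proof.
move=> mh; have m2 : measurable_fun setT (fun x => h x ^+ 2) by exact: measurable_funX.
split=> -[_ L]; split => //; [exact: measurableT_comp|exact/(L1_law m2)|].
exact/(L1_law m2).
Qed.

End law.

Lemma distribution_law d dT (Om : measurableType d) (T : measurableType dT)
    (R : realType) (Pr : probability Om R) (V : {mfun Om >-> T}) A :
  measurable A -> Pr (V @^-1` A) = distribution Pr V A.
Proof. by []. Qed.

(** * The law of a pick-freeze pair *)

Section pick_freeze_law.
Context d (Om : measurableType d) (R : realType) (Pr : probability Om R)
  d1 (T1 : measurableType d1) d2 (T2 : measurableType d2).
Variables (X : {RV Pr >-> T1}) (Z Z' : {RV Pr >-> T2}).
Hypothesis indep_XZ : independent Pr X Z.
Hypothesis copy_Z : forall B : set T2, measurable B ->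
  distribution Pr Z' B = distribution Pr Z B.
Hypothesis indep_Z' : independent Pr (fun w => (X w, Z w)) Z'.

Local Notation mu := (distribution Pr X).
Local Notation nu := (distribution Pr Z).

Lemma law_input E : measurable E -> Pr (paired X Z @^-1` E) = (mu \x nu)%E E.
Proof.
move=> mE; have := @joint_law _ _ _ _ _ _ _ Pr X Z mu nu setT 1 measurableT ler01 _ E mE.
rewrite setIT mule1; apply => A C mA mC.
by rewrite setIT mule1; exact: indep_XZ.
Qed.

Lemma law_frozen E : measurable E ->
  Pr (paired (paired X Z) Z' @^-1` E) = ((mu \x nu) \x nu)%E E.
Proof.
move=> mE.
have := @joint_law _ _ _ _ _ _ _ Pr (paired X Z) Z' (mu \x nu)%E nu setT 1
  measurableT ler01 _ E mE.
rewrite setIT mule1; apply => A C mA mC.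
by rewrite setIT mule1 indep_Z'// law_input//; congr (_ * _)%E; exact: copy_Z.
Qed.

Let law_rectangle A B C : measurable A -> measurable B -> measurable C ->
  Pr (X @^-1` A `&` Z' @^-1` B `&` Z @^-1` C) = (mu A * nu B * nu C)%E.
Proof.
move=> mA mB mC.
have -> : X @^-1` A `&` Z' @^-1` B `&` Z @^-1` C =
    paired X Z @^-1` (A `*` C) `&` Z' @^-1` B.
  by apply/seteqP; split=> w /=; tauto.
rewrite indep_Z'//; last exact: measurableX.
rewrite law_input ?product_measure1E//; last exact: measurableX.
rewrite -[X in (_ * X)%E]/(distribution Pr Z' B) copy_Z//.
by rewrite -muleA [(nu C * _)%E]muleC muleA.
Qed.

(** X, Z and Z' are mutually independent, and Z and Z' have the same law: exchanging
    them does not change the joint law. The event that Z lies in C is carried along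
    as the event F of [joint_law]. *)
Lemma law_swapped E : measurable E ->
  Pr (paired (paired X Z') Z @^-1` E) = ((mu \x nu) \x nu)%E E.
Proof.
move=> mE.
have := @joint_law _ _ _ _ _ _ _ Pr (paired X Z') Z (mu \x nu)%E nu setT 1
  measurableT ler01 _ E mE.
rewrite setIT mule1; apply => A C mA mC; rewrite setIT mule1.
have mZC : measurable (Z @^-1` C) by exact: measurable_funPTI.
have cE : (fine (nu C))%:E = nu C by rewrite fineK// fin_num_measure.
have fC : 0 <= fine (nu C) by rewrite fine_ge0.
have := @joint_law _ _ _ _ _ _ _ Pr X Z' mu nu (Z @^-1` C) (fine (nu C)) mZC fC _ A mA.
rewrite cE; apply => A' B' mA' mB'.
exact: law_rectangle.
Qed.

Variable f : {mfun (T1 * T2)%type >-> R}.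
Local Notation P := (distribution Pr (pick_freeze_pair f X Z Z')).

Let both (v : T1 * T2 * T2) := (f v.1, f (v.1.1, v.2)).
Let mboth : measurable_fun setT both.
Proof.
apply: measurable_fun_pair; apply: measurableT_comp => //.
apply: measurable_fun_pair => //.
by apply: measurableT_comp.
Qed.

Lemma law_pick_freeze_swap A : measurable A ->
  Pr (pick_freeze_pair f X Z' Z @^-1` A) = P A.
Proof.
move=> mA; have mE : measurable (both @^-1` A).
  by rewrite -[X in measurable X]setTI; exact: mboth.
by have := law_swapped mE; rewrite -law_frozen.
Qed.

Let measurable_swap (h : R * R -> R) : measurable_fun setT h ->
  measurable_fun setT (fun y => h (y.2, y.1)).
Proof. by move=> mh; apply: measurableT_comp => //; exact: measurable_fun_pair. Qed.

Lemma L1_swap (h : R * R -> R) : L1 P h -> L1 P (fun y => h (y.2, y.1)).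
Proof.
move=> Lh; have mh := L1_measurable Lh.
apply/(L1_law (distribution_law Pr (pick_freeze_pair f X Z Z'))).
  exact: measurable_swap.
exact/(L1_law law_pick_freeze_swap).
Qed.

Lemma E_swap (h : R * R -> R) : L1 P h ->
  \int[P]_y h (y.2, y.1) = \int[P]_y h y.
Proof.
move=> Lh; rewrite (E_law law_pick_freeze_swap Lh).
by rewrite (E_law (distribution_law Pr (pick_freeze_pair f X Z Z')))//; exact: L1_swap.
Qed.

End pick_freeze_law.

(** * Variance of the conditional expectation *)

Section variance.
Context d (T : measurableType d) (R : realType) (P : probability T R).

Lemma fine_variance (Y : T -> R) : L2 P Y ->
  fine 'V_P[Y] = \int[P]_x (Y x ^+ 2) - (\int[P]_x Y x) ^+ 2.
Proof.
move=> L2Y; have LY := L2_L1 L2Y; rewrite varianceE; last exact/L2_Lfun.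
have -> : ('E_P[(Y ^+ 2)%R] = (\int[P]_x (Y x ^+ 2))%:E)%E.
  rewrite unlock -EFinE; last exact: L2Y.2.
  by apply: eq_integral => x _; rewrite !expr2.
have -> : ('E_P[Y] = (\int[P]_x Y x)%:E)%E by rewrite unlock -EFinE.
by rewrite -EFin_expe -EFinB.
Qed.

End variance.

Section conditional_expectation.
Context d (Om : measurableType d) (R : realType) (Pr : probability Om R)
  d1 (T1 : measurableType d1) d2 (T2 : measurableType d2).
Variables (X : {RV Pr >-> T1}) (Z : {RV Pr >-> T2}).
Hypothesis indep_XZ : independent Pr X Z.
Variable f : {mfun (T1 * T2)%type >-> R}.
Hypothesis LY : L1 Pr (output f X Z).

Local Notation mu := (distribution Pr X).
Local Notation nu := (distribution Pr Z).

Let Lf : L1 (mu \x nu)%E f.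
Proof. exact/(L1_law (law_input indep_XZ)). Qed.

Let phi := partial_integral nu f.
Let mphi : measurable_fun setT phi := measurable_partial_integral Lf.
Let Lphi : L1 mu phi := L1_partial_integral Lf.

(** Fubini for the product of f with the indicator of A. *)
Lemma cond_expectation_version : is_cond_expectation Pr X (output f X Z) (phi \o X).
Proof.
split; first by exists phi.
  exact/(L1_law (distribution_law Pr X)).
move=> A mA; rewrite -(E_in_law (distribution_law Pr X))//.
pose g (v : T1 * T2) := \1_A v.1 * f v.
have mg1 : measurable_fun setT (fun v : T1 * T2 => \1_A v.1 : R).
  exact: measurableT_comp.
have Lg : L1 (mu \x nu)%E g.
  have := @L1Mb _ _ _ (mu \x nu)%E _ _ 1 Lf mg1.
  have -> : (fun v : T1 * T2 => f v * \1_A v.1) = g.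
    by apply/funext => v; rewrite mulrC.
  apply=> v; rewrite indicE; case: (_ \in _); by rewrite ?normr1 ?normr0.
have eA d' (T : measurableType d') (m : probability T R) (D : set T) (h : T -> R) :
    L1 m (fun x => \1_D x * h x) -> measurable D ->
    (\int[m]_(x in D) (h x)%:E = (\int[m]_x (\1_D x * h x))%:E)%E.
  move=> L mD; rewrite -(EFinE L) integral_mkcond; apply: eq_integral => x _.
  by rewrite patchE indicE; case: (x \in D); rewrite ?mul1r ?mul0r.
have mXA : measurable (X @^-1` A) by exact: measurable_funPTI.
have pg x : partial_integral nu g x = \1_A x * phi x.
  rewrite /phi /partial_integral /g /= indicE; case: (x \in A) => /=.
    by rewrite mul1r; apply: eq_Rintegral => z _; rewrite mul1r.
  by rewrite mul0r -[RHS](Ecst nu); apply: eq_Rintegral => z _; rewrite mul0r.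
have LgX := (L1_law (law_input indep_XZ) (L1_measurable Lg)).1 Lg.
rewrite !eA//.
- congr EFin; rewrite -[RHS](E_law (law_input indep_XZ) Lg) -(E_partial_integral Lg).
  by apply: eq_Rintegral => x _; rewrite pg.
- by have := L1_partial_integral Lg; congr (L1 mu _); apply/funext => x.
Qed.

(** Two versions have the same integrals over all the events X in E, hence agree
    almost everywhere for the law of X. This is all that is known of
    [cond_expectation], which is a choice among versions. *)
Lemma cond_expectation_unique m : is_cond_expectation Pr X (output f X Z) m ->
  exists psi : T1 -> R, [/\ measurable_fun setT psi, m = psi \o X &
    {ae mu, forall x, psi x = phi x}].
Proof.
move=> [[psi mpsi ->] Lpsi m_int]; exists psi; split=> //.
have Lp : L1 mu psi by exact/(L1_law (distribution_law Pr X)).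
have [_ _ phi_int] := cond_expectation_version.
have := @integral_ae_eq _ _ _ mu setT measurableT (EFin \o phi) (EFin \o psi) Lp.
have mphiE : measurable_fun setT (EFin \o phi) by exact/measurable_EFinP.
move=> /(_ mphiE) H.
have : ae_eq mu setT (EFin \o psi) (EFin \o phi).
  apply: H => E _ mE; rewrite (E_in_law (distribution_law Pr X) mE Lp).
  rewrite (E_in_law (distribution_law Pr X) mE Lphi).
  by rewrite [LHS]m_int// [RHS]phi_int.
by apply: filterS => x /(_ I) [].
Qed.

Hypothesis Lff : L1 ((mu \x nu) \x nu)%E (fun v => f v.1 * f (v.1.1, v.2)).

(** Var (E (Y | X)) = Cov (Y, Y^X), with the right-hand side on the product space:
    the second moment of the conditional mean is [E_sqr_partial_integral]. *)
Lemma variance_cond_expectation :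
  fine 'V_Pr[cond_expectation Pr X (output f X Z)] =
  \int[((mu \x nu) \x nu)%E]_v (f v.1 * f (v.1.1, v.2)) -
  (\int[Pr]_w output f X Z w) ^+ 2.
Proof.
have [psi [mpsi -> psi_phi]] : exists psi : T1 -> R, [/\ measurable_fun setT psi,
    cond_expectation Pr X (output f X Z) = psi \o X &
    {ae mu, forall x, psi x = phi x}].
  apply: cond_expectation_unique.
  by apply: xgetPex; exists (phi \o X); exact: cond_expectation_version.
have psi_phi2 : {ae mu, forall x, psi x ^+ 2 = phi x ^+ 2}.
  by apply: filterS psi_phi => x ->.
have mpsi2 : measurable_fun setT (fun x => psi x ^+ 2) by exact: measurable_funX.
have L2phi := L2_partial_integral Lf Lff.
have Lp : L1 mu psi by exact: L1_ae psi_phi.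
have Lp2 : L1 mu (fun x => psi x ^+ 2) by exact: L1_ae L2phi.2 psi_phi2.
rewrite fine_variance; last exact/(L2_law (distribution_law Pr X) mpsi).
rewrite -(E_law (distribution_law Pr X) Lp) -(E_law (distribution_law Pr X) Lp2).
rewrite (E_ae _ _ psi_phi)// (E_ae _ _ psi_phi2)//; last exact: measurable_funX L2phi.1.
by rewrite -(E_sqr_partial_integral Lf Lff) E_partial_integral// (E_law (law_input indep_XZ)).
Qed.

End conditional_expectation.

(** * Efficiency *)

Section efficiency.
Context (R : realType) (P : probability (R * R)%type R).
Local Notation pr1 := (fst : R * R -> R).
Local Notation pr2 := (snd : R * R -> R).
Hypotheses (L2a : L2 P pr1) (L2b : L2 P pr2).
Hypothesis swapP : forall h : R * R -> R, L1 P h ->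
  \int[P]_y h (y.2, y.1) = \int[P]_y h y.
Hypothesis var_neq0 : var P != 0.

Lemma efficient_of_L2_influence c : L2 P (influence P) ->
  asymptotically_efficient (sobol_estimator c) (@psi R) P.
Proof.
move=> L2i; exists (influence P); last exact: regular_sobol.
split; last by move=> g gS; exact: psi_derivative.
by apply: tangent_of_L2 => //; [exact: influence_swap|exact: E_influence].
Qed.

(** The candidate h and [influence] give the same derivative along every score,
    whence the same pairing. *)
Lemma L2_influence_of_efficient h : efficient_influence_function (@psi R) P h ->
  L2 P (influence P).
Proof.
move=> [[/L2_Lfun L2h _] h_derivative].
apply: (L2_of_pairing (L1_influence L2a L2b) (influence_swap P) _ L2h).
  exact: E_influence.
move=> g gS; apply: (cvg_unique _ (h_derivative g gS)) => //.
exact: psi_derivative.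
Qed.

(** The cross term is bounded by the square term, which is quadratic in the
    coordinates. *)
Lemma L2_influence_of_fourth : L2 P (fun y => y.1 ^+ 2) -> L2 P (fun y => y.2 ^+ 2) ->
  L2 P (influence P).
Proof.
move=> L2a2 L2b2; pose m := mean P.
have L2sq : L2 P (square_term P).
  have := L2D (L2B (L2Zl 2^-1 (L2D L2a2 L2b2)) (L2Zl m (L2D L2a L2b))) (L2_cst P (m ^+ 2)).
  by congr (L2 P _); apply/funext => y; rewrite /square_term -/m; field.
have L2cr : L2 P (cross_term P).
  apply: (L2_le _ L2sq); first exact: L1_measurable (L1_cross L2a L2b).
  move=> y; rewrite [leRHS]ger0_norm /cross_term /square_term; last first.
    by rewrite divr_ge0// addr_ge0// sqr_ge0.
  move: (y.1 - _) (y.2 - _) => a b; rewrite ler_norml.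
  have := sqr_ge0 (a + b); have := sqr_ge0 (a - b).
  by rewrite !expr2 => ? ?; apply/andP; split; lra.
have := L2Zl (var P)^-1 (L2B L2cr (L2Zl (psi P) L2sq)); congr (L2 P _).
by apply/funext => y; rewrite mulrC.
Qed.

End efficiency.

Theorem proposition2p5 (R : realType) (d : measure_display)
    (Om : measurableType d) (Pr : probability Om R) (p1 p2 : nat)
    (X : {RV Pr >-> p1.-tuple R}) (Z Z' : {RV Pr >-> p2.-tuple R})
    (f : {mfun (p1.-tuple R * p2.-tuple R)%type >-> R}) (c : R)
    (indep_XZ : independent Pr X Z)
    (copy_Z : forall B : set (p2.-tuple R), measurable B ->
       distribution Pr Z' B = distribution Pr Z B)
    (indep_Z' : independent Pr (fun w => (X w, Z w)) Z')
    (Y_L2 : output f X Z \in Lfun Pr 2%:E)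
    (Y_var : 'V_Pr[output f X Z] != 0%E) :
  let P := distribution Pr (pick_freeze_pair f X Z Z') in
  [/\ exchangeable_model P,
      psi P = sobol_index Pr X (output f X Z),
      (exists h, efficient_influence_function (@psi R) P h) ->
        asymptotically_efficient (sobol_estimator c) (@psi R) P &
      output f X Z \in Lfun Pr 4%:E ->
        asymptotically_efficient (sobol_estimator c) (@psi R) P].
Proof.
move=> P; pose Y := output f X Z; pose pf := pick_freeze_pair f X Z Z'.
have L2Y : L2 Pr Y by exact/L2_Lfun.
have swapL1 h : L1 P h -> L1 P (fun y => h (y.2, y.1)).
  exact: (L1_swap indep_XZ copy_Z indep_Z').
have swapP h : L1 P h -> \int[P]_y h (y.2, y.1) = \int[P]_y h y.
  exact: (E_swap indep_XZ copy_Z indep_Z').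
have L2a : L2 P fst by exact/(L2_law (distribution_law Pr pf)).
have L2b : L2 P snd by split=> //; exact: (swapL1 (fun y => y.1 ^+ 2) L2a.2).
have LY := L2_L1 L2Y; have La := L2_L1 L2a; have Lab := L2M L2a L2b.
have EY : mean P = \int[Pr]_w Y w by exact: (E_law (distribution_law Pr pf) La).
have varY : var P = fine 'V_Pr[Y].
  rewrite fine_variance// /var EY; congr (_ - _).
  exact: (E_law (distribution_law Pr pf) L2a.2).
have var_neq0 : var P != 0.
  rewrite varY; apply: contra Y_var => /eqP V0.
  by rewrite -[X in X == _]fineK ?V0//; exact: variance_fin_num.
split.
- split; [exact/L2_Lfun|exact/L2_Lfun|move=> a b].
  rewrite -[LHS](law_pick_freeze_swap indep_XZ copy_Z indep_Z'); last exact: measurableX.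
  by rewrite -[RHS]/(Pr (pf @^-1` _)); congr (Pr _); apply/seteqP; split=> w [].
- have mff : measurable_fun setT (fun v : p1.-tuple R * p2.-tuple R * p2.-tuple R =>
      f v.1 * f (v.1.1, v.2)).
    apply: measurable_funM; apply: measurableT_comp => //.
    by apply: measurable_fun_pair => //; exact: measurableT_comp.
  have Lff := (L1_law (law_frozen indep_XZ copy_Z indep_Z') mff).2
    ((L1_law (distribution_law Pr pf) (L1_measurable Lab)).1 Lab).
  rewrite psiE// /sobol_index -/Y -varY (variance_cond_expectation indep_XZ LY Lff).
  rewrite -/Y -EY -/(mean P) (mean_snd L2a swapP) -expr2; congr ((_ - _) / _).
  rewrite (E_law (distribution_law Pr pf) Lab).
  by rewrite (E_law (law_frozen indep_XZ copy_Z indep_Z') Lff).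
- by move=> [h hE]; apply: efficient_of_L2_influence => //; exact: L2_influence_of_efficient hE.
- move=> Y4; apply: efficient_of_L2_influence => //.
  have L2a2 : L2 P (fun y => y.1 ^+ 2).
    apply/(L2_law (distribution_law Pr pf)); first exact: measurable_funX.
    split; first exact: measurable_funX L2Y.1.
    have := Lfun_integrable _ Y4; rewrite ler1n => /(_ isT).
    congr (Pr.-integrable _ _); apply/funext => w; rewrite powR_mulrn//=.
    by rewrite -exprM -normrX ger0_norm// (exprM _ 2 2) sqr_ge0.
  have L2b2 : L2 P (fun y => y.2 ^+ 2).
    by split; [exact: measurable_funX|exact: (swapL1 (fun y => (y.1 ^+ 2) ^+ 2) L2a2.2)].
  exact: L2_influence_of_fourth.
Qed.
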